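(* Let $\mu$ be an arbitrary probability measure on $\mathbb{C}$ and $X_1, X_2,\ldots$ iid with distribution $\mu$. For each $n$ let $k_n$ be a deterministic integer with $0\le k_n\le n$, $k_n = o(n)$, and let $\xi_1^{(n)}, \ldots, \xi_{k_n}^{(n)}$ be a deterministic triangular array of complex numbers. Assume there is a set $E \subset \mathbb{C}$ of Lebesgue measure zero such that for every $z \in \mathbb{C}\setminus E$, \[ \limsup_{n\to\infty} \frac{1}{n}\sum_{l=1}^{k_n}\log_-|z - \xi_l^{(n)}| = 0. \] Let $p_n(z) := \prod_{j=1}^{n-k_n}(z - X_j)\prod_{l=1}^{k_n}(z - \xi_l^{(n)})$. Then $\mu'_{p_n}$ converges weakly to $\mu$ in probability as $n\to\infty$.
   Context: $\log_- x := |\log x|$ for $0 \le x \le 1$ and $\log_- x := 0$ for $x \ge 1$, with $\log_-(0) := \infty$. For a polynomial $f$ of degree $n$, $\mu_f := \frac1n\sum_{f(z)=0}\delta_z$ (with multiplicity) and $\mu'_f := \mu_{f'}$. Weak convergence in probability of random measures $\nu_n$ to $\nu$ means $\int f\,d\nu_n \to \int f\,d\nu$ in probability for every bounded continuous $f:\mathbb{C}\to\mathbb{R}$. *)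

(* Defs.v *)
From HB Require Import structures.
From mathcomp Require Import all_boot all_order all_algebra.
From mathcomp Require Import all_classical all_reals all_analysis.
From mathcomp Require Import complex.
Set Implicit Arguments. Unset Strict Implicit. Unset Printing Implicit Defensive.
Import Order.TTheory GRing.Theory Num.Theory.
Import numFieldNormedType.Exports.
Local Open Scope classical_set_scope.
Local Open Scope ring_scope.

(* The complex plane C is represented, for all measure-theoretic and
   topological purposes, by R * R (Borel sigma-algebra = product of the
   Borel sigma-algebras, product topology); for polynomial algebra we use
   the algebraically closed field R[i]. *)
Definition toC {R : realType} (z : R * R) : R[i] := Complex z.1 z.2.
Definition ofC {R : realType} (w : R[i]) : R * R := let: Complex a b := w in (a, b).

Definition cdist {R : realType} (z w : R * R) : R :=
  Num.sqrt ((z.1 - w.1) ^+ 2 + (z.2 - w.2) ^+ 2).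

Definition log_minus {R : realType} (x : R) : \bar R :=
  if x == 0 then +oo%E else if x <= 1 then (- ln x)%:E else 0%E.

(* The roots of a polynomial over the algebraically closed field R[i],
   listed with multiplicity (chosen via closed_field_poly_normal). *)
Definition rootseq {R : realType} (p : {poly R[i]}) : seq R[i] :=
  projT1 (closed_field_poly_normal p).

Definition root_measure_int {R : realType} (p : {poly R[i]}) (f : R * R -> R) : R :=
  ((size p).-1%:R)^-1 * \sum_(x <- rootseq p) f (ofC x).

Definition crit_measure_int {R : realType} (p : {poly R[i]}) (f : R * R -> R) : R :=
  root_measure_int p^`() f.

Definition bounded_continuous {R : realType} (f : R * R -> R) : Prop :=
  continuous f /\ exists M : R, forall z, `|f z| <= M.

Definition mutually_independent {R : realType} {d : measure_display}
  {T : measurableType d} (P : probability T R) (X : nat -> T -> R * R) : Prop :=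
  forall (J : seq nat) (A : nat -> set (R * R)), uniq J ->
    (forall j, j \in J -> measurable (A j)) ->
    P (\big[setI/setT]_(j <- J) (X j @^-1` A j)) =
    (\prod_(j <- J) P (X j @^-1` A j))%E.

(* Convergence in probability of real-valued functions Y n on (T, P) to the
   constant c: for every eps > 0 the event {|Y n - c| >= eps} has
   probability tending to 0.  (Stated with measurable envelopes B n of these
   events, so that no measurability of the event needs to be presupposed;
   this is the usual definition whenever the events are measurable.) *)
Definition cvg_in_probability {R : realType} {d : measure_display}
  {T : measurableType d} (P : probability T R) (Y : nat -> T -> R) (c : R) : Prop :=
  forall eps : R, 0 < eps ->
    exists B : nat -> set T,
      (forall n, measurable (B n)) /\
      (forall n, [set w | eps <= `|Y n w - c|] `<=` B n) /\
      (fun n => P (B n)) @ \oo --> 0%E.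

(* Main.v *)
Require Import Defs.
From HB Require Import structures.
From mathcomp Require Import all_boot all_order all_algebra.
From mathcomp Require Import all_classical all_reals all_analysis.
From mathcomp Require Import complex measurable_realfun.
From mathcomp Require Import ring lra.
Import Order.TTheory GRing.Theory Num.Theory.
Import numFieldNormedType.Exports.
Local Open Scope classical_set_scope.
Local Open Scope ring_scope.
Import ComplexField.Normc.
Set Implicit Arguments. Unset Strict Implicit. Unset Printing Implicit Defensive.

(** Let p be the product of the (X - x_i), L(z) = sum_i 1/(z - x_i) = p'/p and
    V(z) = sum_i 1/(z - x_i)^2 = -L'. Then p''/p' = L - V/L, so the Cauchy
    transforms of the root measures of p' and of p differ by
    L/(n(n-1)) - V/((n-1)L). This is small wherever sum_i |z - x_i|^(-3/2) is not
    too large and |L| is not too small; elsewhere it is controlled by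
    integrability of |z - x|^(-1), provided that the exceptional set has small
    area. The integral of the Cauchy kernel along the boundary of a square is
    the winding number, so after averaging over the centres of small squares
    the L^1 norm of the difference of the transforms on a box bounds the
    difference of the integrals of a uniformly continuous function.
    For fixed z, a Fourier-analytic anticoncentration estimate makes |L(z)|
    small with probability tending to 0, unless 1/(z - X_1) is constant; in
    that case mu is a point mass, and L(z) has order n off a set of small area.
    The empirical measure of the x_i converges to mu by the law of large
    numbers. *)

(** * The logarithmic derivative at critical points *)

(** The summands of V have the exponent 2, which is not locally integrable in the plane, so V cannot
    be bounded in mean. Hence the detour through an exponent p between 1 and 2. Since p < 2, W =
    sum_i |z - x_i|^(-p) is little more than n off a set of small area, and comparison of l^p norms
    gives |V| <= W^(2/p). Since p > 1, the kernel |z - x|^(-1) is uniformly integrable over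
    exceptional sets. For p = 3/2 this makes V of order little more than n^(4/3), so V/(nL) is small
    once |L| is somewhat larger than n^(1/3); anticoncentration makes |L| improbable below any scale
    slightly under n^(1/2), which leaves room.

    The anticoncentration bound is uniform in translations of the sum, and the deterministic points
    enter L only as a translation. Estimates at each fixed z suffice: Tonelli turns small
    probabilities into a small expected area. Squares are convenient because, as the centre varies,
    every point of a side sweeps a translate of the box of centres. *)

Section log_derivative.
Context {F : fieldType}.
Implicit Types (s : seq F) (z : F).

Let prodX s : {poly F} := \prod_(x <- s) ('X - x%:P).

Lemma horner_deriv_prodXsub s z : (prodX s).[z] != 0 ->
  (prodX s)^`().[z] = (prodX s).[z] * \sum_(x <- s) (z - x)^-1.
Proof.
rewrite /prodX; elim: s => [|a s IH]; first by rewrite !big_nil derivC horner0 mulr0.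
rewrite !big_cons hornerM mulf_eq0 negb_or !hornerE => /andP[za pz].
rewrite derivM derivXsubC mul1r !hornerE IH// mulrDr mulrAC divff// mul1r.
by rewrite mulrA.
Qed.

Lemma horner_deriv2_prodXsub s z : (prodX s).[z] != 0 ->
  (prodX s)^`()^`().[z] = (prodX s).[z] *
    ((\sum_(x <- s) (z - x)^-1) ^+ 2 - \sum_(x <- s) (z - x)^-1 ^+ 2).
Proof.
elim: s => [|a s IH].
  by rewrite /prodX !big_nil derivC deriv0 horner0 expr0n subrr mulr0.
rewrite /prodX !big_cons hornerM mulf_eq0 negb_or !hornerE => /andP[za pz].
rewrite derivM derivXsubC mul1r derivD derivM derivXsubC mul1r !hornerE IH//.
rewrite horner_deriv_prodXsub// -/(prodX s).
by rewrite /=; field.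
Qed.

Lemma prodXsub_deriv_neq0 s z : (prodX s).[z] != 0 ->
  \sum_(x <- s) (z - x)^-1 != 0 -> (prodX s)^`().[z] != 0.
Proof. by move=> pz Lz; rewrite horner_deriv_prodXsub// mulf_neq0. Qed.

End log_derivative.

Section critical_points.
Context {R : realType}.
Implicit Types (p : {poly R[i]}) (s : seq R[i]).

Lemma rootseqE p : p = lead_coef p *: \prod_(x <- rootseq p) ('X - x%:P).
Proof. exact: (projT2 (closed_field_poly_normal p)). Qed.

Lemma size_rootseq p : p != 0 -> size (rootseq p) = (size p).-1.
Proof.
move=> p0; rewrite [in RHS](rootseqE p) size_scale ?lead_coef_eq0//.
by rewrite size_prod_XsubC.
Qed.

(** For nonempty [s] the leading coefficient of the derivative is [size s], nonzero in
    characteristic 0. *)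
Lemma size_deriv_prodXsub s :
  size (\prod_(x <- s) ('X - x%:P))^`() = size s.
Proof.
set p := \prod_(x <- s) _.
have sp : size p = (size s).+1 by rewrite size_prod_XsubC.
have lp : p`_(size s) = 1.
  have := monic_prod_XsubC s predT id.
  by rewrite -/p monicE lead_coefE sp /= => /eqP.
have [/size0nil s0|s0] := posnP (size s).
  by rewrite s0 /p s0 big_nil derivC size_poly0.
rewrite /deriv sp /= size_poly_eq// prednK// lp.
by rewrite pnatr_eq0 -lt0n.
Qed.

(* p'' / p' = L - V / L, where L = p' / p and V = - L'. *)
Lemma sum_rootseq_deriv s z : (\prod_(x <- s) ('X - x%:P)).[z] != 0 ->
    \sum_(x <- s) (z - x)^-1 != 0 ->
  \sum_(x <- rootseq (\prod_(x <- s) ('X - x%:P))^`()) (z - x)^-1 =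
  \sum_(x <- s) (z - x)^-1 -
  (\sum_(x <- s) (z - x)^-1 ^+ 2) / (\sum_(x <- s) (z - x)^-1).
Proof.
move=> pz Lz; set p := \prod_(x <- s) _.
have p'z : p^`().[z] != 0 by exact: prodXsub_deriv_neq0.
pose q := \prod_(x <- rootseq p^`()) ('X - x%:P).
have p'E : p^`() = lead_coef p^`() *: q by exact: rootseqE.
have l0 : lead_coef p^`() != 0.
  by apply: contraNneq p'z => l0; rewrite p'E l0 scale0r horner0.
have qz : q.[z] != 0.
  by apply: contraNneq p'z => q0; rewrite p'E hornerZ q0 mulr0.
(* The second derivative at [z] is computed twice: from the roots of [p], and as [p'] times the sum
   over the roots of [p']. *)
have := horner_deriv2_prodXsub pz; rewrite -/p p'E derivZ hornerZ.
rewrite horner_deriv_prodXsub// mulrA -hornerZ -p'E.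
rewrite horner_deriv_prodXsub// -/p -mulrA => /(mulfI pz) H.
apply: (mulfI Lz); rewrite H mulrBr -expr2 mulrCA divff// mulr1.
by [].
Qed.

End critical_points.

(** * The Cauchy kernel in real coordinates *)

Section cauchy_kernel.
Context {R : realType}.
Implicit Types (z w : R * R) (s : seq (R * R)).

Definition invdist z w : R := (cdist z w)^-1.

(** The pair ([kre], [kim]) is the gradient in [z] of log |z - w|, and [kre - i kim] is 1/(z - w).
    Both vanish at [z = w], by the convention on division by 0. *)
Definition kre z w : R := (z.1 - w.1) / ((z.1 - w.1) ^+ 2 + (z.2 - w.2) ^+ 2).

Definition kim z w : R := (z.2 - w.2) / ((z.1 - w.1) ^+ 2 + (z.2 - w.2) ^+ 2).

(** This is |z - w|^(-3/2). *)
Definition invdist32 z w : R := invdist z w * Num.sqrt (invdist z w).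

Lemma toC_inj : injective (@toC R).
Proof. by move=> [a b] [c d] [-> ->]. Qed.

Lemma ofCK : cancel (@ofC R) toC. Proof. by case. Qed.

Lemma inv_toC z w : (toC z - toC w)^-1 = Complex (kre z w) (- kim z w).
Proof.
case: z w => [a b] [c d]; reflexivity.
Qed.

Lemma sum_inv_toC s z : \sum_(x <- s) (toC z - toC x)^-1 =
  Complex (\sum_(x <- s) kre z x) (- \sum_(x <- s) kim z x).
Proof.
elim: s => [|a s IH]; first by rewrite !big_nil oppr0.
by rewrite !big_cons IH inv_toC opprD.
Qed.

Lemma normc_inv_toC z w : normc (toC z - toC w)^-1 = invdist z w.
Proof.
rewrite normcV; congr (_^-1); case: z w => [a b] [c d]; reflexivity.
Qed.

Lemma invdist_ge0 z w : 0 <= invdist z w.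
Proof. by rewrite invr_ge0 sqrtr_ge0. Qed.

Lemma invdist32_ge0 z w : 0 <= invdist32 z w.
Proof. by rewrite mulr_ge0 ?invdist_ge0 ?sqrtr_ge0. Qed.

Lemma abs_Re_normc (x : R[i]) : `|complex.Re x| <= normc x.
Proof.
case: x => a b /=; rewrite -sqrtr_sqr ler_wsqrtr// lerDl sqr_ge0//.
Qed.

Lemma abs_Im_normc (x : R[i]) : `|complex.Im x| <= normc x.
Proof.
case: x => a b /=; rewrite -sqrtr_sqr ler_wsqrtr// lerDr sqr_ge0//.
Qed.

Lemma kre_le z w : `|kre z w| <= invdist z w.
Proof. by rewrite -normc_inv_toC inv_toC (abs_Re_normc (Complex _ _)). Qed.

Lemma kim_le z w : `|kim z w| <= invdist z w.
Proof.
by rewrite -normc_inv_toC inv_toC -normrN (abs_Im_normc (Complex _ _)).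
Qed.

Lemma normc_sum (I : Type) (r : seq I) (F : I -> R[i]) :
  normc (\sum_(i <- r) F i) <= \sum_(i <- r) normc (F i).
Proof.
elim: r => [|a r IH]; first by rewrite !big_nil normc0.
by rewrite !big_cons (le_trans (le_normcD _ _))// lerD2l.
Qed.

Lemma invdist_le z w : invdist z w <= 1 + invdist32 z w.
Proof.
rewrite /invdist32; have := invdist_ge0 z w; set u := invdist z w => u0.
have [u1|u1] := leP u 1.
  by rewrite (le_trans u1)// lerDl mulr_ge0 ?sqrtr_ge0.
rewrite (@le_trans _ _ (u * Num.sqrt u))// ?lerDr//.
by rewrite ler_peMr// -sqrtr1 ler_wsqrtr// ltW.
Qed.

(** Let r_x be the square root of [invdist z x]. A sum of r_x^3 at most tau^3 forces every r_x <=
    tau, so r_x^4 <= tau r_x^3. *)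
Lemma sum_sqr_invdist_le s z (tau : R) : 0 <= tau ->
    \sum_(x <- s) invdist32 z x <= tau ^+ 3 ->
  \sum_(x <- s) invdist z x ^+ 2 <= tau ^+ 4.
Proof.
move=> tau0 Ws.
suff H : \sum_(x <- s) invdist z x ^+ 2 <= \sum_(x <- s) invdist32 z x * tau.
  by rewrite (le_trans H)// -mulr_suml exprSr ler_wpM2r.
rewrite big_seq [leRHS]big_seq; apply: ler_sum => x xs.
rewrite /invdist32 -{1}[invdist z x]sqr_sqrtr ?invdist_ge0//.
set r := Num.sqrt _; have r0 : 0 <= r by exact: sqrtr_ge0.
have r3 : r ^+ 3 <= tau ^+ 3.
  apply: le_trans Ws; rewrite (big_rem x)//=.
  rewrite [in leRHS]/invdist32 -/r -{1}[invdist z x]sqr_sqrtr ?invdist_ge0//.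
  by rewrite -/r -exprSr lerDl sumr_ge0// => y _; exact: invdist32_ge0.
have rt : r <= tau by rewrite -(@ler_pXn2r _ 3).
rewrite -[invdist z x]sqr_sqrtr ?invdist_ge0// -/r.
rewrite (_ : r ^+ 2 ^+ 2 = r ^+ 2 * r * r); last by ring.
by rewrite ler_wpM2l// mulr_ge0// exprn_ge0.
Qed.

Definition crit_points s : seq (R * R) :=
  map ofC (rootseq (\prod_(x <- s) ('X - (toC x)%:P))^`()).

Lemma size_crit_points s : (0 < size s)%N ->
  size (crit_points s) = (size s).-1.
Proof.
move=> s0; rewrite size_map.
have := @size_deriv_prodXsub _ (map toC s); rewrite big_map size_map => sz.
by rewrite size_rootseq ?sz// -size_poly_eq0 sz -lt0n.
Qed.

(** The two terms of [g] bound L/(n(n-1)) and V/((n-1)L): |L| <= n + tau^3 follows from u <= 1 +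
    u^(3/2), and |V| <= tau^4 from [sum_sqr_invdist_le]. The lower bound is asked of one coordinate
    of L because anticoncentration is applied to real-valued sums. *)
Lemma crit_transform_le s z (tau t : R) : (1 < size s)%N -> 0 <= tau -> 0 < t ->
    z \notin s -> \sum_(x <- s) invdist32 z x <= tau ^+ 3 ->
    t < `|\sum_(x <- s) kre z x| \/ t < `|\sum_(x <- s) kim z x| ->
  let n := (size s)%:R in
  let g := (n + tau ^+ 3) / (n * (n - 1)) + tau ^+ 4 / ((n - 1) * t) in
  `|(n - 1)^-1 * \sum_(x <- crit_points s) kre z x
     - n^-1 * \sum_(x <- s) kre z x| <= g /\
  `|(n - 1)^-1 * \sum_(x <- crit_points s) kim z x
     - n^-1 * \sum_(x <- s) kim z x| <= g.
Proof.
move=> s1 tau0 t0 zs Ws Lt n g.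
have n1 : 1 < n by rewrite ltr1n.
pose L : R[i] := \sum_(x <- s) (toC z - toC x)^-1.
have LE : L = Complex (\sum_(x <- s) kre z x) (- \sum_(x <- s) kim z x).
  exact: sum_inv_toC.
have tL : t < normc L.
  case: Lt => h; apply: (lt_le_trans h); rewrite LE.
    exact: (abs_Re_normc (Complex _ _)).
  by rewrite -normrN; exact: (abs_Im_normc (Complex _ _)).
have L0 : L != 0.
  by apply/eqP => L0; move: tL; rewrite L0 normc0 ltNge (ltW t0).
pose V : R[i] := \sum_(x <- s) (toC z - toC x)^-1 ^+ 2.
have pz : (\prod_(x <- s) ('X - (toC x)%:P)).[toC z] != 0.
  rewrite -rootE -(big_map toC xpredT (fun x => 'X - x%:P)).
  by rewrite root_prod_XsubC mem_map//; exact: toC_inj.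
have crE : \sum_(r <- crit_points s) (toC z - toC r)^-1 = L - V / L.
  rewrite /crit_points big_map.
  rewrite (eq_bigr (fun r => (toC z - r)^-1)); last by move=> r _; rewrite ofCK.
  have := @sum_rootseq_deriv _ (map toC s) (toC z); rewrite !big_map.
  by apply.
pose nC : R[i] := n%:C%C.
have nCE (a b c d : R) : (n - 1)^-1%:C%C * (Complex a b) - n^-1%:C%C * Complex c d =
    Complex ((n - 1)^-1 * a - n^-1 * c) ((n - 1)^-1 * b - n^-1 * d).
  by simpc.
have DE : Complex
    ((n - 1)^-1 * \sum_(x <- crit_points s) kre z x - n^-1 * \sum_(x <- s) kre z x)
    ((n - 1)^-1 * (- \sum_(x <- crit_points s) kim z x) - n^-1 * (- \sum_(x <- s) kim z x))
    = ((n * (n - 1))^-1)%:C%C * L - (n - 1)^-1%:C%C * (V / L).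
  rewrite -nCE -!sum_inv_toC crE -/L.
  have -> : ((n * (n - 1))^-1)%:C%C = (n - 1)^-1%:C%C - n^-1%:C%C :> R[i].
    rewrite -rmorphB; congr (_%:C%C); field.
    by rewrite !gt_eqF//; lra.
  ring.
set D := Complex _ _ in DE.
have normcR (a : R) : 0 <= a -> normc (a%:C%C : R[i]) = a.
  by move=> a0; rewrite /= expr0n/= addr0 sqrtr_sqr ger0_norm.
have LN : normc L <= n + tau ^+ 3.
  rewrite (le_trans (normc_sum _ _))//.
  under eq_bigr do rewrite normc_inv_toC.
  rewrite (@le_trans _ _ (\sum_(x <- s) (1 + invdist32 z x)))//.
    by apply: ler_sum => x _; exact: invdist_le.
  rewrite big_split/= lerD//.
  by rewrite big_const_seq count_predT iter_addr addr0.
have VN : normc V <= tau ^+ 4.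
  rewrite (le_trans (normc_sum _ _))//.
  under eq_bigr do rewrite expr2 normcM normc_inv_toC -expr2.
  exact: sum_sqr_invdist_le.
have Dg : normc D <= g.
  rewrite DE (le_trans (le_normcD _ _))// normcN !normcM !normcR; last 2 first.
  - by rewrite invr_ge0; lra.
  - by rewrite invr_ge0 mulr_ge0//; lra.
  rewrite lerD//.
    by rewrite mulrC ler_wpM2r// invr_ge0 mulr_ge0//; lra.
  have n10 : 0 <= (n - 1)^-1 by rewrite invr_ge0; lra.
  have normc_ge0 (x : R[i]) : 0 <= normc x by case: x => *; exact: sqrtr_ge0.
  rewrite normcV invfM mulrCA ler_pM ?mulr_ge0 ?invr_ge0//.
  by lra.
  by rewrite ler_wpM2l// lef_pV2 ?posrE// ?ltW// (lt_trans t0).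
split; apply: le_trans Dg; first exact: (abs_Re_normc D).
rewrite -normrN; apply: le_trans (abs_Im_normc D).
by rewrite /D /= !mulrN opprD.
Qed.

End cauchy_kernel.

(** * Winding number of a square *)

Section square_winding.
Context {R : realType}.
Local Notation leb := (@lebesgue_measure R).
Implicit Types (a b x y e k : R) (z w c : R * R).

Lemma atanD_inv x : 0 < x -> atan x + atan x^-1 = pi / 2.
Proof.
move=> x0; have /andP[ax1 ax2] : 0 < atan x < pi / 2.
  by rewrite atan_ltpi2 -(@atan0 R) lt_atan.
have : atan (tan (pi / 2 - atan x)) = pi / 2 - atan x.
  by rewrite tanK// in_itv/=; lra.
rewrite /tan -[pi / 2 - _]opprB sinN cosN cosBpihalf sinBpihalf opprK.
have -> : cos (atan x) / sin (atan x) = x^-1.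
  by rewrite -[in RHS](atanK x) /tan invf_div.
by move=> ->; lra.
Qed.

(** Each corner of a square contributes one arctangent from each of its two sides; their sum depends
    only on the quadrant of the corner relative to the pole of the kernel. *)
Lemma atan_div_swap a b : a != 0 -> b != 0 ->
  atan (b / a) + atan (a / b) = pi / 2 * Num.sg a * Num.sg b.
Proof.
move=> a0 b0; have H x y : x != 0 -> y != 0 -> 0 < x * y ->
    atan (y / x) + atan (x / y) = pi / 2.
  move=> x0 y0 xy; rewrite -[x / y]invf_div atanD_inv//.
  rewrite (_ : y / x = x * y / x ^+ 2); last by field.
  by rewrite divr_gt0// exprn_even_gt0.
rewrite -mulrA -sgrM; have [ab|ab] := ltP 0 (a * b).
  by rewrite H// gtr0_sg// mulr1.
have {}ab : a * b < 0 by rewrite lt_neqAle ab mulf_neq0.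
rewrite ltr0_sg// mulrN1 -(@H (- a) b) ?oppr_eq0//; last by rewrite mulNr oppr_gt0.
by rewrite invrN mulrN !mulNr !atanN opprD !opprK.
Qed.

Lemma continuous_div_sqrD k b : k != 0 ->
  continuous (fun t : R => k / (k ^+ 2 + (t + b) ^+ 2)).
Proof.
move=> k0 t; apply: cvgM; first exact: cvg_cst.
apply: cvgV.
  by rewrite gt_eqF// ltr_pwDl ?sqr_ge0// exprn_even_gt0.
apply: cvgD; first exact: cvg_cst.
rewrite expr2; under eq_cvg do rewrite expr2.
by apply: cvgM; (apply: cvgD; [exact: cvg_id|exact: cvg_cst]).
Qed.

Lemma Rintegral_div_sqrD k b e : k != 0 -> 0 < e ->
  \int[leb]_(t in `[- e, e]) (k / (k ^+ 2 + (t + b) ^+ 2)) =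
  atan ((e + b) / k) - atan ((- e + b) / k).
Proof.
move=> k0 e0; pose F t := atan ((t + b) / k).
have dF (t : R) : is_derive t 1 F (k / (k ^+ 2 + (t + b) ^+ 2)).
  rewrite (_ : F = atan \o (fun t => (t + b) * k^-1))//.
  have -> : k / (k ^+ 2 + (t + b) ^+ 2) =
      (1 + ((t + b) * k^-1) ^+ 2)^-1 * k^-1.
    have h : k ^+ 2 + (t + b) ^+ 2 != 0.
      by rewrite gt_eqF// ltr_pwDl ?sqr_ge0// exprn_even_gt0.
    field.
    by rewrite k0.
  apply: (@is_derive1_comp _ atan (fun t => (t + b) * k^-1)).
  apply: is_derive_eq.
  by rewrite addr0 /GRing.scale /= !(mulr0, mulr1, add0r, addr0).
have cF (t : R) : {for t, continuous F}.
  by apply: differentiable_continuous; apply/derivable1_diffP; have [] := dF t.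
rewrite /Rintegral (@continuous_FTC2 _ _ F)////.
- by rewrite gtrN.
- by apply: continuous_subspaceT; exact: continuous_div_sqrD.
- split; first by move=> t _; have [] := dF t.
  + apply: cvg_at_right_filter; exact: cF.
  + apply: cvg_at_left_filter; exact: cF.
- by move=> t _; rewrite derive1E; apply: derive_val.
Qed.

Definition sq e c w : bool := (`|w.1 - c.1| < e) && (`|w.2 - c.2| < e).

(** The left side is the outward flux of the gradient of log |z - w|. Each side of the square gives
    a difference of two arctangents; regrouped by corners, they become pi/2 times a product of two
    differences of signs. The hypotheses keep [w] off the four lines that carry the sides, so no
    denominator vanishes identically. *)
Lemma square_winding e c w : 0 < e ->
    w.1 != c.1 + e -> w.1 != c.1 - e -> w.2 != c.2 + e -> w.2 != c.2 - e ->
  \int[leb]_(t in `[- e, e]) kre (c.1 + e, c.2 + t) w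
  - \int[leb]_(t in `[- e, e]) kre (c.1 - e, c.2 + t) w
  + \int[leb]_(t in `[- e, e]) kim (c.1 + t, c.2 + e) w
  - \int[leb]_(t in `[- e, e]) kim (c.1 + t, c.2 - e) w
  = 2 * pi * (sq e c w)%:R.
Proof.
move=> e0 h1 h2 h3 h4.
set p := c.1 + e - w.1; set q := c.1 - e - w.1.
set r := c.2 + e - w.2; set s := c.2 - e - w.2.
have p0 : p != 0 by rewrite subr_eq0 eq_sym.
have q0 : q != 0 by rewrite subr_eq0 eq_sym.
have r0 : r != 0 by rewrite subr_eq0 eq_sym.
have s0 : s != 0 by rewrite subr_eq0 eq_sym.
have I1 k : k - w.1 != 0 -> \int[leb]_(t in `[- e, e]) kre (k, c.2 + t) w =
    atan (r / (k - w.1)) - atan (s / (k - w.1)).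
  move=> k0; rewrite /r /s (_ : c.2 + e - w.2 = e + (c.2 - w.2)); last by ring.
  rewrite (_ : c.2 - e - w.2 = - e + (c.2 - w.2)); last by ring.
  rewrite -Rintegral_div_sqrD//; apply: eq_Rintegral => t _; rewrite /kre /=.
  by congr (_ / _); ring.
have I2 k : k - w.2 != 0 -> \int[leb]_(t in `[- e, e]) kim (c.1 + t, k) w =
    atan (p / (k - w.2)) - atan (q / (k - w.2)).
  move=> k0; rewrite /p /q (_ : c.1 + e - w.1 = e + (c.1 - w.1)); last by ring.
  rewrite (_ : c.1 - e - w.1 = - e + (c.1 - w.1)); last by ring.
  rewrite -Rintegral_div_sqrD//; apply: eq_Rintegral => t _; rewrite /kim /=.
  by congr (_ / _); ring.
rewrite !I1// !I2// -/p -/q -/r -/s.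
have := atan_div_swap p0 r0; have := atan_div_swap p0 s0.
have := atan_div_swap q0 r0; have := atan_div_swap q0 s0.
move=> A1 A2 A3 A4.
have -> : atan (r / p) - atan (s / p) - (atan (r / q) - atan (s / q)) +
    (atan (p / r) - atan (q / r)) - (atan (p / s) - atan (q / s)) =
    pi / 2 * ((Num.sg p - Num.sg q) * (Num.sg r - Num.sg s)).
  transitivity (pi / 2 * Num.sg p * Num.sg r - pi / 2 * Num.sg p * Num.sg s
    - pi / 2 * Num.sg q * Num.sg r + pi / 2 * Num.sg q * Num.sg s); last by ring.
  rewrite -A1 -A2 -A3 -A4; ring.
(* The signed distances to two opposite sides have opposite signs exactly when [w] lies between
   these sides. *)
have sgE x y u v : x = u + e - v -> y = u - e - v -> x != 0 -> y != 0 ->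
    Num.sg x - Num.sg y = 2 * (`|v - u| < e)%R%:R.
  move=> xE yE x0 y0; rewrite ltr_norml.
  have [xp|xn|/eqP] := ltrgt0P x; last by rewrite (negbTE x0).
  - have -> : v - u < e by lra.
    rewrite andbT; have [yp|yn|/eqP] := ltrgt0P y; last by rewrite (negbTE y0).
      by rewrite !gtr0_sg// subrr (_ : _ < _ = false) ?mulr0//; apply/negbTE; rewrite -leNgt; lra.
    by rewrite gtr0_sg// ltr0_sg// (_ : _ < _ = true) ?mulr1 ?opprK//; lra.
  - have -> : v - u < e = false by apply/negbTE; rewrite -leNgt; lra.
    by rewrite andbF mulr0 !ltr0_sg ?subrr//; lra.
rewrite (sgE p q c.1 w.1)// (sgE r s c.2 w.2)// /sq -mulnb natrM.
by field.
Qed.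

End square_winding.

(** * Area on the plane *)

(* The library gives product measures a sigma-finite structure only when the
   factors are finite; [area] is a copy of the product carrying that structure. *)
Definition area {R : realType} :
    set (measurableTypeR R * measurableTypeR R) -> \bar R :=
  ((@lebesgue_measure R) \x (@lebesgue_measure R))%E.

HB.instance Definition _ (R : realType) := Measure.copy (@area R)
  ((@lebesgue_measure R) \x (@lebesgue_measure R))%E.

Lemma area_sigma_finite (R : realType) : sigma_finite setT (@area R).
Proof.
have /sigma_finiteP[F [TF ndF Foo]] := sigma_finiteT (@lebesgue_measure R).
exists (fun n => F n `*` F n).
  rewrite -setXTT TF predeqE => -[x y]; split.
    move=> [/= [n _ Fnx] [k _ Fky]]; exists (maxn n k) => //; split.
    - by move: x Fnx; exact/subsetPset/ndF/leq_maxl.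
    - by move: y Fky; exact/subsetPset/ndF/leq_maxr.
  by move=> [n _ []/= ? ?]; split; exists n.
move=> k; have [mF F_fin] := Foo k; split; first exact: measurableX.
by rewrite /area product_measure1E// lte_mul_pinfty// ge0_fin_numE.
Qed.

HB.instance Definition _ (R : realType) :=
  Measure_isSigmaFinite.Build _ _ _ (@area R) (@area_sigma_finite R).

Lemma areaX (R : realType) (A B : set R) : measurable A -> measurable B ->
  area (A `*` B) = (lebesgue_measure A * lebesgue_measure B)%E.
Proof. by move=> mA mB; rewrite /area /= product_measure1E. Qed.

Lemma integral_area (R : realType) (f : R * R -> \bar R) :
  measurable_fun setT f -> (forall x, 0 <= f x)%E ->
  (\int[area]_z f z =
   \int[lebesgue_measure]_x \int[lebesgue_measure]_y f (x, y))%E.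
Proof.
move=> mf f0.
exact: (@fubini_tonelli1 _ _ _ _ _ (@lebesgue_measure R) (@lebesgue_measure R) f).
Qed.

(** * Translation invariance of the area *)

Section translation.
Context {R : realType}.
Local Notation leb := (@lebesgue_measure R).

Lemma measurable_addr (a : R) : measurable_fun setT (fun x : R => x + a).
Proof. exact: measurable_funD. Qed.

Lemma lebesgue_measure_shift (a : R) (A : set R) : measurable A ->
  pushforward leb (fun x : measurableTypeR R => x + a : measurableTypeR R) A = leb A.
Proof.
move=> mA; apply/esym/lebesgue_measure_unique => //=; first exact: measurable_addr.
move=> _ _ [[u v]] _ <-.
rewrite /pushforward (_ : _ @^-1` _ = `]u - a, v - a]%classic); last first.
  by apply/seteqP; split => x /=; rewrite !in_itv/= ltrBlDr lerBrDr.
rewrite !lebesgue_measure_itv/= !lte_fin ltrD2r.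
by rewrite -!EFinB; case: ifPn => // _; congr (_%:E); ring.
Qed.

Lemma ge0_integral_shift (a : R) (f : R -> \bar R) :
  measurable_fun setT f -> (forall x, 0 <= f x)%E ->
  (\int[leb]_x f (x + a)%R = \int[leb]_x f x)%E.
Proof.
move=> mf f0.
pose sh (x : measurableTypeR R) : measurableTypeR R := x + a.
have msh : measurable_fun setT sh by exact: measurable_addr.
transitivity (\int[pushforward leb sh]_x f x)%E.
  by rewrite ge0_integral_pushforward.
by apply: eq_measure_integral => //= A mA _; exact: lebesgue_measure_shift.
Qed.

Lemma ge0_integral2_shift (a b : R) (f : R * R -> \bar R) :
  measurable_fun setT f -> (forall x, 0 <= f x)%E ->
  (\int[area]_z f (z.1 + a, z.2 + b)%R = \int[area]_z f z)%E.
Proof.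
move=> mf f0.
have msh : measurable_fun setT (fun z : R * R => (z.1 + a, z.2 + b)).
  by apply: measurable_fun_pair; exact: measurable_funD.
rewrite !integral_area//; last exact: measurableT_comp.
rewrite /=.
rewrite -(@ge0_integral_shift a (fun x => \int[leb]_y f (x, y))%E); last 2 first.
- exact: measurable_fun_fubini_tonelli_F.
- by move=> x; exact: integral_ge0.
apply: eq_integral => x _.
rewrite -(@ge0_integral_shift b (fun y => f (x + a, y)))//.
exact/measurable_fun_pair2.
Qed.

End translation.

(** * Joint measurability of the kernels *)

Section measurability_kernels.
Context {R : realType}.
Implicit Types (A : R) (z w : R * R).

(** On nonnegative reals the inverse is the power with exponent -1, including the value 0 at 0. *)
Lemma measurable_funV d (T : measurableType d) (f : T -> R) :
  measurable_fun setT f -> (forall x, 0 <= f x) ->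
  measurable_fun setT (fun x => (f x)^-1).
Proof.
move=> mf f0; rewrite (_ : (fun _ => _) = (@powR R ^~ (-1)) \o f).
  exact: measurableT_comp.
by apply/funext => x /=; rewrite powR_inv1.
Qed.

Lemma measurable_sqrt : measurable_fun setT (@Num.sqrt R).
Proof. by apply: continuous_measurable_fun; exact: sqrt_continuous. Qed.

Let den (p : (R * R) * (R * R)) : R := (p.1.1 - p.2.1) ^+ 2 + (p.1.2 - p.2.2) ^+ 2.

Let mx : measurable_fun setT (fun p : (R * R) * (R * R) => p.1.1 - p.2.1).
Proof.
by apply: measurable_funB; apply: measurableT_comp.
Qed.

Let my : measurable_fun setT (fun p : (R * R) * (R * R) => p.1.2 - p.2.2).
Proof.
by apply: measurable_funB; apply: measurableT_comp.
Qed.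

Let mden : measurable_fun setT den.
Proof. by apply: measurable_funD; apply: measurable_funX. Qed.

Let den0 p : 0 <= den p. Proof. by rewrite addr_ge0 ?sqr_ge0. Qed.

Lemma measurable_kre2 : measurable_fun setT (fun p : (R * R) * (R * R) => kre p.1 p.2).
Proof. by apply: measurable_funM => //; exact: measurable_funV. Qed.

Lemma measurable_kim2 : measurable_fun setT (fun p : (R * R) * (R * R) => kim p.1 p.2).
Proof. by apply: measurable_funM => //; exact: measurable_funV. Qed.

Lemma measurable_invdist2 :
  measurable_fun setT (fun p : (R * R) * (R * R) => invdist p.1 p.2).
Proof.
apply: measurable_funV; last by move=> p; exact: sqrtr_ge0.
by apply: measurableT_comp => //; exact: measurable_sqrt.
Qed.

Lemma measurable_invdist322 :
  measurable_fun setT (fun p : (R * R) * (R * R) => invdist32 p.1 p.2).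
Proof.
apply: measurable_funM; first exact: measurable_invdist2.
by apply: measurableT_comp; [exact: measurable_sqrt|exact: measurable_invdist2].
Qed.

Lemma measurable_kre w : measurable_fun setT (kre ^~ w).
Proof. exact: (@measurable_fun_pair1 _ _ _ _ _ _ _ w measurable_kre2). Qed.

Lemma measurable_kim w : measurable_fun setT (kim ^~ w).
Proof. exact: (@measurable_fun_pair1 _ _ _ _ _ _ _ w measurable_kim2). Qed.

Lemma measurable_kreR z : measurable_fun setT (kre z).
Proof. exact: (@measurable_fun_pair2 _ _ _ _ _ _ _ z measurable_kre2). Qed.

Lemma measurable_kimR z : measurable_fun setT (kim z).
Proof. exact: (@measurable_fun_pair2 _ _ _ _ _ _ _ z measurable_kim2). Qed.

Lemma measurable_invdist32 w : measurable_fun setT (invdist32 ^~ w).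
Proof. exact: (@measurable_fun_pair1 _ _ _ _ _ _ _ w measurable_invdist322). Qed.

Definition box (A : R) : set (R * R) := `[- A, A] `*` `[- A, A].

Lemma boxP (A : R) (z : R * R) : box A z <-> `|z.1| <= A /\ `|z.2| <= A.
Proof. by rewrite /box /setX /= !in_itv/= !ler_norml. Qed.

Lemma measurable_box (A : R) : measurable (box A).
Proof. exact: measurableX. Qed.

End measurability_kernels.

(** * Comparison of two root measures through their Cauchy transforms *)

Section weighted_points.
Context {R : realType}.
Local Notation leb := (@lebesgue_measure R).
Implicit Types (A e k : R) (z w c : R * R) (ms : seq (R * (R * R))).

Lemma integrable_kre_line e (a b : R) w : a != w.1 ->
  leb.-integrable `[- e, e] (EFin \o (fun t => kre (a, b + t) w)).
Proof.
move=> aw; rewrite (_ : (fun _ => _) =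
    (fun t => (a - w.1) / ((a - w.1) ^+ 2 + (t + (b - w.2)) ^+ 2))).
  apply: continuous_compact_integrable; first exact: segment_compact.
  by apply: continuous_subspaceT; apply: continuous_div_sqrD; rewrite subr_eq0.
by apply/funext => t; rewrite /kre /=; congr (_ / _); ring.
Qed.

Lemma integrable_kim_line e (a b : R) w : b != w.2 ->
  leb.-integrable `[- e, e] (EFin \o (fun t => kim (a + t, b) w)).
Proof.
move=> bw; have := @integrable_kre_line e b a (w.2, w.1) bw.
congr (_.-integrable _ _); apply/funext => t; rewrite /kre /kim /=.
by congr (_%:E); congr (_ / _); ring.
Qed.

(** A list [ms] of pairs (weight, point) encodes a finitely supported signed measure; with [kre] and
    [kim] these sums are, up to sign, the two parts of its Cauchy transform. *)
Definition wsum (k : R * R -> R * R -> R) ms z := \sum_(m <- ms) m.1 * k z m.2.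

Definition transform_norm ms z := `|wsum kre ms z| + `|wsum kim ms z|.

Definition sqmass e ms c := \sum_(m <- ms) m.1 * (sq e c m.2)%:R.

Lemma integrable_wsum (g : R -> R * R) (k : R * R -> R * R -> R) ms e :
  (forall m, m \in ms ->
    leb.-integrable `[- e, e] (EFin \o (fun t => k (g t) m.2))) ->
  leb.-integrable `[- e, e] (EFin \o (fun t => wsum k ms (g t))).
Proof.
elim: ms => [|m ms IH] H.
  rewrite (_ : _ \o _ = cst 0%E); first exact: integrable0.
  by apply/funext => t; rewrite /wsum /= big_nil.
rewrite (_ : _ \o _ =
  (fun t => m.1%:E * (k (g t) m.2)%:E + (wsum k ms (g t))%:E)%E).
  apply: integrableD => //.
    apply: integrableZl => //.
    by apply: H; rewrite mem_head.
  by apply: IH => i im; apply: H; rewrite inE im orbT.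
by apply/funext => t; rewrite /wsum /= big_cons.
Qed.

Lemma Rintegral_wsum (g : R -> R * R) (k : R * R -> R * R -> R) ms e :
  (forall m, m \in ms ->
    leb.-integrable `[- e, e] (EFin \o (fun t => k (g t) m.2))) ->
  \int[leb]_(t in `[- e, e]) wsum k ms (g t) =
  \sum_(m <- ms) m.1 * \int[leb]_(t in `[- e, e]) k (g t) m.2.
Proof.
elim: ms => [|m ms IH] H.
  under eq_Rintegral do rewrite /wsum big_nil.
  by rewrite big_nil /Rintegral integral0.
under eq_Rintegral do rewrite /wsum big_cons.
have Hm : leb.-integrable `[- e, e] (EFin \o (fun t => k (g t) m.2)).
  by apply: H; rewrite mem_head.
have Hms i : i \in ms ->
    leb.-integrable `[- e, e] (EFin \o (fun t => k (g t) i.2)).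
  by move=> im; apply: H; rewrite inE im orbT.
rewrite big_cons RintegralD//.
- by rewrite RintegralZl// -IH.
- exact: (@integrableZl _ _ _ leb _ _ m.1 (EFin \o (fun t => k (g t) m.2))%E Hm).
- exact: integrable_wsum.
Qed.

Definition off_lines e c w :=
  [&& w.1 != c.1 + e, w.1 != c.1 - e, w.2 != c.2 + e & w.2 != c.2 - e].

Lemma winding_sqmass e ms c : 0 < e -> all (fun m => off_lines e c m.2) ms ->
  \int[leb]_(t in `[- e, e]) wsum kre ms (c.1 + e, c.2 + t)
  - \int[leb]_(t in `[- e, e]) wsum kre ms (c.1 - e, c.2 + t)
  + \int[leb]_(t in `[- e, e]) wsum kim ms (c.1 + t, c.2 + e)
  - \int[leb]_(t in `[- e, e]) wsum kim ms (c.1 + t, c.2 - e)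
  = 2 * pi * sqmass e ms c.
Proof.
move=> e0 /allP off.
rewrite (Rintegral_wsum (g := fun t => (c.1 + e, c.2 + t))); last first.
  by move=> m /off /and4P[? ? ? ?]; apply: integrable_kre_line; rewrite eq_sym.
rewrite (Rintegral_wsum (g := fun t => (c.1 - e, c.2 + t))); last first.
  by move=> m /off /and4P[? ? ? ?]; apply: integrable_kre_line; rewrite eq_sym.
rewrite (Rintegral_wsum (g := fun t => (c.1 + t, c.2 + e))); last first.
  by move=> m /off /and4P[? ? ? ?]; apply: integrable_kim_line; rewrite eq_sym.
rewrite (Rintegral_wsum (g := fun t => (c.1 + t, c.2 - e))); last first.
  by move=> m /off /and4P[? ? ? ?]; apply: integrable_kim_line; rewrite eq_sym.
rewrite -sumrB -big_split/= -sumrB /sqmass mulr_sumr big_seq [RHS]big_seq.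
apply: eq_bigr => m /off /and4P[? ? ? ?].
by rewrite -mulrBr -mulrDr -mulrBr square_winding// mulrCA.
Qed.

Lemma measurable_wsum (k : R * R -> R * R -> R) ms : (forall w, measurable_fun setT (k ^~ w)) ->
  measurable_fun setT (wsum k ms).
Proof. by move=> mk; apply: measurable_sum => m; apply: measurable_funM. Qed.

Lemma measurable_transform_norm ms : measurable_fun setT (transform_norm ms).
Proof.
by apply: measurable_funD; apply: measurableT_comp => //; apply: measurable_wsum;
  [exact: measurable_kre|exact: measurable_kim].
Qed.

Lemma transform_norm_ge0 ms z : 0 <= transform_norm ms z.
Proof. by rewrite addr_ge0. Qed.

Lemma abs_Rintegral_le (D : set R) (f h : R -> R) : measurable D ->
    leb.-integrable D (EFin \o f) -> measurable_fun D h ->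
    (forall t, `|f t| <= h t) ->
  (`|\int[leb]_(t in D) f t|%:E <= \int[leb]_(t in D) (h t)%:E)%E.
Proof.
move=> mD intf mh fh.
rewrite EFin_normr_Rintegral// (le_trans (le_abse_integral _ _ _))//.
  by case/integrableP: intf.
apply: ge0_le_integral => //.
- by apply: measurableT_comp => //; case/integrableP: intf.
- exact/measurable_EFinP.
- by move=> t _; rewrite lee_fin.
Qed.

Lemma sqmass_le e ms c : 0 < e -> all (fun m => off_lines e c m.2) ms ->
  (((2 * pi) * `|sqmass e ms c|)%:E <=
  \int[leb]_(t in `[(- e)%R, e]) (transform_norm ms (c.1 + e, c.2 + t)%R)%:E
  + \int[leb]_(t in `[(- e)%R, e]) (transform_norm ms (c.1 - e, c.2 + t)%R)%:E
  + \int[leb]_(t in `[(- e)%R, e]) (transform_norm ms (c.1 + t, c.2 + e)%R)%:E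
  + \int[leb]_(t in `[(- e)%R, e]) (transform_norm ms (c.1 + t, c.2 - e)%R)%:E)%E.
Proof.
move=> e0 off; have pi0 : 0 <= 2 * pi :> R by rewrite mulr_ge0// pi_ge0.
rewrite -[X in X * `| _ |](ger0_norm pi0) -normrM -winding_sqmass//.
set I1 := \int[_]_(t in _) wsum kre _ _; set I2 := \int[_]_(t in _) wsum kre _ _.
set I3 := \int[_]_(t in _) wsum kim _ _; set I4 := \int[_]_(t in _) wsum kim _ _.
have mH (g : R -> R * R) : measurable_fun setT g ->
    measurable_fun `[- e, e] (fun t => transform_norm ms (g t)).
  move=> mg; apply: measurable_funTS; apply: measurableT_comp => //.
  exact: measurable_transform_norm.
have mp1 (a b : R) : measurable_fun setT (fun t : R => (a, b + t)).
  by apply: measurable_fun_pair => //; exact: measurable_funD.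
have mp2 (a b : R) : measurable_fun setT (fun t : R => (a + t, b)).
  by apply: measurable_fun_pair => //; exact: measurable_funD.
have le1 z : `|wsum kre ms z| <= transform_norm ms z by rewrite lerDl.
have le2 z : `|wsum kim ms z| <= transform_norm ms z by rewrite lerDr.
move/allP: off => off.
apply: (@le_trans _ _ (`|I1|%:E + `|I2|%:E + `|I3|%:E + `|I4|%:E)%E).
  rewrite -!EFinD lee_fin (le_trans (ler_normB _ _))// lerD2r.
  by rewrite (le_trans (ler_normD _ _))// lerD2r (le_trans (ler_normB _ _)).
apply: leeD; [apply: leeD; [apply: leeD|]|]; apply: abs_Rintegral_le => //;
  try exact: mH; apply: integrable_wsum => m /off /and4P[? ? ? ?].
- by apply: integrable_kre_line; rewrite eq_sym.
- by apply: integrable_kre_line; rewrite eq_sym.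
- by apply: integrable_kim_line; rewrite eq_sym.
- by apply: integrable_kim_line; rewrite eq_sym.
Qed.

Lemma measurable_restrict_box (h : R * R -> R) A : measurable_fun setT h ->
  measurable_fun setT ((fun z => (h z)%:E) \_ (box A)).
Proof.
move=> mh; have mb := measurable_box A.
have mhE : measurable_fun setT (fun z => (h z)%:E) by exact/measurable_EFinP.
by apply: (measurable_restrictT (fun z => (h z)%:E) mb).1; exact: measurable_funTS.
Qed.

(** Tonelli exchanges the centre [c] and the parameter [t]; for fixed [t] the translate of [box A]
    by ([p t], [q t]) stays in [box (A + e)]. With one of [p], [q] the identity and the other the
    constant [e] or [- e], the inner integral runs over a side of the square centred at [c]. *)
Lemma integral_box_shift (h : R * R -> R) (p q : R -> R) A e : 0 < e ->
    measurable_fun setT h -> (forall z, 0 <= h z) ->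
    measurable_fun setT p -> measurable_fun setT q ->
    (forall t, `|t| <= e -> `|p t| <= e) -> (forall t, `|t| <= e -> `|q t| <= e) ->
  (\int[area]_(c in box A)
     \int[leb]_(t in `[(- e)%R, e]) (h (c.1 + p t, c.2 + q t)%R)%:E <=
   (2 * e)%:E * \int[area]_(z in box (A + e)%R) (h z)%:E)%E.
Proof.
move=> e0 mh h0 mp mq pe qe.
pose F (x : (R * R) * R) : \bar R := (h (x.1.1 + p x.2, x.1.2 + q x.2) *
  \1_(box A) x.1 * \1_(`[- e, e]%classic) x.2)%:E.
have mF : measurable_fun setT F.
  apply/measurable_EFinP; apply: measurable_funM; [apply: measurable_funM|].
  - apply: measurableT_comp => //; apply: measurable_fun_pair;
      apply: measurable_funD; exact: measurableT_comp.
  - by apply: measurableT_comp => //; apply: measurable_indic; exact: measurable_box.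
  - by apply: measurableT_comp => //; apply: measurable_indic.
have F0 x : (0 <= F x)%E by rewrite lee_fin !mulr_ge0.
have -> : (\int[area]_(c in box A)
     \int[leb]_(t in `[(- e)%R, e]) (h (c.1 + p t, c.2 + q t)%R)%:E =
   \int[area]_c \int[leb]_t F (c, t))%E.
  rewrite integral_mkcond; apply: eq_integral => c _; rewrite patchE.
  case: ifPn => cA; last first.
    by rewrite integral0_eq// => t _; rewrite /F /= indicE (negbTE cA) mulr0 mul0r.
  rewrite integral_mkcond; apply: eq_integral => t _; rewrite patchE /F /=.
  by rewrite !indicE cA mulr1; case: ifPn => _; rewrite ?mulr1 ?mulr0.
rewrite fubini_tonelli//.
set J := (\int[area]_(z in box (A + e)%R) (h z)%:E)%E.
have J0 : (0 <= J)%E by apply: integral_ge0 => z _; rewrite lee_fin.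
have inner (t : R) : (\int[area]_c F (c, t) <= J * (\1_(`[- e, e]%classic) t)%:E)%E.
  rewrite indicE; case: (boolP (t \in _)) => tE; last first.
    rewrite integral0_eq ?mule0// => c _.
    by rewrite /F /= [X in _ * X]indicE (negbTE tE) mulr0.
  rewrite mule1; have te : `|t| <= e.
    by move: tE; rewrite inE/= in_itv/= ler_norml.
  rewrite /J [leRHS]integral_mkcond -[leRHS](ge0_integral2_shift (p t) (q t)); last 2 first.
  - exact: measurable_restrict_box.
  - by move=> z; apply: erestrict_ge0 => x _; rewrite lee_fin.
  apply: ge0_le_integral => //.
  - exact: measurable_fun_pair1.
  - apply: (@measurableT_comp _ _ _ _ _ _ ((fun z => (h z)%:E) \_ (box (A + e)))).
      exact: measurable_restrict_box.
    by apply: measurable_fun_pair; exact: measurable_funD.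
  - move=> c _; rewrite /F /= !indicE patchE; case: (boolP (c \in _)) => cA; last first.
      by rewrite mulr0 mul0r; case: ifPn => // _; rewrite lee_fin.
    rewrite tE !mulr1 ifT//; move: cA; rewrite !inE => /boxP[c1 c2]; apply/boxP.
    by split => /=; rewrite (le_trans (ler_normD _ _))// lerD// ?pe ?qe.
apply: (@le_trans _ _ (\int[leb]_t (J * (\1_(`[- e, e]%classic) t)%:E))%E).
  apply: ge0_le_integral => //.
  - by move=> t _; exact: integral_ge0.
  - exact: measurable_fun_fubini_tonelli_G.
  - by apply: measurable_funeM; apply/measurable_EFinP; exact: measurable_indic.
rewrite ge0_integralZl//; last first.
- by apply/measurable_EFinP; exact: measurable_indic.
rewrite integral_indic//= setIT lebesgue_measure_itv/= lte_fin gtrN// -EFinB.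
by rewrite opprK muleC (_ : e + e = 2 * e)//; ring.
Qed.

End weighted_points.

(** * Averages over small squares *)

Section smoothing.
Context {R : realType}.
Local Notation leb := (@lebesgue_measure R).
Implicit Types (A e M : R) (z w c : R * R) (ms : seq (R * (R * R))) (s : seq (R * R)).

Lemma measurable_line_integral (h : R * R -> R) (p q : R -> R) e :
    measurable_fun setT h -> (forall z, 0 <= h z) ->
    measurable_fun setT p -> measurable_fun setT q ->
  measurable_fun setT (fun c : R * R =>
    \int[leb]_(t in `[(- e)%R, e]) (h (c.1 + p t, c.2 + q t)%R)%:E)%E.
Proof.
move=> mh h0 mp mq.
pose F (x : (R * R) * R) : \bar R :=
  (h (x.1.1 + p x.2, x.1.2 + q x.2) * \1_(`[- e, e]%classic) x.2)%:E.
have mF : measurable_fun setT F.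
  apply/measurable_EFinP; apply: measurable_funM.
  - apply: measurableT_comp => //; apply: measurable_fun_pair;
      apply: measurable_funD; exact: measurableT_comp.
  - by apply: measurableT_comp => //; apply: measurable_indic.
have F0 x : (0 <= F x)%E by rewrite lee_fin !mulr_ge0.
have := @measurable_fun_fubini_tonelli_F _ _ _ _ R leb F mF F0.
congr measurable_fun; apply/funext => c; rewrite /fubini_F [RHS]integral_mkcond.
apply: eq_integral => t _; rewrite patchE /F /= indicE.
by case: ifPn => _; rewrite ?mulr1 ?mulr0.
Qed.

(** The excluded centres lie on finitely many lines parallel to the axes. *)
Lemma ae_off_lines e ms :
  {ae area, forall c : R * R, all (fun m => off_lines e c m.2) ms}.
Proof.
have L1 (a : R) : area.-negligible [set c : R * R | c.1 = a].
  exists ([set a] `*` setT); split.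
  - exact: measurableX.
  - by rewrite areaX// lebesgue_measure_set1 mul0e.
  - by move=> c /= ->.
have L2 (a : R) : area.-negligible [set c : R * R | c.2 = a].
  exists (setT `*` [set a]); split.
  - exact: measurableX.
  - by rewrite areaX// lebesgue_measure_set1 mule0.
  - by move=> c /= ->.
elim: ms => [|m ms IH]; first exact: aeW.
have N4 := negligibleU (negligibleU (L1 (m.2.1 - e)) (L1 (m.2.1 + e)))
  (negligibleU (L2 (m.2.2 - e)) (L2 (m.2.2 + e))).
apply: negligibleS (negligibleU N4 IH) => c /= /negP.
rewrite negb_and => /orP[|/negP]; last by right.
rewrite /off_lines => H; left; move: H; rewrite !negb_and !negbK.
by case/or4P => /eqP ->; [left; left|left; right|right; left|right; right]; ring.
Qed.

Definition sqset e w : set (R * R) :=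
  `]w.1 - e, w.1 + e[ `*` `]w.2 - e, w.2 + e[.

Lemma measurable_sqset e w : measurable (sqset e w).
Proof. exact: measurableX. Qed.

Lemma sqE e c w : (sq e c w)%:R =
  \1_(sqset e w) c :> R.
Proof.
rewrite indicE; congr ((nat_of_bool _)%:R); apply/idP/idP.
  rewrite /sq inE /= => /andP[]; rewrite !ltr_norml => /andP[? ?] /andP[? ?].
  by split => /=; rewrite in_itv/=; lra.
rewrite inE => -[] /=; rewrite !in_itv/= /sq !ltr_norml => ? ?.
by apply/andP; split; lra.
Qed.

Lemma measurable_sq e w : measurable_fun setT (fun c => (sq e c w)%:R : R).
Proof.
rewrite (_ : (fun _ => _) = \1_(sqset e w)).
  by apply: measurable_indic; exact: measurable_sqset.
by apply/funext => c; rewrite sqE.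
Qed.

Lemma measurable_sqmass e ms : measurable_fun setT (sqmass e ms).
Proof.
by apply: measurable_sum => m; apply: measurable_funM => //; exact: measurable_sq.
Qed.

(** The factor [8 * e] is the perimeter: each side contributes its length [2 * e] times the same
    integral over the enlarged box. *)
Lemma integral_sqmass_le e ms A : 0 < e ->
  ((2 * pi)%:E * \int[area]_(c in box A) `|sqmass e ms c|%:E <=
   (8 * e)%:E * \int[area]_(z in box (A + e)%R) (transform_norm ms z)%:E)%E.
Proof.
move=> e0; have pi0 : 0 <= 2 * pi :> R by rewrite mulr_ge0// pi_ge0.
set J := (\int[area]_(z in box (A + e)%R) _)%E.
have J0 : (0 <= J)%E.
  by apply: integral_ge0 => z _; rewrite lee_fin; exact: transform_norm_ge0.
have mH := measurable_transform_norm ms.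
have H0 := transform_norm_ge0 ms.
have me (a : R) : measurable_fun setT (fun _ : R => a) by [].
have mid : measurable_fun setT (fun t : R => t) by [].
have mbox : measurable (box A : set (measurableTypeR R * measurableTypeR R)).
  exact: measurable_box.
pose I (p q : R -> R) (c : R * R) : \bar R :=
  (\int[leb]_(t in `[(- e)%R, e]) (transform_norm ms (c.1 + p t, c.2 + q t)%R)%:E)%E.
have mI p q : measurable_fun setT p -> measurable_fun setT q ->
    measurable_fun (box A) (I p q).
  by move=> mp mq; apply: measurable_funTS; exact: measurable_line_integral.
have I0 p q c : (0 <= I p q c)%E by apply: integral_ge0 => t _; rewrite lee_fin.
have msq : measurable_fun (box A) (fun c => (`|sqmass e ms c|)%:E).
  apply: measurable_funTS; apply/measurable_EFinP; apply: measurableT_comp => //.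
  exact: measurable_sqmass.
rewrite -ge0_integralZl//.
have eN (t : R) : `|t| <= e -> `|- e| <= e by move=> _; rewrite normrN gtr0_norm.
have eP (t : R) : `|t| <= e -> `|e| <= e by move=> _; rewrite gtr0_norm.
have idP (t : R) : `|t| <= e -> `|t| <= e by [].
pose S c : \bar R := (I (cst e) id c + I (cst (- e)%R) id c +
  I id (cst e) c + I id (cst (- e)%R) c)%E.
apply: (@le_trans _ _ (\int[area]_(c in box A) S c)%E).
  apply: ae_ge0_le_integral => //.
  - by move=> c _; rewrite mule_ge0// lee_fin.
  - exact: measurable_funeM.
  - by move=> c _; do 3 (apply: adde_ge0; last exact: I0); exact: I0.
  - by do 3 (apply: emeasurable_funD; last exact: mI); exact: mI.
  - apply: negligibleS (ae_off_lines e ms) => c; apply: contra_not => off _.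
    by rewrite -EFinM; exact: sqmass_le.
have I00 p q p' q' c : (0 <= I p q c + I p' q' c)%E.
  by apply: adde_ge0; exact: I0.
have I000 p q p' q' p'' q'' c : (0 <= I p q c + I p' q' c + I p'' q'' c)%E.
  by apply: adde_ge0; [exact: I00|exact: I0].
rewrite /S ge0_integralD//; last 2 first.
- by do 2 (apply: emeasurable_funD; last exact: mI); exact: mI.
- exact: mI.
rewrite ge0_integralD//; last 2 first.
- by apply: emeasurable_funD; exact: mI.
- exact: mI.
rewrite ge0_integralD//; do ?exact: mI.
have B p q := @integral_box_shift _ (transform_norm ms) p q A e e0 mH H0.
apply: (@le_trans _ _ ((2 * e)%:E * J + (2 * e)%:E * J + (2 * e)%:E * J + (2 * e)%:E * J)%E).
  by do 3 (apply: leeD; last exact: B); exact: B.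
have e20 : (0%:E <= (2 * e)%:E)%E by rewrite lee_fin mulr_ge0// ltW.
rewrite -!ge0_muleDl ?adde_ge0// -!EFinD.
by rewrite (_ : _ + 2 * e = 8 * e)//; ring.
Qed.

Lemma area_box A : 0 <= A -> area (box A) = ((2 * A) ^+ 2)%:E.
Proof.
move=> A0; rewrite /box areaX// lebesgue_measure_itv/= lte_fin.
case: ltP => [_|]; first by rewrite -EFinB -EFinM; congr (_%:E); ring.
by move=> AA; rewrite (_ : A = 0) ?mulr0 ?mul0e ?expr0n//; lra.
Qed.

Lemma area_box_lty A : (area (box A) < +oo)%E.
Proof.
have [A0|A0] := leP 0 A; first by rewrite area_box// ltry.
rewrite (_ : box A = set0) ?measure0//; apply/seteqP; split => // z /boxP[z1 _].
by have := normr_ge0 z.1; rewrite leNgt (le_lt_trans z1).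
Qed.

Lemma integrable_box (g : R * R -> R) A M : measurable_fun setT g ->
  (forall c, `|g c| <= M) -> area.-integrable (box A) (EFin \o g).
Proof.
move=> mg gM; apply: measurable_bounded_integrable.
- exact: measurable_box.
- exact: area_box_lty.
- exact: measurable_funTS.
- exists M; split; first exact: num_real.
  by move=> x Mx c _ /=; rewrite (le_trans (gM c))// ltW.
Qed.

(** The mean of [g] over the square of half side [e] around [w], with [g] replaced by 0 outside
    [box A]. In particular [smooth (cst 1)] is the fraction of that square inside the box. *)
Definition smooth (g : R * R -> R) A e w : R :=
  (4 * e ^+ 2)^-1 * \int[area]_(c in box A) (g c * (sq e c w)%:R).

Let mbox A : measurable (box A : set (measurableTypeR R * measurableTypeR R)).
Proof. exact: measurable_box. Qed.

Lemma integrable_boxZ (k : R) (g : R * R -> R) A :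
  area.-integrable (box A) (EFin \o g) ->
  area.-integrable (box A) (EFin \o (fun c => k * g c)).
Proof. by move=> ig; exact: (integrableZl (mbox A) k ig). Qed.

Lemma integrable_box_sq (g : R * R -> R) A M e w : measurable_fun setT g ->
  (forall c, `|g c| <= M) ->
  area.-integrable (box A) (EFin \o (fun c => g c * (sq e c w)%:R)).
Proof.
move=> mg gM; apply: (@integrable_box _ _ M).
  by apply: measurable_funM => //; exact: measurable_sq.
move=> c; rewrite normrM normr_nat (le_trans _ (gM c))//.
by rewrite ler_piMr// lern1; case: sq.
Qed.

Lemma integral_sq A e w :
  (\int[area]_(c in box A) (sq e c w)%:R%:E =
   area (sqset e w `&` box A))%E.
Proof.
rewrite -integral_indic//; last exact: measurable_sqset.
by apply: eq_integral => c _; rewrite sqE.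
Qed.

Lemma area_sq e w : 0 < e ->
  area (sqset e w) = (4 * e ^+ 2)%:E.
Proof.
move=> e0; rewrite /sqset areaX// !lebesgue_measure_itv/= !lte_fin.
rewrite !ifT; [|lra|lra].
by rewrite -!EFinB -EFinM; congr (_%:E); ring.
Qed.

Lemma smooth1_itv A e w : 0 < e -> 0 <= smooth (cst 1) A e w <= 1.
Proof.
have msq : measurable (sqset e w : set (measurableTypeR R * measurableTypeR R)).
  exact: measurable_sqset.
move=> e0; have e20 : 0 < 4 * e ^+ 2 by rewrite mulr_gt0// exprn_gt0.
rewrite /smooth mulr_ge0 ?invr_ge0 ?(ltW e20)//=; last first.
  by apply: Rintegral_ge0 => c _; rewrite mul1r.
rewrite mulrC ler_pdivrMr// mul1r -lee_fin -(area_sq w e0).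
rewrite /Rintegral; under eq_integral do rewrite /= mul1r.
rewrite integral_sq fineK; last first.
  rewrite ge0_fin_numE//; apply: le_lt_trans (area_box_lty A).
  by apply: le_measure; rewrite ?inE//; exact: measurableI.
by apply: le_measure; rewrite ?inE//; exact: measurableI.
Qed.

Lemma smooth1_inner A e w : 0 < e -> box (A - e) w -> smooth (cst 1) A e w = 1.
Proof.
move=> e0 /boxP[w1 w2]; have e20 : 0 < 4 * e ^+ 2 by rewrite mulr_gt0// exprn_gt0.
rewrite /smooth /Rintegral; under eq_integral do rewrite /= mul1r.
rewrite integral_sq (_ : _ `&` _ = sqset e w).
  by rewrite area_sq//= mulVf// gt_eqF.
apply/setIidl => c [] /=; rewrite !in_itv/= => c1 c2; apply/boxP.
by move: w1 w2; rewrite !ler_norml => ? ?; split; lra.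
Qed.

(** The error is the mean of [f w - f c] over the part of the square inside the box, plus [f w]
    times the fraction of the square that is missing. *)
Lemma smooth_approx (f : R * R -> R) A e M osc w : 0 < e -> 0 <= osc ->
    measurable_fun setT f -> (forall z, `|f z| <= M) ->
    (forall c, box A c -> sq e c w -> `|f w - f c| <= osc) ->
  `|f w - smooth f A e w| <= osc + M * (1 - smooth (cst 1) A e w).
Proof.
move=> e0 osc0 mf fM fosc; have e20 : 0 < 4 * e ^+ 2 by rewrite mulr_gt0// exprn_gt0.
have /andP[s0 s1] := smooth1_itv A w e0.
have i1 : area.-integrable (box A) (EFin \o (fun c => cst 1 c * (sq e c w)%:R)).
  by apply: (@integrable_box_sq _ _ 1) => //= _; rewrite normr1.
have i2 := @integrable_box_sq f A M e w mf fM.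
have -> : f w - smooth f A e w =
    (4 * e ^+ 2)^-1 * \int[area]_(c in box A) ((f w - f c) * (sq e c w)%:R) +
    f w * (1 - smooth (cst 1) A e w).
  under eq_Rintegral do rewrite mulrBl -[X in f w * X]mul1r.
  rewrite RintegralB//; last exact: (integrable_boxZ (f w) i1).
  rewrite RintegralZl// /smooth /=; ring.
rewrite (le_trans (ler_normD _ _))// lerD//.
  rewrite normrM ger0_norm ?invr_ge0 ?(ltW e20)//.
  have i3 : area.-integrable (box A) (EFin \o (fun c => (f w - f c) * (sq e c w)%:R)).
    apply: (@integrable_box_sq _ _ (M + M)).
      by apply: measurable_funB.
    by move=> c; rewrite (le_trans (ler_normB _ _))// lerD.
  apply: (@le_trans _ _ ((4 * e ^+ 2)^-1 *
      \int[area]_(c in box A) (osc * (cst 1 c * (sq e c w)%:R)))).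
    rewrite ler_wpM2l ?invr_ge0 ?(ltW e20)//.
    rewrite (le_trans (le_normr_Rintegral _ _))//; apply: le_Rintegral => //.
    - by have := integrable_abse i3; congr (_.-integrable _ _); apply/funext.
    - exact: (integrable_boxZ osc i1).
    - move=> c cA; rewrite mul1r normrM normr_nat; case: (boolP (sq e c w)) => cw.
        by rewrite !mulr1 fosc.
      by rewrite !mulr0.
  rewrite RintegralZl// mulrCA -/(smooth (cst 1) A e w).
  by rewrite ler_piMr.
by rewrite normrM [X in _ * X]ger0_norm ?subr_ge0// ler_wpM2r ?subr_ge0.
Qed.

Lemma sum_smooth (f : R * R -> R) A e M ms : 0 < e ->
    measurable_fun setT f -> (forall z, `|f z| <= M) ->
  \sum_(m <- ms) m.1 * smooth f A e m.2 =
  (4 * e ^+ 2)^-1 * \int[area]_(c in box A) (f c * sqmass e ms c).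
Proof.
move=> e0 mf fM.
have isq m := @integrable_box_sq f A M e m mf fM.
have ims ms' : area.-integrable (box A) (EFin \o (fun c => f c * sqmass e ms' c)).
  apply: (@integrable_box _ _ (M * \sum_(m <- ms') `|m.1|)).
    by apply: measurable_funM => //; exact: measurable_sqmass.
  move=> c; rewrite normrM ler_pM// (le_trans (ler_norm_sum _ _ _))//.
  apply: ler_sum => m _; rewrite normrM normr_nat ler_piMr// lern1.
  by case: sq.
elim: ms => [|m ms IH].
  under eq_Rintegral do rewrite /sqmass big_nil mulr0.
  by rewrite big_nil /Rintegral integral0 mulr0.
have -> : \int[area]_(c in box A) (f c * sqmass e (m :: ms) c) =
    \int[area]_(c in box A) (m.1 * (f c * (sq e c m.2)%:R) + f c * sqmass e ms c).
  by apply: eq_Rintegral => c _; rewrite /sqmass big_cons mulrDr mulrCA.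
rewrite big_cons IH RintegralD//; last exact: (integrable_boxZ m.1 (isq m.2)).
by rewrite RintegralZl// mulrDr [in RHS]mulrCA.
Qed.

(** The constant is M/(4 e^2), from the definition of [smooth], times 8 e I/(2 pi), from
    [integral_sqmass_le]. *)
Lemma sum_smooth_le (f : R * R -> R) A e M ms (I : R) : 0 < e ->
    measurable_fun setT f -> (forall z, `|f z| <= M) ->
    (\int[area]_(z in box (A + e)%R) (transform_norm ms z)%:E <= I%:E)%E ->
  `|\sum_(m <- ms) m.1 * smooth f A e m.2| <= M * (I / (pi * e)).
Proof.
move=> e0 mf fM HI; rewrite (@sum_smooth _ _ _ M)//.
have e20 : 0 < 4 * e ^+ 2 by rewrite mulr_gt0// exprn_gt0.
have p0 : 0 < pi :> R by exact: pi_gt0.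
have M0 : 0 <= M by exact: le_trans (fM (0, 0)).
have isq : area.-integrable (box A) (EFin \o (fun c => `|sqmass e ms c|)).
  apply: (@integrable_box _ _ (\sum_(m <- ms) `|m.1|)).
    by apply: measurableT_comp => //; exact: measurable_sqmass.
  move=> c; rewrite normr_id (le_trans (ler_norm_sum _ _ _))//.
  apply: ler_sum => m _; rewrite normrM normr_nat ler_piMr// lern1.
  by case: sq.
have ifs : area.-integrable (box A) (EFin \o (fun c => f c * sqmass e ms c)).
  apply: le_integrable (integrableZl _ M isq) => //.
    apply: measurable_funTS; apply/measurable_EFinP; apply: measurable_funM => //.
    exact: measurable_sqmass.
  move=> c _ /=; rewrite lee_fin !normrM normr_id ler_wpM2r//.
  by rewrite (le_trans (fM c))// ler_norm.
have := integral_sqmass_le ms A e0.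
rewrite (_ : \int[area]_(c in box A) `|sqmass e ms c|%:E =
  (\int[area]_(c in box A) `|sqmass e ms c|)%:E)%E; last first.
  by rewrite /Rintegral fineK//; exact: integrable_fin_num isq.
set J := Rintegral _ _ _ => HJ.
have {}HJ : J <= 8 * e * I / (2 * pi).
  rewrite ler_pdivlMr ?mulr_gt0// -lee_fin mulrC.
  apply: le_trans HJ _; rewrite [leRHS]EFinM lee_wpmul2l// lee_fin mulr_ge0//.
  exact: ltW.
rewrite normrM ger0_norm ?invr_ge0 ?(ltW e20)//.
apply: (@le_trans _ _ ((4 * e ^+ 2)^-1 * (M * J))).
  rewrite ler_wpM2l ?invr_ge0 ?(ltW e20)// (le_trans (le_normr_Rintegral _ _))//.
  rewrite /J -RintegralZl//; apply: le_Rintegral => //.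
  - by have := integrable_abse ifs; congr (_.-integrable _ _); apply/funext.
  - exact: (integrable_boxZ M isq).
  - by move=> c _; rewrite normrM ler_wpM2r.
apply: (@le_trans _ _ ((4 * e ^+ 2)^-1 * (M * (8 * e * I / (2 * pi))))).
  by rewrite ler_wpM2l ?invr_ge0 ?(ltW e20)// ler_wpM2l.
rewrite le_eqVlt; apply/orP; left; apply/eqP.
clear -e0 p0; move: (pi : R) p0 => p p0; field.
by rewrite !gt_eqF.
Qed.

Definition avg (s : seq (R * R)) (f : R * R -> R) : R :=
  (size s)%:R^-1 * \sum_(x <- s) f x.

(** The difference of the two empirical measures, as a weighted list. *)
Definition diff_weights s' s : seq (R * (R * R)) :=
  map (pair ((size s')%:R^-1)) s' ++ map (pair (- (size s)%:R^-1)) s.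

Lemma sum_diff_weights s' s (g : R * R -> R) :
  \sum_(m <- diff_weights s' s) m.1 * g m.2 = avg s' g - avg s g.
Proof.
by rewrite big_cat !big_map /= -!mulr_sumr mulNr.
Qed.

Lemma avg_le s (g h : R * R -> R) : (forall z, g z <= h z) -> avg s g <= avg s h.
Proof.
by move=> gh; rewrite ler_wpM2l ?invr_ge0//; apply: ler_sum => x _; exact: gh.
Qed.

Lemma avgB s (g h : R * R -> R) : avg s (fun z => g z - h z) = avg s g - avg s h.
Proof. by rewrite /avg -mulrBr -sumrB. Qed.

Lemma avgD s (g h : R * R -> R) : avg s (fun z => g z + h z) = avg s g + avg s h.
Proof. by rewrite /avg -mulrDr -big_split. Qed.

Lemma avgZ s (k : R) (g : R * R -> R) : avg s (fun z => k * g z) = k * avg s g.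
Proof. by rewrite /avg -mulr_sumr mulrCA. Qed.

Lemma avg_cst s (k : R) : (0 < size s)%N -> avg s (cst k) = k.
Proof.
move=> s0; rewrite /avg big_const_seq count_predT iter_addr addr0 -[k *+ _]mulr_natl.
by rewrite mulKf// pnatr_eq0 -lt0n.
Qed.

Lemma norm_avg_le s (g : R * R -> R) : `|avg s g| <= avg s (fun z => `|g z|).
Proof.
rewrite /avg normrM ger0_norm ?invr_ge0// ler_wpM2l ?invr_ge0//.
exact: ler_norm_sum.
Qed.

(* Averages are compared through [smooth f]: outside the inner box the defect is
   absorbed by [smooth 1], whose two averages are compared in the same way. *)
Lemma avg_diff_le s' s (f : R * R -> R) A e M osc I :
    (0 < size s')%N -> (0 < size s)%N -> 0 < e -> 0 <= osc ->
    measurable_fun setT f -> (forall z, `|f z| <= M) ->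
    (forall c w, box A c -> sq e c w -> `|f w - f c| <= osc) ->
    (\int[area]_(z in box (A + e)%R)
       (transform_norm (diff_weights s' s) z)%:E <= I%:E)%E ->
  `|avg s' f - avg s f| <=
  2 * osc + 2 * M * (1 - avg s (\1_(box (A - e)))) + 2 * M * (I / (pi * e)).
Proof.
move=> s'0 s0 e0 osc0 mf fM fosc HI.
have M0 : 0 <= M by exact: le_trans (fM (0, 0)).
set chi := smooth (cst 1) A e.
have D1 s1 : (0 < size s1)%N ->
    `|avg s1 f - avg s1 (smooth f A e)| <= osc + M * (1 - avg s1 chi).
  move=> s10; rewrite -avgB (le_trans (norm_avg_le _ _))//.
  rewrite -[osc](avg_cst _ s10) -[X in X - avg _ _](avg_cst 1 s10) -avgB -avgZ -avgD.
  by apply: avg_le => z; apply: smooth_approx => // c; exact: fosc.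
have Df : `|avg s' (smooth f A e) - avg s (smooth f A e)| <= M * (I / (pi * e)).
  by rewrite -sum_diff_weights; exact: sum_smooth_le.
have Dchi : `|avg s' chi - avg s chi| <= 1 * (I / (pi * e)).
  by rewrite -sum_diff_weights; apply: sum_smooth_le => //= _; rewrite normr1.
have inner : avg s (\1_(box (A - e))) <= avg s chi.
  apply: avg_le => z; rewrite indicE; case: (boolP (z \in _)) => [|_].
    by rewrite inE => zA; rewrite /chi smooth1_inner.
  by have /andP[] := smooth1_itv A z e0.
move: Dchi (D1 _ s'0) (D1 _ s0) Df; rewrite mul1r.
set a := avg s' f; set b := avg s f; set a1 := avg s' (smooth _ _ _).
set b1 := avg s (smooth _ _ _); set c' := avg s' chi; set c := avg s chi.
set J := I / _; set q := avg s _ => Dc Da Db Dab.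
have -> : a - b = (a - a1) + (a1 - b1) - (b - b1) by ring.
rewrite (le_trans (ler_normB _ _))//.
apply: (@le_trans _ _ (osc + M * (1 - c') + M * J + (osc + M * (1 - c)))).
  by rewrite lerD// (le_trans (ler_normD _ _))// lerD.
have Mc' : M * (1 - c') <= M * (1 - c + J).
  by rewrite ler_wpM2l//; move: Dc; rewrite ler_norml => /andP[]; lra.
have Mc : M * (1 - c) <= M * (1 - q) by rewrite ler_wpM2l// lerD2l lerN2.
rewrite mulrDr in Mc'; lra.
Qed.

End smoothing.

(** * Integrability of the Cauchy kernel *)

Lemma markov_ge0 d (T : measurableType d) (R : realType)
    (mu : {measure set T -> \bar R}) (D : set T) (f : T -> R) (M : R) :
    measurable D -> measurable_fun D f -> (forall x, 0 <= f x) -> 0 < M ->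
  (M%:E * mu (D `&` [set x | (M <= f x)%R]) <= \int[mu]_(x in D) (f x)%:E)%E.
Proof.
move=> mD mf f0 M0.
have := @le_integral_comp_abse _ _ _ mu D mD (EFin \o f) M id _ _ _ _ M0.
move=> /(_ _ _ _ _)/le_trans H.
have -> : D `&` [set x | (M <= f x)%R] =
    D `&` [set x | (M%:E <= `|(EFin \o f) x|)%E].
  apply/seteqP; split => x [Dx /=]; split => //=.
    by rewrite lee_fin ger0_norm.
  by move: b; rewrite lee_fin ger0_norm.
apply: H => //; first exact/measurable_EFinP.
rewrite le_eqVlt; apply/orP; left; apply/eqP; apply: eq_integral => x _ /=.
by rewrite ger0_norm.
Qed.

Section kernel_integrals.
Context {R : realType}.
Implicit Types (A B e M t tau l : R) (z w : R * R) (s : seq (R * R)).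

Let mbox A : measurable (box A : set (measurableTypeR R * measurableTypeR R)).
Proof. exact: measurable_box. Qed.

Definition csq (r : R) w : set (R * R) :=
  `[w.1 - r, w.1 + r] `*` `[w.2 - r, w.2 + r].

Lemma area_csq r w : 0 < r -> area (csq r w) = (4 * r ^+ 2)%:E.
Proof.
move=> e0; rewrite /csq areaX// !lebesgue_measure_itv/= !lte_fin.
rewrite !ifT; [|lra|lra].
by rewrite -!EFinB -EFinM; congr (_%:E); ring.
Qed.

Let c4 (k : nat) : R := (4 ^+ k)^-1.

(** Choose the least [k] with 4^(-k-1) below the distance. Powers of 4 as scales make the exponent
    3/2 exact: (4^(k+1))^(3/2) = 8^(k+1). *)
Lemma invdist32_dyadic z w : 1 < invdist32 z w ->
  exists k, csq (c4 k) w z /\ invdist32 z w <= 8 ^+ k.+1.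
Proof.
rewrite /invdist32 /invdist => u1.
set r := cdist z w in u1 *; have r0 : 0 <= r by exact: sqrtr_ge0.
have {}r0 : 0 < r.
  rewrite lt_neqAle r0 andbT; apply: contraTneq u1 => <-.
  by rewrite invr0 mul0r -leNgt.
have r1 : r <= 1.
  rewrite leNgt; apply: contraL u1 => r1; rewrite -leNgt.
  have i1 : r^-1 <= 1 by rewrite invf_le1// ltW.
  by rewrite mulr_ile1 ?invr_ge0 ?sqrtr_ge0// ?(ltW r0)// -sqrtr1 ler_wsqrtr.
have ex : exists k, c4 k.+1 < r.
  have := @cvg_expr R (4^-1); rewrite ger0_norm// => /(_ _)/cvgrPdist_lt.
  have q1 : (4^-1 : R) < 1 by lra.
  move=> /(_ q1 r r0)[N _ /(_ N.+1 (leqnSn N))].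
  by rewrite sub0r normrN normrX ger0_norm// exprVn => H; exists N.
case: (ex_minnP ex) => k kr kmin; exists k; split.
  have rk : r <= c4 k.
    case: k kr kmin => [|k] kr kmin; first by rewrite /c4 expr0 invr1.
    by rewrite leNgt; apply/negP => /kmin; rewrite ltnn.
  have H1 : `|z.1 - w.1| <= r.
    by rewrite -sqrtr_sqr ler_wsqrtr// lerDl sqr_ge0.
  have H2 : `|z.2 - w.2| <= r.
    by rewrite -sqrtr_sqr ler_wsqrtr// lerDr sqr_ge0.
  move: (le_trans H1 rk) (le_trans H2 rk); rewrite !ler_norml => ? ?.
  by split => /=; rewrite in_itv/=; lra.
have ru : r^-1 <= 4 ^+ k.+1.
  by rewrite -[leRHS]invrK lef_pV2 ?posrE ?invr_gt0 ?exprn_gt0// ltW.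
have su : Num.sqrt r^-1 <= 2 ^+ k.+1.
  rewrite -[leRHS]ger0_norm ?exprn_ge0// -sqrtr_sqr ler_wsqrtr//.
  by rewrite (le_trans ru)// -exprM mulnC exprM (_ : 2 ^+ 2 = 4)//; ring.
rewrite (_ : 8 = 4 * 2 :> R) ?exprMn; last by ring.
by rewrite ler_pM// ?invr_ge0 ?sqrtr_ge0// ltW.
Qed.

(** The first term is the area of [box B], where the kernel is replaced by 1; the second bounds the
    integral of its values above 1. *)
Definition K32 B : R := (2 * B) ^+ 2 + 64.

Lemma K32_gt0 B : 0 < K32 B.
Proof. by rewrite ltr_wpDl// sqr_ge0. Qed.

Lemma integral_invdist32_le B w : 0 <= B ->
  (\int[area]_(z in box B) (invdist32 z w)%:E <= (K32 B)%:E)%E.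
Proof.
move=> B0.
have mcsq r : measurable (csq r w : set (measurableTypeR R * measurableTypeR R)).
  exact: measurableX.
pose f k z : \bar R := ((8 ^+ k.+1)%:E * (\1_(csq (c4 k) w) z)%:E)%E.
have f0 k z : (0 <= f k z)%E by rewrite mule_ge0// lee_fin ?exprn_ge0.
have mf k : measurable_fun (box B) (f k).
  apply: measurable_funeM; apply/measurable_EFinP; apply: measurable_funTS.
  by apply: measurable_indic; exact: mcsq.
apply: (@le_trans _ _ (\int[area]_(z in box B) (1%:E + \sum_(k <oo) f k z))%E).
  apply: ge0_le_integral => //.
  - by move=> z _; rewrite lee_fin invdist32_ge0.
  - apply: measurable_funTS; apply/measurable_EFinP; exact: measurable_invdist32.
  - by apply: emeasurable_funD => //; by apply: ge0_emeasurable_sum => *; [exact: f0|exact: mf].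
  - move=> z _; have [u1|/invdist32_dyadic[k [zk uk]]] := leP (invdist32 z w) 1.
      by rewrite (@le_trans _ _ 1%:E) ?lee_fin// leeDl// nneseries_ge0.
    apply: (@le_trans _ _ (f k z)).
      by rewrite /f indicE mem_set// mule1 lee_fin.
    rewrite (@le_trans _ _ (\sum_(k <oo) f k z)%E)// ?leeDr ?lee_fin//.
    apply: le_trans (nneseries_lim_ge k.+1 _) => //.
    by rewrite big_nat_recr//= leeDr// sume_ge0.
rewrite ge0_integralD//; last 2 first.
- by move=> z _; exact: nneseries_ge0.
- by apply: ge0_emeasurable_sum => *; [exact: f0|exact: mf].
rewrite integral_cst//= mul1e area_box// /K32 EFinD leeD//.
rewrite integral_nneseries//.
(* The layer [k] has height 8^(k+1) on a square of area 4 / 16^k, hence mass 64/2^(k+1); the masses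
   add up to 64. *)
apply: (@le_trans _ _ (\sum_(k <oo) (64 / (2 ^ k.+1)%:R)%:E))%E; last first.
  by apply: epsilon_trick0.
apply: lee_nneseries => [k _ _|k _]; first by apply: integral_ge0 => z _; exact: f0.
rewrite /f ge0_integralZl_EFin//; last first.
- apply/measurable_EFinP; apply: measurable_funTS; by apply: measurable_indic; exact: mcsq.
rewrite integral_indic//.
apply: (@le_trans _ _ ((8 ^+ k.+1)%:E * area (csq (c4 k) w)))%E.
  rewrite lee_wpmul2l// ?lee_fin ?exprn_ge0//.
  by apply: le_measure; rewrite ?inE//; exact: measurableI.
rewrite area_csq; last by rewrite invr_gt0 exprn_gt0.
rewrite -EFinM lee_fin le_eqVlt; apply/orP; left; apply/eqP.
have c0 : (4 ^+ k : R) != 0 by rewrite expf_neq0.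
rewrite /c4 natrX !exprS (_ : 8 = 4 * 2 :> R); last by ring.
rewrite (_ : (4 ^+ k : R) = 2 ^+ k * 2 ^+ k) in c0 *; last first.
  by rewrite -exprMn; congr (_ ^+ _); ring.
rewrite exprMn (_ : (4 ^+ k : R) = 2 ^+ k * 2 ^+ k); last first.
  by rewrite -exprMn; congr (_ ^+ _); ring.
have d0 : (2 ^+ k : R) != 0 by rewrite expf_neq0.
move: d0; set b := 2 ^+ k => b0; field.
by rewrite b0.
Qed.

Definition W32 s z : R := \sum_(x <- s) invdist32 z x.

Lemma W32_ge0 s z : 0 <= W32 s z.
Proof. by apply: sumr_ge0 => x _; exact: invdist32_ge0. Qed.

Lemma measurable_W32 s : measurable_fun setT (W32 s).
Proof. by apply: measurable_sum => x; exact: measurable_invdist32. Qed.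

Lemma integral_W32_le s B : 0 <= B ->
  (\int[area]_(z in box B) (W32 s z)%:E <= ((size s)%:R * K32 B)%:E)%E.
Proof.
move=> B0; under eq_integral do rewrite /W32 -sumEFin.
rewrite ge0_integral_sum//; last 2 first.
- move=> x; apply: measurable_funTS; apply/measurable_EFinP.
  exact: measurable_invdist32.
- by move=> x z _; rewrite lee_fin invdist32_ge0.
elim: s => [|x s IH]; first by rewrite big_nil mul0r.
rewrite big_cons /= -natr1 mulrDl mul1r addrC EFinD leeD//.
exact: integral_invdist32_le.
Qed.

Lemma area_W32_le s B M : 0 <= B -> 0 < M ->
  (area (box B `&` [set z | (M <= W32 s z)%R]) <= ((size s)%:R * K32 B / M)%:E)%E.
Proof.
move=> B0 M0; rewrite EFinM muleC -lee_pdivrMl ?invr_gt0// invrK.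
apply: le_trans (integral_W32_le s B0); apply: markov_ge0 => //.
- apply: measurable_funTS; exact: measurable_W32.
- by move=> z; exact: W32_ge0.
Qed.

(** Truncation at height l^2: where [invdist] exceeds l^2, its square root exceeds l, so multiplying
    by that root and dividing by l only enlarges it. Over a set of small area the first term
    integrates to little for fixed [l], and the second is small for large [l]. *)
Lemma invdist_le_split z w l : 0 < l ->
  invdist z w <= l ^+ 2 + l^-1 * invdist32 z w.
Proof.
move=> l0; rewrite /invdist32; have := invdist_ge0 z w.
set u := invdist z w => u0; set r := Num.sqrt u.
have r0 : 0 <= r by exact: sqrtr_ge0.
have ur : u = r ^+ 2 by rewrite sqr_sqrtr.
have [rl|lr] := leP r l.
  rewrite (@le_trans _ _ (l ^+ 2))// ?ur ?ler_pXn2r ?nnegrE ?(ltW l0)//.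
  by rewrite lerDl mulr_ge0 ?invr_ge0 ?(ltW l0)// mulr_ge0 ?sqr_ge0.
rewrite (@le_trans _ _ (l^-1 * (u * r)))// ?lerDr ?sqr_ge0//.
by rewrite mulrCA ler_peMr// mulrC ler_pdivlMr// mul1r ltW.
Qed.

Definition small_set s t : set (R * R) :=
  [set z | `|\sum_(x <- s) kre z x| <= t /\ `|\sum_(x <- s) kim z x| <= t].

Lemma wsum_diff_weights (k : R * R -> R * R -> R) s' s z :
  wsum k (diff_weights s' s) z = avg s' (k z) - avg s (k z).
Proof. exact: (@sum_diff_weights _ _ _ (k z)). Qed.

Lemma transform_norm_le s' s z : transform_norm (diff_weights s' s) z <=
  2 * (avg s' (invdist z) + avg s (invdist z)).
Proof.
rewrite /transform_norm !wsum_diff_weights (_ : 2 = 1 + 1)// mulrDl mul1r.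
have H (k : R * R -> R * R -> R) s1 : (forall z w, `|k z w| <= invdist z w) ->
    `|avg s1 (k z)| <= avg s1 (invdist z).
  by move=> ku; rewrite (le_trans (norm_avg_le _ _))//; apply: avg_le => w.
by apply: lerD; rewrite (le_trans (ler_normB _ _))// lerD// H//;
  [exact: kre_le|exact: kre_le|exact: kim_le|exact: kim_le].
Qed.

Lemma measurable_small_set s t : measurable (small_set s t).
Proof.
have m1 : measurable_fun setT (fun z : R * R => `|\sum_(x <- s) kre z x|).
  apply: measurableT_comp => //; apply: measurable_sum => x; exact: measurable_kre.
have m2 : measurable_fun setT (fun z : R * R => `|\sum_(x <- s) kim z x|).
  apply: measurableT_comp => //; apply: measurable_sum => x; exact: measurable_kim.
rewrite (_ : small_set s t = [set z | `|\sum_(x <- s) kre z x| <= t] `&`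
  [set z | `|\sum_(x <- s) kim z x| <= t])//.
apply: measurableI; rewrite -[X in measurable X]setTI.
- exact: (measurable_fun_ler m1 (measurable_cst t)).
- exact: (measurable_fun_ler m2 (measurable_cst t)).
Qed.

(** The bound [g] of [crit_transform_le]. *)
Definition crit_bound (n : nat) tau t : R :=
  (n%:R + tau ^+ 3) / (n%:R * (n%:R - 1)) + tau ^+ 4 / ((n%:R - 1) * t).

Lemma area_seq s : area.-negligible [set z : R * R | z \in s].
Proof.
elim: s => [|x s IH].
  rewrite (_ : [set _ | _] = set0); first exact: negligible_set0.
  by apply/seteqP; split => z //=; rewrite in_nil.
have nx : area.-negligible ([set x.1] `*` [set x.2]).
  exists ([set x.1] `*` [set x.2]); split => //; first exact: measurableX.
  by rewrite areaX// lebesgue_measure_set1 mul0e.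
apply: negligibleS (negligibleU nx IH) => z /=.
by rewrite inE => /predU1P[->|zs]; [left; split|right].
Qed.

(** The first term comes from the points where [crit_transform_le] applies. On the remaining set the
    kernel is truncated at height l^2: the second term is the truncated part times the area of that
    set, which is estimated by Markov for [W32] and by [beta] for [small_set]; the third is the
    tail, integrated over the whole box. *)
Lemma integral_transform_norm_le s B tau t l (beta : R) :
    (1 < size s)%N -> 0 <= B -> 0 < tau -> 0 < t -> 0 < l ->
    (area (box B `&` small_set s t) <= beta%:E)%E ->
  (\int[area]_(z in box B)
     (transform_norm (diff_weights (crit_points s) s) z)%:E <=
   (2 * crit_bound (size s) tau t * (2 * B) ^+ 2 +
    4 * l ^+ 2 * ((size s)%:R * K32 B / tau ^+ 3 + beta) + 4 * l^-1 * K32 B)%:E)%E.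
Proof.
move=> s1 B0 tau0 t0 l0 small.
have s0 : (0 < size s)%N by exact: ltnW.
set s' := crit_points s.
have s'0 : (0 < size s')%N by rewrite size_crit_points// -subn1 subn_gt0.
have nE : (size s')%:R = (size s)%:R - 1 :> R.
  by rewrite size_crit_points// -subn1 natrB.
set g := crit_bound _ _ _.
have n1 : 1 < (size s)%:R :> R by rewrite ltr1n.
have g0 : 0 <= g.
  have n10 : 0 <= (size s)%:R - 1 :> R by lra.
  have tau1 := ltW tau0; have t1 := ltW t0.
  by apply: addr_ge0; apply: divr_ge0; rewrite ?addr_ge0 ?mulr_ge0 ?exprn_ge0.
have li0 : 0 <= l^-1 by rewrite invr_ge0 ltW.
pose bad : set (R * R) := [set z | (tau ^+ 3 <= W32 s z)%R] `|` small_set s t.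
have mW : measurable [set z : R * R | (tau ^+ 3 <= W32 s z)%R].
  rewrite -[X in measurable X]setTI.
  exact: (measurable_fun_ler (measurable_cst (tau ^+ 3)) (measurable_W32 s)).
have mbad : measurable bad by apply: measurableU => //; exact: measurable_small_set.
(* A majorant valid off the points of [s], hence almost everywhere. The truncation tail is added
   also on the good set, which makes every term integrable separately. *)
pose F z : R := 2 * g + 4 * l ^+ 2 * \1_bad z +
  2 * l^-1 * (avg s' (invdist32 z) + avg s (invdist32 z)).
have avg0 s2 z : 0 <= avg s2 (invdist32 z).
  by rewrite mulr_ge0 ?invr_ge0//; apply: sumr_ge0 => x _; exact: invdist32_ge0.
have HF z : z \notin s -> transform_norm (diff_weights s' s) z <= F z.
  move=> zs; rewrite /F.
  have [zb|zb] := pselect (bad z).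
    rewrite indicE mem_set// mulr1 (le_trans (transform_norm_le _ _ _))//.
    have H s2 : (0 < size s2)%N ->
        avg s2 (invdist z) <= l ^+ 2 + l^-1 * avg s2 (invdist32 z).
      move=> s20; rewrite -[l ^+ 2](avg_cst _ s20) -avgZ -avgD; apply: avg_le => w.
      exact: invdist_le_split.
    by move: (H s' s'0) (H s s0); rewrite mulrDr; lra.
  rewrite indicE memNset// mulr0 addr0 (@le_trans _ _ (2 * g))//; last first.
    by rewrite lerDl mulr_ge0 ?mulr_ge0 ?addr_ge0.
  have Wz : W32 s z <= tau ^+ 3.
    by rewrite leNgt; apply/negP => H; apply: zb; left; exact: ltW.
  have Sz : t < `|\sum_(x <- s) kre z x| \/ t < `|\sum_(x <- s) kim z x|.
    have [h1|h1] := ltP t `|\sum_(x <- s) kre z x|; first by left.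
    have [h2|h2] := ltP t `|\sum_(x <- s) kim z x|; first by right.
    by exfalso; apply: zb; right.
  have [] := crit_transform_le s1 (ltW tau0) t0 zs Wz Sz.
  rewrite -/s' -nE -/(avg s' (kre z)) -/(avg s' (kim z)) -/(avg s (kre z)).
  rewrite -/(avg s (kim z)) -!wsum_diff_weights nE => h1 h2.
  rewrite /transform_norm (_ : 2 * g = g + g); last by ring.
  exact: lerD.
have mF : measurable_fun setT F.
  apply: measurable_funD; [apply: measurable_funD => //|].
    by apply: measurable_funM => //; exact: measurable_indic.
  apply: measurable_funM => //.
  apply: measurable_funD; apply: measurable_funM => //; exact: measurable_W32.
have F0 z : 0 <= F z.
  apply: addr_ge0; first apply: addr_ge0; first by rewrite mulr_ge0.
    by apply: mulr_ge0; [apply: mulr_ge0; rewrite ?sqr_ge0|rewrite indicE].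
  by apply: mulr_ge0; [exact: mulr_ge0|exact: addr_ge0].
have mbad' : measurable (bad : set (measurableTypeR R * measurableTypeR R)) by [].
apply: (@le_trans _ _ (\int[area]_(z in box B) (F z)%:E)%E).
  apply: ae_ge0_le_integral => //.
  - by move=> z _; rewrite lee_fin; exact: transform_norm_ge0.
  - by apply: measurable_funTS; apply/measurable_EFinP; exact: measurable_transform_norm.
  - by move=> z _; rewrite lee_fin.
  - by apply: measurable_funTS; apply/measurable_EFinP.
  - apply: negligibleS (area_seq s) => z; apply: contra_notP => /negP zs _.
    by rewrite lee_fin HF.
have mW' s2 : measurable_fun (box B) (fun z => (W32 s2 z)%:E).
  apply: measurable_funTS; apply/measurable_EFinP; exact: measurable_W32.
have W0 s2 z : (0 <= (W32 s2 z)%:E)%E by rewrite lee_fin W32_ge0.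
have mI : measurable_fun (box B) (fun z => (\1_bad z)%:E : \bar R).
  by apply/measurable_EFinP; apply: measurable_funTS; exact: measurable_indic.
pose k1 := 2 * l^-1 * (size s')%:R^-1.
pose k2 := 2 * l^-1 * (size s)%:R^-1.
have k10 : 0 <= k1 by rewrite !mulr_ge0// invr_ge0.
have k20 : 0 <= k2 by rewrite !mulr_ge0// invr_ge0.
have l20 : 0 <= 4 * l ^+ 2 by rewrite mulr_ge0 ?sqr_ge0.
have -> : (\int[area]_(z in box B) (F z)%:E = \int[area]_(z in box B)
    (((2 * g)%R%:E + (4 * l ^+ 2)%R%:E * (\1_bad z)%:E) +
     (k1%:E * (W32 s' z)%:E + k2%:E * (W32 s z)%:E)))%E.
  apply: eq_integral => z _; rewrite -!EFinM -!EFinD /F /avg /W32 /k1 /k2; congr (_ + _)%:E.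
  by rewrite mulrDr !mulrA.
have g20 : (0 <= (2 * g)%:E)%E by rewrite lee_fin mulr_ge0.
have b0 z : (0 <= (4 * l ^+ 2)%:E * (\1_bad z)%:E)%E.
  by rewrite -EFinM lee_fin; apply: mulr_ge0 => //; rewrite indicE.
have w1 z : (0 <= k1%:E * (W32 s' z)%:E)%E by rewrite mule_ge0.
have w2 z : (0 <= k2%:E * (W32 s z)%:E)%E by rewrite mule_ge0.
have mI2 : measurable_fun (box B) (fun z => ((4 * l ^+ 2)%R%:E * (\1_bad z)%:E)%E).
  by apply: measurable_funeM; exact: mI.
have mW2 k s2 : measurable_fun (box B) (fun z => (k%:E * (W32 s2 z)%:E)%E).
  by apply: measurable_funeM; exact: mW'.
rewrite ge0_integralD//; last 4 first.
- by move=> z _; apply: adde_ge0.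
- by apply: emeasurable_funD; [|exact: mI2].
- by move=> z _; apply: adde_ge0.
- by apply: emeasurable_funD; exact: mW2.
rewrite ge0_integralD//.
rewrite ge0_integralD//; [|exact: mW2|exact: mW2].
have -> : (\int[area]_(z in box B) (2 * g)%R%:E =
    ((2 * g) * (2 * B) ^+ 2)%R%:E)%E.
  by rewrite [RHS]EFinM -area_box//; exact: integral_cst.
have -> : (\int[area]_(z in box B) ((4 * l ^+ 2)%R%:E * (\1_bad z)%:E) =
    (4 * l ^+ 2)%R%:E * area (bad `&` box B))%E.
  rewrite -(_ : \int[area]_(z in box B) (\1_bad z)%:E = area (bad `&` box B))%E.
    by apply: ge0_integralZl_EFin.
  exact: integral_indic.
have E3 k s2 : 0 <= k -> (\int[area]_(z in box B) (k%:E * (W32 s2 z)%:E) =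
    k%:E * \int[area]_(z in box B) (W32 s2 z)%:E)%E.
  by move=> k0; apply: ge0_integralZl_EFin => //; exact: mW'.
rewrite !E3//.
have K0 : 0 <= K32 B by rewrite ltW// K32_gt0.
rewrite !EFinD; apply: leeD; [apply: leeD|] => //.
- rewrite [leRHS]EFinM; apply: lee_wpmul2l; first by rewrite lee_fin.
  rewrite setIC setIUr; apply: le_trans (measureU2 _ _ _) _.
  + exact: measurableI.
  + by apply: measurableI => //; exact: measurable_small_set.
  rewrite EFinD leeD//; apply: area_W32_le => //.
  by rewrite exprn_gt0.
- have H s2 : (0 < size s2)%N ->
    (((2 * l^-1 * (size s2)%:R^-1)%:E * \int[area]_(x in box B) (W32 s2 x)%:E <=
     (2 * l^-1 * K32 B)%:E)%E).
    move=> s20; have -> : 2 * l^-1 * K32 B =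
        (2 * l^-1 * (size s2)%:R^-1) * ((size s2)%:R * K32 B).
      by rewrite -!mulrA mulKf// pnatr_eq0 -lt0n.
    rewrite [leRHS]EFinM; apply: lee_wpmul2l; last exact: integral_W32_le.
    by rewrite lee_fin !mulr_ge0// invr_ge0.
  rewrite (_ : 4 * l^-1 * K32 B = 2 * l^-1 * K32 B + 2 * l^-1 * K32 B); last by ring.
  by rewrite EFinD leeD// H.
Qed.

End kernel_integrals.

(** * Expectation and the law of large numbers *)

Section bounded_expectation.
Context {R : realType} d (T : measurableType d) (P : probability T R).
Implicit Types (Y Z : T -> R) (a c M : R).

(** Under a probability measure such functions are integrable and closed under sums and products, so
    expectations can be handled as plain real numbers. *)
Definition bdmeas Z := measurable_fun setT Z /\ exists M, forall x, `|Z x| <= M.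

Definition Ex Z : R := \int[P]_x Z x.

Lemma bdmeas_integrable Z : bdmeas Z -> P.-integrable setT (EFin \o Z).
Proof.
move=> [mZ [M ZM]]; apply: measurable_bounded_integrable => //.
- by rewrite /= probability_setT ltry.
- exists M; split; first exact: num_real.
  by move=> x Mx c _ /=; rewrite (le_trans (ZM c))// ltW.
Qed.

Lemma bdmeas_cst c : bdmeas (cst c).
Proof. by split=> //; exists `|c|. Qed.

Lemma bdmeasD Y Z : bdmeas Y -> bdmeas Z -> bdmeas (fun x => Y x + Z x).
Proof.
move=> [mY [M YM]] [mZ [N ZN]]; split; first exact: measurable_funD.
by exists (M + N) => x; rewrite (le_trans (ler_normD _ _))// lerD.
Qed.

Lemma bdmeasM Y Z : bdmeas Y -> bdmeas Z -> bdmeas (fun x => Y x * Z x).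
Proof.
move=> [mY [M YM]] [mZ [N ZN]]; split; first exact: measurable_funM.
by exists (M * N) => x; rewrite normrM ler_pM.
Qed.

Lemma bdmeasZ c Z : bdmeas Z -> bdmeas (fun x => c * Z x).
Proof. exact/bdmeasM/bdmeas_cst. Qed.

Lemma bdmeasB Y Z : bdmeas Y -> bdmeas Z -> bdmeas (fun x => Y x - Z x).
Proof.
move=> bY bZ; have := bdmeasD bY (bdmeasZ (-1) bZ).
by congr bdmeas; apply/funext => x; rewrite mulN1r.
Qed.

Lemma bdmeas_sum (I : Type) (r : seq I) (F : I -> T -> R) :
  (forall i, bdmeas (F i)) -> bdmeas (fun x => \sum_(i <- r) F i x).
Proof.
move=> bF; elim: r => [|i r IH].
  have := bdmeas_cst 0; congr bdmeas; apply/funext => x; by rewrite big_nil.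
have := bdmeasD (bF i) IH; congr bdmeas; apply/funext => x; by rewrite big_cons.
Qed.

Lemma bdmeas_indic (A : set T) : measurable A -> bdmeas (\1_A).
Proof.
move=> mA; split; first exact: measurable_indic.
by exists 1 => x; rewrite indicE normr_nat lern1; case: (x \in A).
Qed.

Lemma Ex_cst c : Ex (cst c) = c.
Proof. by rewrite /Ex Rintegral_cst//= probability_setT mulr1. Qed.

Lemma ExD Y Z : bdmeas Y -> bdmeas Z -> Ex (fun x => Y x + Z x) = Ex Y + Ex Z.
Proof. by move=> bY bZ; rewrite /Ex RintegralD//; exact: bdmeas_integrable. Qed.

Lemma ExZ c Z : bdmeas Z -> Ex (fun x => c * Z x) = c * Ex Z.
Proof. by move=> bZ; rewrite /Ex RintegralZl//; exact: bdmeas_integrable. Qed.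

Lemma ExB Y Z : bdmeas Y -> bdmeas Z -> Ex (fun x => Y x - Z x) = Ex Y - Ex Z.
Proof. by move=> bY bZ; rewrite /Ex RintegralB//; exact: bdmeas_integrable. Qed.

Lemma Ex_sum (I : Type) (r : seq I) (F : I -> T -> R) :
  (forall i, bdmeas (F i)) ->
  Ex (fun x => \sum_(i <- r) F i x) = \sum_(i <- r) Ex (F i).
Proof.
move=> bF; elim: r => [|i r IH].
  rewrite big_nil -[RHS](Ex_cst 0); congr Ex; apply/funext => x; by rewrite big_nil.
rewrite big_cons -IH -ExD//; last exact: bdmeas_sum.
by congr Ex; apply/funext => x; rewrite big_cons.
Qed.

Lemma le_Ex Y Z : bdmeas Y -> bdmeas Z -> (forall x, Y x <= Z x) -> Ex Y <= Ex Z.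
Proof. by move=> bY bZ YZ; apply: le_Rintegral => //; exact: bdmeas_integrable. Qed.

Lemma Ex_indic (A : set T) : measurable A -> Ex (\1_A) = fine (P A).
Proof. by move=> mA; rewrite /Ex /Rintegral integral_indic// setIT. Qed.

Lemma abs_Ex_le Z M : bdmeas Z -> (forall x, `|Z x| <= M) -> `|Ex Z| <= M.
Proof.
move=> bZ ZM; rewrite ler_norml; apply/andP; split.
  rewrite -[leLHS]Ex_cst; apply: le_Ex => //; first exact: bdmeas_cst.
  by move=> x; have := ZM x; rewrite ler_norml => /andP[].
rewrite -[leRHS]Ex_cst; apply: le_Ex => //; first exact: bdmeas_cst.
by move=> x; have := ZM x; rewrite ler_norml => /andP[].
Qed.

Lemma Ex_ge0 Z : (forall x, 0 <= Z x) -> 0 <= Ex Z.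
Proof. by move=> Z0; apply: Rintegral_ge0 => x _. Qed.

Lemma prob_le_Ex (A : set T) Z a : measurable A -> bdmeas Z -> (forall x, 0 <= Z x) ->
  0 < a -> (forall x, A x -> a <= Z x) -> fine (P A) <= Ex Z / a.
Proof.
move=> mA bZ Z0 a0 AZ; rewrite ler_pdivlMr// mulrC -Ex_indic// -ExZ; last first.
  exact: bdmeas_indic.
apply: le_Ex => //; first exact/bdmeasZ/bdmeas_indic.
move=> x; rewrite indicE; case: (boolP (x \in A)) => [|_].
  by rewrite inE mulr1 => /AZ.
by rewrite mulr0.
Qed.

End bounded_expectation.

(** The sum counts the positive integers up to [t], so it is the floor of [t]. *)
Lemma count_le_floor (R : realType) (n : nat) (t : R) : 0 <= t -> t <= n%:R ->
  t - 1 <= \sum_(i < n) (i.+1%:R <= t)%R%:R <= t.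
Proof.
move=> t0; set f := fun n => \sum_(i < n) (i.+1%:R <= t)%R%:R : R.
have fS m : f m.+1 = f m + (m.+1%:R <= t)%R%:R by rewrite /f big_ord_recr.
have fa m : m%:R <= t -> f m = m%:R.
  elim: m => [|m IH] mt; first by rewrite /f big_ord0.
  by rewrite fS mt IH ?natr1// (le_trans _ mt)// ler_nat.
have fb m : f m <= t.
  elim: m => [|m IH]; first by rewrite /f big_ord0.
  rewrite fS; have [mt|_] := leP m.+1%:R t; last by rewrite addr0.
  by rewrite fa ?natr1// (le_trans _ mt)// ler_nat.
have fc m : t <= m%:R -> t - 1 <= f m.
  elim: m => [|m IH] mt; first by rewrite /f big_ord0; move: mt; lra.
  rewrite fS; have [{}/IH tm|tm] := leP t m%:R.
    by rewrite (le_trans tm)// lerDl.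
  rewrite fa ?(ltW tm)//; have : 0 <= ((m.+1%:R <= t)%R%:R : R) by [].
  by move: mt; rewrite -natr1; lra.
by move=> tn; apply/andP; split; [exact: fc|exact: fb].
Qed.

(** * From indicators to bounded functions in a factorization of expectations *)

Section conditional_law.
Context {R : realType} d d' (T : measurableType d) (S : measurableType d').
Variables (P : probability T R) (mu : probability S R) (Y : T -> S) (Z : T -> R) (c : R).
Hypotheses (mY : measurable_fun setT Y) (bZ : bdmeas Z).
Hypothesis ZY : forall A, measurable A ->
  Ex P (fun x => Z x * \1_A (Y x)) = c * fine (mu A).

Let bdmeas_comp (h : S -> R) : bdmeas h -> bdmeas (h \o Y).
Proof.
move=> [mh [M hM]]; split; first exact: measurableT_comp.
by exists M => x; exact: hM.
Qed.

(* A function with values in [0, 1] is within 1/n of the average of the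
   indicators of its n superlevel sets. *)
Let Ex_comp01 (h : S -> R) : measurable_fun setT h -> (forall y, 0 <= h y <= 1) ->
  Ex P (fun x => Z x * h (Y x)) = c * Ex mu h.
Proof.
move=> mh h01.
have bh : bdmeas h.
  by split => //; exists 1 => y; have /andP[h0 h1] := h01 y; rewrite ger0_norm.
have [_ [M ZM]] := bZ.
suff H n : `|Ex P (fun x => Z x * h (Y x)) - c * Ex mu h| <= (M + `|c|) / n.+1%:R.
  apply/eqP; rewrite -subr_eq0 -normr_le0; apply/ler_addgt0Pl => e e0.
  rewrite addr0.
  have MC : 0 <= M + `|c| by rewrite addr_ge0// (le_trans _ (ZM point)).
  have [n ne] : exists n, (M + `|c|) / n.+1%:R <= e.
    exists (Num.truncn ((M + `|c|) / e)); rewrite ler_pdivrMr// mulrC -ler_pdivrMr//.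
    exact/ltW/Num.Theory.truncnS_gt.
  exact: le_trans (H n) ne.
set N : R := n.+1%:R.
have N0 : 0 < N by rewrite ltr0n.
pose A (i : nat) : set S := [set y | (i.+1%:R <= N * h y)%R].
have mA i : measurable (A i).
  rewrite -[A i]setTI; apply: (measurable_fun_ler (measurable_cst _)) => //.
  exact: measurable_funM.
pose hn y : R := N^-1 * \sum_(i < n.+1) \1_(A i) y.
have hnh y : `|h y - hn y| <= N^-1.
  have /andP[h0 h1] := h01 y.
  have := @count_le_floor R n.+1 (N * h y); rewrite mulr_ge0 ?(ltW N0)// ler_piMr ?(ltW N0)//.
  move=> /(_ isT isT).
  rewrite /hn (_ : \sum_(i < n.+1) \1_(A i) y =
      \sum_(i < n.+1) (i.+1%:R <= N * h y)%R%:R); last first.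
    apply: eq_bigr => i _; rewrite indicE; congr (nat_of_bool _)%:R.
    by apply/idP/idP; rewrite inE.
  set s := \sum_(_ < _) _ => /andP[s1 s2].
  rewrite -[h y](mulKf (lt0r_neq0 N0)) -mulrBr normrM ger0_norm ?invr_ge0 ?(ltW N0)//.
  rewrite -[leRHS]mulr1 ler_wpM2l ?invr_ge0 ?(ltW N0)// ler_norml; lra.
have bI i : bdmeas (\1_(A i) : S -> R) by exact: bdmeas_indic.
have bhn : bdmeas hn by apply: bdmeasZ; apply: bdmeas_sum => i.
have bZI i : bdmeas (fun x => Z x * \1_(A i) (Y x)).
  exact: bdmeasM bZ (bdmeas_comp (bI i)).
have E1 : Ex P (fun x => Z x * hn (Y x)) = c * Ex mu hn.
  rewrite [Ex mu hn]ExZ; last by apply: bdmeas_sum => i.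
  rewrite Ex_sum// (_ : (fun x => _) =
      (fun x => N^-1 * \sum_(i < n.+1) Z x * \1_(A i) (Y x))); last first.
    by apply/funext => x; rewrite /hn mulrCA mulr_sumr.
  rewrite ExZ; last by apply: bdmeas_sum => i.
  rewrite Ex_sum// mulrCA; congr (_ * _); rewrite mulr_sumr.
  by apply: eq_bigr => i _; rewrite ZY// Ex_indic.
have bZh : bdmeas (fun x => Z x * h (Y x)) by exact: bdmeasM bZ (bdmeas_comp bh).
have bZhn : bdmeas (fun x => Z x * hn (Y x)) by exact: bdmeasM bZ (bdmeas_comp bhn).
have -> : Ex P (fun x => Z x * h (Y x)) - c * Ex mu h =
    Ex P (fun x => Z x * h (Y x) - Z x * hn (Y x)) - c * Ex mu (fun y => h y - hn y).
  by rewrite !ExB// E1; ring.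
rewrite (le_trans (ler_normB _ _))// mulrDl lerD//.
  apply: abs_Ex_le; first exact: bdmeasB.
  by move=> x; rewrite -mulrBr normrM ler_pM.
rewrite normrM ler_wpM2l//; apply: abs_Ex_le => //; exact: bdmeasB.
Qed.

(** An affine change brings [h] into [0, 1]. The constant term needs E Z = c, which is [ZY] for the
    full set. *)
Lemma Ex_comp (h : S -> R) : bdmeas h -> Ex P (fun x => Z x * h (Y x)) = c * Ex mu h.
Proof.
move=> bh; have [mh [M hM]] := bh.
pose K := `|M| + 1; have K0 : 0 < K by rewrite ltr_pwDr.
have hK y : `|h y| <= K by rewrite (le_trans (hM y))// (le_trans (ler_norm _))// lerDl.
pose h' y := (2 * K)^-1 * (h y + K).
have h01 y : 0 <= h' y <= 1.
  have := hK y; rewrite ler_norml => /andP[? ?].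
  rewrite /h' mulr_ge0 ?invr_ge0 ?mulr_ge0 ?(ltW K0)//=; last by lra.
  by rewrite mulrC ler_pdivrMr ?mulr_gt0// mul1r; lra.
have bh' : bdmeas h' by apply: bdmeasZ; apply: bdmeasD => //; exact: bdmeas_cst.
have hE : h = (fun y => 2 * K * h' y - K).
  by apply/funext => y; rewrite /h' mulVKf ?addrK// mulf_neq0// gt_eqF.
have E := Ex_comp01 (bh'.1) h01.
have E0 : Ex P Z = c.
  have := ZY measurableT; rewrite probability_setT /= mulr1 => <-.
  by congr Ex; apply/funext => x; rewrite indicT mulr1.
have bZh' : bdmeas (fun x => Z x * h' (Y x)) by exact: bdmeasM bZ (bdmeas_comp bh').
rewrite hE (_ : (fun x => _) = (fun x => 2 * K * (Z x * h' (Y x)) - K * Z x)); last first.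
  by apply/funext => x; ring.
have -> : Ex mu (fun y => 2 * K * h' y - K) = 2 * K * Ex mu h' - K.
  rewrite ExB; [|exact: bdmeasZ|exact: bdmeas_cst].
  by rewrite (ExZ mu (2 * K) bh') [Ex mu (fun=> K)]Ex_cst.
rewrite ExB; [|exact: bdmeasZ|exact: bdmeasZ].
by rewrite (ExZ P (2 * K) bZh') (ExZ P K bZ) E E0; ring.
Qed.

End conditional_law.

(** * Independence of past and future, and the law of large numbers *)

Section iid_sequence.
Context {R : realType} (mu : probability (R * R)%type R).
Context (d : measure_display) (T : measurableType d) (P : probability T R).
Context (X : nat -> T -> R * R).
Hypothesis mX : forall j, measurable_fun setT (X j).
Hypothesis lawX : forall j (A : set (R * R)), measurable A -> P (X j @^-1` A) = mu A.
Hypothesis indX : mutually_independent P X.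
Implicit Types (Y Z : T -> R) (g h : R * R -> R) (J : seq nat)
  (A : nat -> set (R * R)).

Let meas_pre A J : (forall j, j \in J -> measurable (A j)) ->
  measurable (\big[setI/setT]_(j <- J) (X j @^-1` A j)).
Proof.
move=> mA; rewrite big_seq; apply: bigsetI_measurable => j jJ.
by rewrite -[X in measurable X]setTI; apply: mX => //; exact: mA.
Qed.

(* [past m Z]: the bounded variable [Z] is independent of [X m, X m.+1, ...]. *)
Definition past m Z := bdmeas Z /\ forall J A, uniq J ->
  (forall j, j \in J -> (m <= j)%N) -> (forall j, j \in J -> measurable (A j)) ->
  Ex P (fun x => Z x * \1_(\big[setI/setT]_(j <- J) (X j @^-1` A j)) x) =
  Ex P Z * \prod_(j <- J) fine (mu (A j)).

Lemma past_cst m c : past m (cst c).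
Proof.
split; first exact: bdmeas_cst.
move=> J A uJ _ mA; rewrite Ex_cst ExZ; last exact/bdmeas_indic/meas_pre.
rewrite Ex_indic ?indX//; last exact: meas_pre.
congr (_ * _); rewrite (eq_big_seq (fun j => mu (A j))); last first.
  by move=> j jJ; rewrite lawX//; exact: mA.
elim: J {uJ} mA => [|i J IH] mA; first by rewrite !big_nil.
rewrite !big_cons fineM ?IH//.
- by move=> j jJ; apply: mA; rewrite inE jJ orbT.
- by rewrite fin_num_measure//; apply: mA; rewrite mem_head.
- rewrite big_seq; apply: (big_ind (fun x => x \is a fin_num)) => //.
    by move=> x y fx fy; rewrite fin_numM.
  by move=> j jJ; rewrite fin_num_measure//; apply: mA; rewrite inE jJ orbT.
Qed.

Lemma past_leq m n Z : (m <= n)%N -> past m Z -> past n Z.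
Proof.
move=> mn [bZ H]; split=> // J A uJ nJ mA; apply: H => // j jJ.
exact: leq_trans (nJ j jJ).
Qed.

Lemma pastD m Y Z : past m Y -> past m Z -> past m (fun x => Y x + Z x).
Proof.
move=> [bY HY] [bZ HZ]; split; first exact: bdmeasD.
move=> J A uJ mJ mA; have b1 := bdmeas_indic (meas_pre mA).
rewrite ExD// mulrDl -HY// -HZ// -ExD; [|exact: bdmeasM|exact: bdmeasM].
by congr Ex; apply/funext => x; rewrite mulrDl.
Qed.

Lemma pastZ m a Z : past m Z -> past m (fun x => a * Z x).
Proof.
move=> [bZ HZ]; split; first exact: bdmeasZ.
move=> J A uJ mJ mA; have b1 := bdmeas_indic (meas_pre mA).
rewrite ExZ// -mulrA -HZ// -ExZ; last exact: bdmeasM.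
by congr Ex; apply/funext => x; rewrite mulrA.
Qed.

Lemma bdmeas_X h j : bdmeas h -> bdmeas (fun x => h (X j x)).
Proof.
move=> [mh [M hM]]; split; last by exists M.
exact: (measurableT_comp mh (mX j)).
Qed.

(** For indices [J] beyond [m], the weight [Z] times the indicator of the event over [J] satisfies
    the hypothesis of [Ex_comp] for [X m]: testing it against a set [B] is an instance of [past m Z]
    for the list [m :: J]. *)
Lemma past_step m Z h : past m Z -> bdmeas h ->
  past m.+1 (fun x => Z x * h (X m x)) /\
  Ex P (fun x => Z x * h (X m x)) = Ex P Z * Ex mu h.
Proof.
move=> [bZ HZ] bh.
have key J A : uniq J -> (forall j, j \in J -> (m < j)%N) ->
    (forall j, j \in J -> measurable (A j)) ->
    Ex P (fun x => Z x * \1_(\big[setI/setT]_(j <- J) (X j @^-1` A j)) x * h (X m x)) =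
    Ex P Z * \prod_(j <- J) fine (mu (A j)) * Ex mu h.
  move=> uJ mJ mA; have b1 := bdmeas_indic (meas_pre mA).
  apply: (@Ex_comp _ _ _ _ _ P mu (X m)) => //; first exact: bdmeasM.
  move=> B mB.
  have mJm : m \notin J by apply/negP => /mJ; rewrite ltnn.
  (* The family [A] with the set at index [m] replaced by [B]. *)
  pose A' j := if j == m then B else A j.
  have AA' j : j \in J -> A' j = A j.
    by move=> jJ; rewrite /A'; case: eqP => // jm; move: mJm; rewrite -jm jJ.
  have := HZ (m :: J) A'; rewrite /= mJm uJ !big_cons.
  have -> : \big[setI/setT]_(j <- J) (X j @^-1` A' j) =
      \big[setI/setT]_(j <- J) (X j @^-1` A j).
    by apply: eq_big_seq => j /AA' ->.
  have -> : \prod_(j <- J) fine (mu (A' j)) = \prod_(j <- J) fine (mu (A j)).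
    by apply: eq_big_seq => j /AA' ->.
  rewrite {2 3}/A' eqxx => H.
  rewrite -mulrA [_ * fine (mu B)]mulrC -H//.
  - congr Ex; apply/funext => x; rewrite -mulrA; congr (_ * _).
    by rewrite indicI /= mulrC.
  - by move=> j; rewrite inE => /predU1P[->//|/mJ/ltnW].
  - move=> j; rewrite inE => /predU1P[->|jJ]; first by rewrite /A' eqxx.
    by rewrite AA'//; exact: mA.
have E : Ex P (fun x => Z x * h (X m x)) = Ex P Z * Ex mu h.
  have := key [::] (fun=> setT) isT; rewrite !big_nil mulr1 => <-//.
  by congr Ex; apply/funext => x; rewrite indicT mulr1.
split=> //; split; first by apply: bdmeasM => //; exact: bdmeas_X.
move=> J A uJ mJ mA; rewrite E mulrAC -key//.
by congr Ex; apply/funext => x; rewrite mulrAC.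
Qed.

Lemma past_X m h : bdmeas h -> past m.+1 (fun x => h (X m x)) /\
  Ex P (fun x => h (X m x)) = Ex mu h.
Proof.
move=> bh; have := past_step (past_cst m 1) bh; rewrite Ex_cst mul1r.
rewrite (_ : (fun x => cst 1 x * h (X m x)) = (fun x => h (X m x)))//.
by apply/funext => x; rewrite mul1r.
Qed.

Lemma past_sum m h : bdmeas h -> past m (fun x => \sum_(j < m) h (X j x)).
Proof.
move=> bh; elim: m => [|m IH].
  have := past_cst 0 0; congr past; apply/funext => x; by rewrite big_ord0.
have := pastD (past_leq (leqnSn m) IH) (past_X m bh).1.
by congr past; apply/funext => x; rewrite big_ord_recr.
Qed.

(** When the square of the sum is expanded, the cross term with the newest variable has mean 0 by
    [past_step]. *)
Lemma Ex_sqr_sum_centered m h M : bdmeas h -> (forall y, `|h y| <= M) -> Ex mu h = 0 ->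
  Ex P (fun x => (\sum_(j < m) h (X j x)) ^+ 2) <= m%:R * M ^+ 2.
Proof.
move=> bh hM h0; elim: m => [|m IH].
  rewrite mul0r (_ : (fun x => _) = cst 0) ?Ex_cst//.
  by apply/funext => x; rewrite big_ord0 expr0n.
pose S x := \sum_(j < m) h (X j x).
have pS : past m S := past_sum m bh.
have [bS _] := pS.
have bhX := bdmeas_X m bh.
have [_ E] := past_step pS bh.
rewrite (_ : (fun x => _) = (fun x => S x ^+ 2 + 2 * (S x * h (X m x)) + h (X m x) ^+ 2)).
  have bS2 : bdmeas (fun x => S x ^+ 2) by exact: bdmeasM.
  have bSh : bdmeas (fun x => 2 * (S x * h (X m x))) by exact/bdmeasZ/bdmeasM.
  have bh2 : bdmeas (fun x => h (X m x) ^+ 2) by exact: bdmeasM.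
  rewrite ExD//; last exact: bdmeasD.
  rewrite ExD// ExZ; last exact: bdmeasM.
  rewrite E h0 !mulr0 addr0 -natr1 mulrDl mul1r lerD//.
  rewrite (le_trans (ler_norm _))//; apply: abs_Ex_le => // x.
  by rewrite normrX lerXn2r ?nnegrE// (le_trans _ (hM point)).
by apply/funext => x; rewrite big_ord_recr /= -/(S x); ring.
Qed.

(** Chebyshev's inequality for the centred function, which is bounded by [2 * M]. *)
Lemma law_large_numbers m h M theta : (0 < m)%N -> 0 < theta ->
    bdmeas h -> (forall y, `|h y| <= M) ->
  fine (P [set x | (theta <= `|m%:R^-1 * (\sum_(j < m) h (X j x)) - Ex mu h|)%R]) <=
    (2 * M) ^+ 2 / (m%:R * theta ^+ 2).
Proof.
move=> m0 th0 bh hM.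
have mR : 0 < m%:R :> R by rewrite ltr0n.
pose h0 y := h y - Ex mu h.
have bh0 : bdmeas h0 by apply: bdmeasB => //; exact: bdmeas_cst.
have h0M y : `|h0 y| <= 2 * M.
  rewrite (le_trans (ler_normB _ _))// (_ : 2 * M = M + M); last by ring.
  by rewrite lerD//; exact: abs_Ex_le.
have h00 : Ex mu h0 = 0.
  by rewrite ExB//; [rewrite [X in _ - X]Ex_cst subrr|exact: bdmeas_cst].
have bS2 : bdmeas (fun x => (\sum_(j < m) h0 (X j x)) ^+ 2).
  by apply: bdmeasM; apply: bdmeas_sum => j; exact: bdmeas_X.
have SE x : m%:R^-1 * (\sum_(j < m) h (X j x)) - Ex mu h =
    m%:R^-1 * (\sum_(j < m) h0 (X j x)).
  rewrite /h0 sumrB mulrBr; congr (_ - _).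
  by rewrite sumr_const card_ord -[Ex _ _ *+ m]mulr_natl mulKf// gt_eqF.
rewrite (_ : [set x | _] =
    [set x | ((m%:R * theta) ^+ 2 <= (\sum_(j < m) h0 (X j x)) ^+ 2)%R]); last first.
  apply/seteqP; split => x /=; rewrite SE normrM ger0_norm ?invr_ge0// [m%:R^-1 * _]mulrC ler_pdivlMr//.
    by move=> H; rewrite -[leRHS]real_normK ?num_real// mulrC lerXn2r ?nnegrE ?mulr_ge0 ?(ltW th0).
  rewrite -[leRHS]real_normK ?num_real// ler_pXn2r ?nnegrE ?mulr_ge0 ?(ltW th0)//.
  by rewrite mulrC.
apply: (@le_trans _ _ (Ex P (fun x => (\sum_(j < m) h0 (X j x)) ^+ 2) / (m%:R * theta) ^+ 2)).
  apply: prob_le_Ex => //.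
  - rewrite -[X in measurable X]setTI.
    exact: (measurable_fun_ler (measurable_cst _) bS2.1).
  - by move=> x; exact: sqr_ge0.
  - by rewrite exprn_gt0// mulr_gt0.
rewrite [leRHS](_ : _ = m%:R * (2 * M) ^+ 2 / (m%:R * theta) ^+ 2); last first.
  by field; rewrite !gt_eqF.
by rewrite ler_wpM2r ?invr_ge0 ?sqr_ge0//; exact: Ex_sqr_sum_centered.
Qed.

End iid_sequence.

(** * Anticoncentration *)

Section nondegenerate_variables.
Context {R : realType} d (S : measurableType d) (mu : probability S R).
Implicit Types (f g : S -> R) (a u v : R).

Lemma probability0_fine (A : set S) : measurable A -> fine (mu A) <= 0 -> mu A = 0%E.
Proof.
move=> mA A0; have Af : mu A \is a fin_num by exact: fin_num_measure.
by move: A0; rewrite -lee_fin (fineK Af) => A0; apply/eqP; rewrite -measure_le0.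
Qed.

Lemma measurable_le_fun f a : measurable_fun setT f -> measurable [set y | f y <= a].
Proof.
move=> mf; rewrite -[X in measurable X]setTI.
exact: (measurable_fun_ler mf (measurable_cst a)).
Qed.

Lemma measurable_ge_fun f a : measurable_fun setT f -> measurable [set y | a <= f y].
Proof.
move=> mf; rewrite -[X in measurable X]setTI.
exact: (measurable_fun_ler (measurable_cst a) mf).
Qed.

Lemma measurable_lt_fun f a : measurable_fun setT f -> measurable [set y | f y < a].
Proof.
move=> mf; rewrite -[X in measurable X]setTI.
exact: (measurable_fun_ltr mf (measurable_cst a)).
Qed.

Lemma measurable_gt_fun f a : measurable_fun setT f -> measurable [set y | a < f y].
Proof.
move=> mf; rewrite -[X in measurable X]setTI.
exact: (measurable_fun_ltr (measurable_cst a) mf).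
Qed.

(** If [f] were almost surely at most its mean m, then m - f would be almost surely nonnegative with
    mean 0; Markov at the levels 1/(k+1) would give f = m almost surely. *)
Lemma gt_Ex_pos f : bdmeas f -> (forall a, mu [set y | f y = a] != 1%E) ->
  mu [set y | Ex mu f < f y] != 0%E.
Proof.
move=> bf nc; have [mf [M fM]] := bf; apply/eqP => G0.
set m := Ex mu f in G0.
have mG : measurable [set y | m < f y] by exact: measurable_gt_fun.
have lt0 : mu.-negligible [set y | f y < m].
  pose A (k : nat) := [set y | f y <= m - k.+1%:R^-1].
  have -> : [set y | f y < m] = \bigcup_k A k.
    apply/seteqP; split => y /=; last first.
      by move=> [k _]; rewrite /A /= => /le_lt_trans; apply; rewrite gtrBl invr_gt0 ltr0n.
    move=> fm; have fm0 : 0 < m - f y by rewrite subr_gt0.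
    exists (Num.truncn (m - f y)^-1) => //; rewrite /A /= lerBrDr addrC -lerBrDr.
    rewrite -[leRHS]invrK lef_pV2 ?posrE ?invr_gt0 ?ltr0n//.
    exact/ltW/Num.Theory.truncnS_gt.
  apply: negligible_bigcup => k.
  have mA : measurable (A k) by exact: measurable_le_fun.
  apply/negligibleP => //; apply: probability0_fine => //.
  pose K := M + `|m|.
  have wK y : `|m - f y| <= K by rewrite (le_trans (ler_normB _ _))// addrC lerD.
  have K0 : 0 <= K by exact: le_trans (wK point).
  have kV0 : 0 < k.+1%:R^-1 :> R by rewrite invr_gt0 ltr0n.
  (* Adding [K] on the null set where f exceeds m makes m - f nonnegative everywhere without
     changing its mean. *)
  pose W y := (m - f y) + K * \1_[set y | m < f y] y.
  have bW1 : bdmeas (fun y => m - f y) by apply: bdmeasB => //; exact: bdmeas_cst.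
  have bW2 : bdmeas (fun y => K * \1_[set y | m < f y] y) by exact/bdmeasZ/bdmeas_indic.
  have bW : bdmeas W by exact: bdmeasD.
  have EW : Ex mu W = 0.
    rewrite ExD// ExB//; last exact: bdmeas_cst.
    rewrite [Ex mu (fun=> m)]Ex_cst subrr ExZ; last exact: bdmeas_indic.
    by rewrite Ex_indic// G0 mulr0 addr0.
  have := @prob_le_Ex _ _ _ mu (A k) W k.+1%:R^-1 mA bW; rewrite EW mul0r; apply => //.
  - move=> y; rewrite /W indicE; case: (boolP (y \in _)).
      by rewrite mulr1 => _; have := wK y; rewrite ler_norml => /andP[]; lra.
    by move=> /negP; rewrite inE /= => /negP; rewrite -leNgt mulr0 addr0 subr_ge0.
  - move=> y; rewrite /A /= => fy; rewrite /W.
    apply: (@le_trans _ _ (m - f y)); first by rewrite lerBrDl -lerBrDr.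
    by rewrite lerDl mulr_ge0// indicE.
have /negP := nc m; apply; apply/eqP.
have mE : measurable [set y | f y = m].
  rewrite (_ : [set y | f y = m] = [set y | f y <= m] `&` [set y | m <= f y]).
    by apply: measurableI; [exact: measurable_le_fun|exact: measurable_ge_fun].
  apply/seteqP; split => y /=; first by move=> ->.
  by move=> [h1 h2]; apply/eqP; rewrite eq_le h1.
have C0 : mu (~` [set y | f y = m]) = 0%E.
  apply/measure_negligible; first exact: measurableC.
  have gt0 : mu.-negligible [set y | m < f y] by exact/negligibleP.
  apply: negligibleS (negligibleU lt0 gt0) => y /= /eqP.
  by rewrite neq_lt => /orP[?|?]; [left|right].
have := probability_setC mu mE; rewrite C0 => /eqP.
by rewrite eq_sym sube_eq ?add0e// => /eqP ->.
Qed.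

Lemma lt_Ex_pos f : bdmeas f -> (forall a, mu [set y | f y = a] != 1%E) ->
  mu [set y | f y < Ex mu f] != 0%E.
Proof.
move=> bf nc; have bN : bdmeas (fun y => -1 * f y) by exact: bdmeasZ.
have := gt_Ex_pos bN; rewrite ExZ// => /(_ _).
rewrite (_ : [set y | -1 * Ex mu f < -1 * f y] = [set y | f y < Ex mu f]).
  apply => a; rewrite (_ : [set y | -1 * f y = a] = [set y | f y = - a])//.
  by apply/seteqP; split => y /=; rewrite mulN1r; [move=> <-|move=> ->]; rewrite opprK.
by apply/seteqP; split => y /=; rewrite !mulN1r ltrN2.
Qed.

(** Since [g] need not have a mean, the threshold is the mean of [atan g], carried back by [tan].
    Both sides of it have positive mass, and this survives in one set of a countable exhaustion that
    opens a gap above the threshold and truncates [g]. *)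
Lemma nonconstant_spread g : measurable_fun setT g ->
    (forall a, mu [set y | g y = a] != 1%E) ->
  exists al be A p : R, [/\ al < be, 0 < p,
    p <= fine (mu [set y | - A <= g y /\ g y <= al]) &
    p <= fine (mu [set y | be <= g y /\ g y <= A])].
Proof.
move=> mg nc; pose f y := atan (g y).
have matan : measurable_fun setT (@atan R).
  by apply: continuous_measurable_fun => x; exact: continuous_atan.
have bf : bdmeas f.
  split; first exact: measurableT_comp.
  exists (pi / 2) => y; rewrite ler_norml (ltW (atan_gtNpi2 _)).
  by rewrite (ltW (atan_ltpi2 _)).
have ncf a : mu [set y | f y = a] != 1%E.
  have [[b <-]|na] := pselect (exists b : R, atan b = a).
    rewrite (_ : [set y | f y = atan b] = [set y | g y = b])//.
    apply/seteqP; split => y /=; last by move=> <-.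
    by move/(can_inj (@atanK R)).
  rewrite (_ : [set y | f y = a] = set0) ?measure0; last first.
    by apply/seteqP; split => y //= fy; apply: na; exists (g y).
  by rewrite eq_sym onee_eq0.
have gtf := gt_Ex_pos bf ncf; have ltf := lt_Ex_pos bf ncf.
set m := Ex mu f in gtf ltf.
have ex (Q : set S) : mu Q != 0%E -> exists y, Q y.
  move=> Q0; apply: contrapT => nQ; move/eqP: Q0; apply.
  rewrite (_ : Q = set0) ?measure0//; apply/seteqP; split => y // Qy.
  by apply: nQ; exists y.
(* Values of [f] on both sides of [m] place [m] in the open range of [atan], where [tan] inverts
   it. *)
have [y1 /= fy1] := ex _ gtf; have [y2 /= fy2] := ex _ ltf.
have mE : atan (tan m) = m.
  rewrite tanK// in_itv/= (lt_trans (atan_gtNpi2 _) fy2).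
  by rewrite (lt_trans fy1 (atan_ltpi2 _)).
set q := tan m in mE.
have ltE y : (g y < q) = (f y < m).
  by rewrite -mE /f; apply/idP/idP; [exact: lt_atan|apply: contraTT; rewrite -!leNgt; exact: le_atan].
have gtE y : (q < g y) = (m < f y).
  by rewrite -mE /f; apply/idP/idP; [exact: lt_atan|apply: contraTT; rewrite -!leNgt; exact: le_atan].
have pos (Q : nat -> set S) (Q0 : set S) : (forall k, measurable (Q k)) ->
    Q0 `<=` \bigcup_k Q k -> measurable Q0 -> mu Q0 != 0%E ->
    exists k, 0 < fine (mu (Q k)).
  move=> mQ Qsub mQ0 Q00; apply: contrapT => nk; move/negP: Q00; apply; apply/eqP.
  apply/measure_negligible => //; apply: negligibleS Qsub _.
  apply: negligible_bigcup => k; apply/negligibleP => //.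
  by apply: probability0_fine => //; rewrite leNgt; apply/negP => h; apply: nk; exists k.
have mlow (a b : R) : measurable [set y | a <= g y /\ g y <= b].
  rewrite (_ : [set y | _ /\ _] = [set y | a <= g y] `&` [set y | g y <= b])//.
  by apply: measurableI; [exact: measurable_ge_fun|exact: measurable_le_fun].
have trn (x : R) : x <= (Num.truncn x).+1%:R by exact/ltW/Num.Theory.truncnS_gt.
have [k1 k1p] : exists k : nat, 0 < fine (mu [set y | - k%:R <= g y /\ g y <= q]).
  apply: (pos (fun k : nat => [set y | - k%:R <= g y /\ g y <= q]) [set y | g y < q]) => //.
  - move=> y /= gq; exists (Num.truncn (- g y)).+1 => //=.
    by split; [rewrite lerNl|exact: ltW].
  - exact: measurable_lt_fun.
  - by rewrite (_ : [set y | _] = [set y | f y < m])//; apply/seteqP; split => y /=; rewrite ltE.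
have [k2 k2p] : exists k : nat,
    0 < fine (mu [set y | q + k.+1%:R^-1 <= g y /\ g y <= k.+1%:R]).
  apply: (pos (fun k : nat => [set y | q + k.+1%:R^-1 <= g y /\ g y <= k.+1%:R])
    [set y | q < g y]) => //.
  - move=> y /= gq; have gq0 : 0 < g y - q by rewrite subr_gt0.
    set n1 := Num.truncn (g y); set n2 := Num.truncn (g y - q)^-1.
    exists (maxn n1 n2) => //=; split.
      rewrite -lerBrDl -[leRHS]invrK lef_pV2 ?posrE ?invr_gt0 ?ltr0n//.
      by rewrite (le_trans (trn _))// ler_nat ltnS leq_maxr.
    by rewrite (le_trans (trn _))// ler_nat ltnS leq_maxl.
  - exact: measurable_gt_fun.
  - by rewrite (_ : [set y | _] = [set y | m < f y])//; apply/seteqP; split => y /=; rewrite gtE.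
pose A : R := k1%:R + k2.+1%:R.
have le_fine_mu (B C : set S) : measurable B -> measurable C -> B `<=` C ->
    fine (mu B) <= fine (mu C).
  by move=> mB mC BC; rewrite fine_le ?fin_num_measure// le_measure ?inE.
exists q, (q + k2.+1%:R^-1), A,
  (Num.min (fine (mu [set y | - k1%:R <= g y /\ g y <= q]))
   (fine (mu [set y | q + k2.+1%:R^-1 <= g y /\ g y <= k2.+1%:R]))); split.
- by rewrite ltrDl invr_gt0 ltr0n.
- by rewrite lt_min k1p.
- rewrite ge_min; apply/orP; left; apply: le_fine_mu => // y /= [h1 h2]; split=> //.
  by rewrite (le_trans _ h1)// lerN2 lerDl.
- rewrite ge_min; apply/orP; right; apply: le_fine_mu => // y /= [h1 h2]; split=> //.
  by rewrite (le_trans h2)// lerDr.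
Qed.

End nondegenerate_variables.

(** * Elementary bounds for sine, cosine and powers *)

Section cosine_bounds.
Context {R : realType}.
Implicit Types (x y u v : R).

Lemma cos_ge_cos1 x : `|x| <= 1 -> cos 1 <= cos x.
Proof.
move=> x1; have p2 := @pi_ge2 R.
have -> : cos x = cos `|x| by have [_|_] := ger0P x; rewrite ?cosN.
have [->//|x1'] := eqVneq `|x| 1.
by apply/ltW; rewrite ltr_cos ?in_itv/= ?normr_ge0/= ?lt_neqAle ?x1'//; lra.
Qed.

Lemma sinB_ge x y : -1 <= x -> x <= y -> y <= 1 -> cos 1 * (y - x) <= sin y - sin x.
Proof.
move=> x1 xy y1.
have [c cxy ->] : exists2 c, c \in `[x, y]%R & sin y - sin x = cos c * (y - x).
  apply: MVT_segment => //.
  exact/continuous_subspaceT/continuous_sin.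
rewrite ler_wpM2r ?subr_ge0// cos_ge_cos1//.
by move: cxy; rewrite in_itv/= ler_norml => /andP[? ?]; lra.
Qed.

(* Both sides are [|sum_(k < N) exp (i k x)|^2]. *)
Lemma fejer_expand (N : nat) x :
  (\sum_(k < N) cos (k%:R * x)) ^+ 2 + (\sum_(k < N) sin (k%:R * x)) ^+ 2 =
  \sum_(k < N) \sum_(l < N) cos ((k%:R - l%:R) * x).
Proof.
rewrite !expr2 !mulr_suml -big_split /=; apply: eq_bigr => k _.
rewrite !mulr_sumr -big_split /=; apply: eq_bigr => l _.
by rewrite mulrBl cosB.
Qed.

(** Induction on [m], using (1 - kap)(1 + (m+1) kap) <= 1 + m kap. *)
Lemma expr_le_invD (kap : R) (m : nat) : 0 <= kap <= 1 ->
  (1 - kap) ^+ m <= (1 + m%:R * kap)^-1.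
Proof.
move=> /andP[k0 k1].
have m0 : 0 < 1 + m%:R * kap by rewrite ltr_pwDl// mulr_ge0.
rewrite -[leRHS]mul1r ler_pdivlMr//; elim: m m0 => [|m IH] m0.
  by rewrite expr0 mul0r addr0 mulr1.
have m0' : 0 < 1 + m%:R * kap by rewrite ltr_pwDl// mulr_ge0.
apply: le_trans (IH m0'); rewrite exprSr -mulrA ler_wpM2l ?exprn_ge0 ?subr_ge0//.
rewrite -natr1; have : 0 <= m%:R * kap ^+ 2 by rewrite mulr_ge0 ?sqr_ge0.
have := sqr_ge0 kap; nra.
Qed.

End cosine_bounds.

(** * Characteristic functions and concentration of sums *)

Section characteristic_functions.
Context {R : realType} (mu : probability (R * R)%type R).
Context (d : measure_display) (T : measurableType d) (P : probability T R).
Context (X : nat -> T -> R * R).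
Hypothesis mX : forall j, measurable_fun setT (X j).
Hypothesis lawX : forall j (A : set (R * R)), measurable A -> P (X j @^-1` A) = mu A.
Hypothesis indX : mutually_independent P X.
Variable g : R * R -> R.
Hypothesis mg : measurable_fun setT g.
Implicit Types (u v c t : R) (m : nat).

Let bdmeas_cos d' (S : measurableType d') (h : S -> R) u c :
  measurable_fun setT h -> bdmeas (fun y => cos (u * h y + c)).
Proof.
move=> mh; split; last by exists 1 => y; exact: cos_max.
apply: measurableT_comp.
  by apply: continuous_measurable_fun; exact: continuous_cos.
by apply: measurable_funD => //; exact: measurable_funM.
Qed.

Let bdmeas_sin d' (S : measurableType d') (h : S -> R) u c :
  measurable_fun setT h -> bdmeas (fun y => sin (u * h y + c)).
Proof.
move=> mh; split; last by exists 1 => y; exact: sin_max.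
apply: measurableT_comp.
  by apply: continuous_measurable_fun; exact: continuous_sin.
by apply: measurable_funD => //; exact: measurable_funM.
Qed.

Let bc u : bdmeas (fun y => cos (u * g y)).
Proof. have := bdmeas_cos u 0 mg; congr bdmeas; by apply/funext => y; rewrite addr0. Qed.

Let bs u : bdmeas (fun y => sin (u * g y)).
Proof. have := bdmeas_sin u 0 mg; congr bdmeas; by apply/funext => y; rewrite addr0. Qed.

Let S m x := \sum_(j < m) g (X j x).

Let mS m : measurable_fun setT (S m).
Proof. by apply: measurable_sum => j; exact: measurableT_comp. Qed.

Let chc u := Ex mu (fun y => cos (u * g y)).
Let chs u := Ex mu (fun y => sin (u * g y)).
(** The squared modulus of the characteristic function of [g] under [mu]. *)
Definition char_sqr u : R := chc u ^+ 2 + chs u ^+ 2.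

(** Multiplicativity of characteristic functions in real form. The [past] statements travel with the
    induction because they let [past_step] factor out the next variable. *)
Let char_sum u m : [/\ past mu P X m (fun x => cos (u * S m x)),
  past mu P X m (fun x => sin (u * S m x)) &
  Ex P (fun x => cos (u * S m x)) ^+ 2 + Ex P (fun x => sin (u * S m x)) ^+ 2 =
  char_sqr u ^+ m].
Proof.
elim: m => [|m [pc ps E]].
  have S0 x : S 0 x = 0 by rewrite /S big_ord0.
  have cE : (fun x => cos (u * S 0 x)) = cst 1.
    by apply/funext => x; rewrite S0 mulr0 cos0.
  have sE : (fun x => sin (u * S 0 x)) = cst 0.
    by apply/funext => x; rewrite S0 mulr0 sin0.
  rewrite cE sE !Ex_cst expr1n expr0n expr0 addr0.
  by split=> //; exact: past_cst.
have SS x : S m.+1 x = S m x + g (X m x) by rewrite /S big_ord_recr.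
have [pcc Ecc] := past_step mX pc (bc u).
have [pcs Ecs] := past_step mX pc (bs u).
have [psc Esc] := past_step mX ps (bc u).
have [pss Ess] := past_step mX ps (bs u).
have cE : (fun x => cos (u * S m.+1 x)) = (fun x =>
    cos (u * S m x) * cos (u * g (X m x)) + -1 * (sin (u * S m x) * sin (u * g (X m x)))).
  by apply/funext => x; rewrite SS mulrDr cosD mulN1r.
have sE : (fun x => sin (u * S m.+1 x)) = (fun x =>
    sin (u * S m x) * cos (u * g (X m x)) + cos (u * S m x) * sin (u * g (X m x))).
  by apply/funext => x; rewrite SS mulrDr sinD.
rewrite cE sE; split.
- by apply: pastD => //; exact: pastZ.
- exact: pastD.
- rewrite (ExD P pcc.1 (bdmeasZ (-1) pss.1)) (ExZ P (-1) pss.1) (ExD P psc.1 pcs.1).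
  rewrite Ecc Ess Esc Ecs [RHS]exprSr -E /char_sqr -/(chc u) -/(chs u); ring.
Qed.

(** A shift by [c] rotates the vector of cosine and sine means, and a coordinate of the rotated
    vector is at most its length. The bound is therefore uniform in [c]. *)
Let sqr_cos_sum_le u c m :
  Ex P (fun x => cos (u * (S m x + c))) ^+ 2 <= char_sqr u ^+ m.
Proof.
have [[b1 _] [b2 _] <-] := char_sum u m.
rewrite (_ : (fun x => _) = (fun x =>
   cos (u * c) * cos (u * S m x) - sin (u * c) * sin (u * S m x))); last first.
  by apply/funext => x; rewrite mulrDr cosD; ring.
rewrite ExB ?ExZ//; [|exact: bdmeasZ|exact: bdmeasZ].
set a := Ex _ _; set b := Ex _ _.
have := cos2Dsin2 (u * c); set p := cos _; set q := sin _ => pq.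
rewrite -subr_ge0 (_ : _ - _ = (p * b + q * a) ^+ 2) ?sqr_ge0//.
rewrite -[X in X - _]mul1r -pq; ring.
Qed.

(** The Fejer sum at (S + c)/(N t) is a majorant of the indicator: on the event all N angles are at
    most 1 in absolute value, so the sum is at least (N cos 1)^2. Its mean is at most N from the
    diagonal plus N^2 r from the other terms. *)
Lemma concentration_le (N m : nat) c t (r : R) : (0 < N)%N -> 0 < t ->
    (forall k l : nat, (k < N)%N -> (l < N)%N -> k != l ->
       char_sqr ((k%:R - l%:R) / (N%:R * t)) ^+ m <= r ^+ 2) -> 0 <= r ->
  fine (P [set x | `|S m x + c| <= t]) <= (N%:R^-1 + r) / cos 1 ^+ 2.
Proof.
move=> N0 t0 Hr r0.
have NR : 0 < N%:R :> R by rewrite ltr0n.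
have c1 := @cos1_gt0 R.
have mY : measurable_fun setT (fun x => S m x + c) by exact: measurable_funD.
pose v := (N%:R * t)^-1.
have v0 : 0 < v by rewrite invr_gt0 mulr_gt0.
pose Z x := \sum_(k < N) \sum_(l < N) cos ((k%:R - l%:R) * (v * (S m x + c))).
have bkl (k l : nat) : bdmeas (fun x => cos ((k%:R - l%:R) * (v * (S m x + c)))).
  have := bdmeas_cos ((k%:R - l%:R) * v) 0 mY; congr bdmeas; apply/funext => x.
  by rewrite addr0 mulrA.
have bZ : bdmeas Z by apply: bdmeas_sum => k; apply: bdmeas_sum => l.
have EZ : Ex P Z <= N%:R + N%:R ^+ 2 * r.
  rewrite Ex_sum; last by move=> k; apply: bdmeas_sum => l.
  apply: (@le_trans _ _ (\sum_(k < N) \sum_(l < N) ((k == l)%:R + r))).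
    apply: ler_sum => k _; rewrite Ex_sum//; apply: ler_sum => l _.
    have [->|kl] := eqVneq k l.
      rewrite (_ : (fun x => _) = cst 1) ?Ex_cst ?lerDl//.
      by apply/funext => x; rewrite subrr mul0r cos0.
    rewrite add0r (le_trans (ler_norm _))// -(@ler_pXn2r _ 2)// real_normK ?num_real//.
    apply: le_trans (Hr k l (ltn_ord _) (ltn_ord _) kl).
    rewrite -/v; apply: le_trans (sqr_cos_sum_le _ c m).
    by rewrite le_eqVlt; apply/orP; left; apply/eqP; congr (Ex _ _ ^+ 2);
      apply/funext => x; rewrite mulrA.
  rewrite (eq_bigr (fun=> 1 + N%:R * r)); last first.
    move=> k _; rewrite big_split/= sumr_const card_ord -[r *+ N]mulr_natl; congr (_ + _).
    rewrite (bigD1 k)//= eqxx big1 ?addr0// => l.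
    by rewrite eq_sym => /negbTE ->.
  rewrite sumr_const card_ord -[_ *+ N]mulr_natl le_eqVlt; apply/orP; left.
  by apply/eqP; ring.
have mA : measurable [set x | `|S m x + c| <= t].
  by apply: measurable_le_fun; exact: measurableT_comp.
have := @prob_le_Ex _ _ _ P _ Z ((N%:R * cos 1) ^+ 2) mA bZ.
move=> /(_ _ _ _)/le_trans; apply.
- by move=> x; rewrite /Z -fejer_expand addr_ge0 ?sqr_ge0.
- by rewrite exprn_gt0// mulr_gt0.
- move=> x /= xt; rewrite /Z -fejer_expand.
  rewrite (@le_trans _ _ ((\sum_(k < N) cos (k%:R * (v * (S m x + c)))) ^+ 2))//; last first.
    by rewrite lerDl sqr_ge0.
  have H : N%:R * cos 1 <= \sum_(k < N) cos (k%:R * (v * (S m x + c))).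
    rewrite mulr_natl -[X in _ *+ X](card_ord N) -sumr_const; apply: ler_sum => k _.
    apply: cos_ge_cos1; rewrite !normrM normr_nat (gtr0_norm v0).
    rewrite (@le_trans _ _ (N%:R * (v * t)))//.
      by rewrite ler_pM// ?ler_nat ?(ltW (ltn_ord k)) ?mulr_ge0 ?(ltW v0)// ?ler_wpM2l ?(ltW v0)// ltnW.
    by rewrite mulrCA mulVf// mulf_neq0 ?gt_eqF.
  have P0 : 0 <= N%:R * cos 1 :> R by rewrite mulr_ge0// ltW.
  by rewrite ler_pXn2r// nnegrE// (le_trans P0).
have D0 : 0 < (N%:R * cos 1) ^+ 2 :> R by rewrite exprn_gt0// mulr_gt0.
apply: (@le_trans _ _ ((N%:R + N%:R ^+ 2 * r) / (N%:R * cos 1) ^+ 2)).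
  by rewrite ler_wpM2r// invr_ge0 ltW.
rewrite le_eqVlt; apply/orP; left; apply/eqP; field.
by rewrite !gt_eqF.
Qed.

(** The quantity 1 - [char_sqr u] is the variance of cos(u g) plus that of sin(u g). The second is
    bounded below because sine is increasing on the relevant range and [g] has mass [p] on either
    side of a gap. *)
Lemma char_sqr_le al be A p : al < be -> 0 < p ->
    p <= fine (mu [set y | - A <= g y /\ g y <= al]) ->
    p <= fine (mu [set y | be <= g y /\ g y <= A]) ->
  exists kap v0 : R, [/\ 0 < kap, 0 < v0 &
    forall u, `|u| <= v0 -> char_sqr u <= 1 - kap * u ^+ 2].
Proof.
move=> ab p0 p1 p2; have c1 := @cos1_gt0 R.
(* For |u| <= v0 the product u g lies in [-1, 1] when |g| <= A, where sine has slope at least cos 1.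
   Then [u * w] is half the guaranteed gap between sin(u al) and sin(u be). *)
pose v0 : R := (`|A| + 1)^-1.
have v00 : 0 < v0 by rewrite invr_gt0 ltr_pwDr.
pose w := cos 1 * (be - al) / 2.
have w0 : 0 < w by rewrite divr_gt0// mulr_gt0// subr_gt0.
exists (p * w ^+ 2), v0; split => //; first by rewrite mulr_gt0// exprn_gt0.
have main u : 0 < u -> u <= v0 -> char_sqr u <= 1 - p * w ^+ 2 * u ^+ 2.
  move=> u0 uv; set s := chs u; set cc := chc u.
  have E : 1 - char_sqr u = Ex mu (fun y => (cos (u * g y) - cc) ^+ 2) +
      Ex mu (fun y => (sin (u * g y) - s) ^+ 2).
    have b2 (h : R * R -> R) a : bdmeas h -> bdmeas (fun y => (h y - a) ^+ 2).
      move=> bh; have bb := bdmeasB bh (@bdmeas_cst _ _ _ a).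
      exact: (bdmeasM bb bb).
    rewrite -ExD//; [|exact: b2|exact: b2].
    rewrite (_ : (fun x => _) = (fun y => (1 + cc ^+ 2 + s ^+ 2) -
      (2 * cc * cos (u * g y) + 2 * s * sin (u * g y)))); last first.
      by apply/funext => y; have := cos2Dsin2 (u * g y); lra.
    have bl1 := bdmeasZ (2 * cc) (bc u); have bl2 := bdmeasZ (2 * s) (bs u).
    rewrite ExB; [|exact: bdmeas_cst|exact: bdmeasD].
    rewrite [Ex mu (fun=> _)]Ex_cst ExD// !ExZ// -/(chc u) -/(chs u) /char_sqr.
    by rewrite -/s -/cc; ring.
  have bZ : bdmeas (fun y => (sin (u * g y) - s) ^+ 2).
    have bb := bdmeasB (bs u) (@bdmeas_cst _ _ _ s).
    exact: (bdmeasM bb bb).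
  have uw0 : 0 < (u * w) ^+ 2 by rewrite exprn_gt0// mulr_gt0.
  suff H : p * (u * w) ^+ 2 <= Ex mu (fun y => (sin (u * g y) - s) ^+ 2).
    have G : 0 <= Ex mu (fun y => (cos (u * g y) - cc) ^+ 2).
      by apply: Ex_ge0 => y; exact: sqr_ge0.
    by move: H; rewrite exprMn; lra.
  have uA y : `|g y| <= A -> `|u * g y| <= 1.
    move=> gA; rewrite normrM (gtr0_norm u0).
    rewrite (@le_trans _ _ (v0 * (`|A| + 1)))//; last first.
      by rewrite mulVf// gt_eqF// ltr_pwDr.
    rewrite ler_pM ?(ltW u0)// (le_trans gA)// (le_trans (ler_norm _))// lerDl//.
  have mlow (a b : R) : measurable [set y | a <= g y /\ g y <= b].
    rewrite (_ : [set y | _ /\ _] = [set y | a <= g y] `&` [set y | g y <= b])//.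
    by apply: measurableI; [exact: measurable_ge_fun|exact: measurable_le_fun].
  have [E1ne|E1] := pselect (exists y, - A <= g y /\ g y <= al); last first.
    exfalso; move: p1; rewrite (_ : [set y | _] = set0) ?measure0/= ?leNgt ?p0//.
    by apply/seteqP; split => y //= h; apply: E1; exists y.
  have [E2ne|E2] := pselect (exists y, be <= g y /\ g y <= A); last first.
    exfalso; move: p2; rewrite (_ : [set y | _] = set0) ?measure0/= ?leNgt ?p0//.
    by apply/seteqP; split => y //= h; apply: E2; exists y.
  have Aal : - A <= al by have [y []] := E1ne; exact: le_trans.
  have Abe : be <= A by have [y []] := E2ne; exact: le_trans.
  have inA (a : R) : - A <= a -> a <= A -> -1 <= u * a /\ u * a <= 1.
    move=> a1 a2; have : `|u * a| <= 1.
      rewrite normrM (gtr0_norm u0) (@le_trans _ _ (v0 * (`|A| + 1)))//; last first.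
        by rewrite mulVf// gt_eqF// ltr_pwDr.
      rewrite ler_pM ?(ltW u0)// (@le_trans _ _ A) ?ler_norml ?a1//.
      by rewrite (le_trans (ler_norm _))// lerDl.
    by rewrite ler_norml => /andP.
  have [al1 al2] : -1 <= u * al /\ u * al <= 1.
    by apply: inA => //; rewrite (le_trans (ltW ab)).
  have [be1 be2] : -1 <= u * be /\ u * be <= 1.
    by apply: inA => //; rewrite (le_trans Aal)// ltW.
  have gap : 2 * (u * w) <= sin (u * be) - sin (u * al).
    apply: le_trans (sinB_ge al1 _ be2); last by rewrite ler_wpM2l ?(ltW u0)// ltW.
    by rewrite le_eqVlt; apply/orP; left; apply/eqP; rewrite /w; field.
  (* whichever side of the midpoint [s] lies on, the other tail is far from it *)
  have [sm|sm] := leP s ((sin (u * be) + sin (u * al)) / 2).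
    rewrite -ler_pdivlMr//; apply: le_trans p2 _.
    apply: prob_le_Ex => //; first by move=> y; exact: sqr_ge0.
    move=> y /= [gb gA].
    have [g1 g2] := inA (g y) (le_trans (le_trans Aal (ltW ab)) gb) gA.
    have H : 0 <= sin (u * g y) - sin (u * be).
      apply: le_trans (sinB_ge be1 _ g2); last by rewrite ler_wpM2l ?(ltW u0).
      by rewrite mulr_ge0 ?(ltW c1)// subr_ge0 ler_wpM2l ?(ltW u0).
    have uw : 0 <= u * w by rewrite mulr_ge0 ?(ltW u0)// ltW.
    by rewrite lerXn2r// ?nnegrE//; lra.
  rewrite -ler_pdivlMr//; apply: le_trans p1 _.
  apply: prob_le_Ex => //; first by move=> y; exact: sqr_ge0.
  move=> y /= [gA ga].
  have [g1 g2] := inA (g y) gA (le_trans ga (le_trans (ltW ab) Abe)).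
  have H : 0 <= sin (u * al) - sin (u * g y).
    apply: le_trans (sinB_ge g1 _ al2); last by rewrite ler_wpM2l ?(ltW u0).
    by rewrite mulr_ge0 ?(ltW c1)// subr_ge0 ler_wpM2l ?(ltW u0).
  have uw : 0 <= u * w by rewrite mulr_ge0 ?(ltW u0)// ltW.
  rewrite -[leRHS]sqrrN opprB lerXn2r// ?nnegrE//; lra.
move=> u; have [u0|u0|->] := ltrgt0P u.
- exact: main.
- have uN : char_sqr u = char_sqr (- u).
    rewrite /char_sqr; congr (_ + _).
      by congr (Ex _ _ ^+ 2); apply/funext => y; rewrite mulNr cosN.
    rewrite -[RHS]sqrrN; congr (_ ^+ 2); rewrite -mulN1r -ExZ//.
    by rewrite /chs; congr Ex; apply/funext => y; rewrite [- u * _]mulNr sinN mulN1r opprK.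
  by move=> uv; rewrite uN -[u ^+ 2]sqrrN; apply: main; rewrite ?oppr_gt0.
- move=> _; rewrite expr0n mulr0 subr0 /char_sqr /chc /chs.
  rewrite (_ : (fun y => cos _) = cst 1); last first.
    by apply/funext => y; rewrite mul0r cos0.
  rewrite (_ : (fun y => sin _) = cst 0); last first.
    by apply/funext => y; rewrite mul0r sin0.
  by rewrite !Ex_cst expr1n expr0n addr0.
Qed.

(** In [concentration_le], N is chosen so that the diagonal contributes at most half of [eta], and r
    = e accounts for the other half. *)
Lemma anticoncentration (eta : R) : 0 < eta ->
    (forall a, mu [set y | g y = a] != 1%E) ->
  exists2 K : R, 0 < K & forall m c t, K <= t -> K * t ^+ 2 <= m%:R ->
    fine (P [set x | `|S m x + c| <= t]) <= eta.
Proof.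
move=> eta0 nc; have c1 := @cos1_gt0 R.
have [al [be [A [p [ab p0 p1 p2]]]]] := nonconstant_spread mg nc.
have [kap [v0 [k0 v00 H]]] := char_sqr_le ab p0 p1 p2.
pose e := eta * cos 1 ^+ 2 / 2.
have e0 : 0 < e by rewrite divr_gt0// mulr_gt0// exprn_gt0.
pose N := (Num.truncn e^-1).+1.
have NR : 0 < N%:R :> R by rewrite ltr0n.
have Ne : N%:R^-1 <= e.
  rewrite -[leRHS]invrK lef_pV2 ?posrE ?invr_gt0//.
  exact/ltW/Num.Theory.truncnS_gt.
(* The frequencies are u = (k - l)/(N t) with k != l. The first summand gives |u| <= 1/t <= v0; the
   second gives m kap u^2 >= 1/e^2, since |u| >= 1/(N t). *)
pose K := v0^-1 + e ^- 2 * N%:R ^+ 2 / kap.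
have K1 : 0 < v0^-1 by rewrite invr_gt0.
have K2 : 0 < e ^- 2 * N%:R ^+ 2 / kap.
  by rewrite divr_gt0// mulr_gt0 ?invr_gt0 ?exprn_gt0.
have K0 : 0 < K by exact: addr_gt0.
exists K => // m c t Kt mt.
have t0 : 0 < t by exact: lt_le_trans Kt.
have vt : t^-1 <= v0.
  rewrite -[leRHS]invrK lef_pV2 ?posrE// (le_trans _ Kt)// lerDl ltW//.
have Nt0 : 0 < N%:R * t by exact: mulr_gt0.
apply: le_trans (@concentration_le N m c t e _ t0 _ (ltW e0)) _ => //.
  move=> k l kN lN kl; set u := _ / _.
  have kl1 : 1 <= (k%:R - l%:R : R) ^+ 2.
    rewrite -real_normK ?num_real// -[leLHS](expr1n _ 2) lerXn2r ?nnegrE//.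
    have [kl'|lk] := ltnP k l.
      rewrite distrC ger0_norm ?subr_ge0 ?ler_nat ?(ltnW kl')//.
      by rewrite lerBrDl natr1 ler_nat.
    have {}lk : (l < k)%N by rewrite ltn_neqAle lk eq_sym kl.
    rewrite ger0_norm ?subr_ge0 ?ler_nat ?(ltnW lk)//.
    by rewrite lerBrDl natr1 ler_nat.
  have uv : `|u| <= v0.
    apply: le_trans vt; rewrite /u normrM [X in _ * X]ger0_norm ?invr_ge0 ?(ltW Nt0)//.
    rewrite ler_pdivrMr// mulrCA mulVf ?gt_eqF// mulr1 ler_norml.
    have : (k%:R : R) <= N%:R by rewrite ler_nat ltnW.
    have : (l%:R : R) <= N%:R by rewrite ler_nat ltnW.
    have : 0 <= (k%:R : R) by []. have : 0 <= (l%:R : R) by [].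
    by move=> ? ? ? ?; apply/andP; split; lra.
  have Hu := H u uv.
  have chi0 : 0 <= char_sqr u by rewrite addr_ge0 ?sqr_ge0.
  have ku : 0 <= kap * u ^+ 2 <= 1.
    by rewrite mulr_ge0 ?sqr_ge0 ?(ltW k0)//=; lra.
  apply: (@le_trans _ _ ((1 - kap * u ^+ 2) ^+ m)).
    by rewrite lerXn2r// nnegrE//; lra.
  apply: le_trans (expr_le_invD m ku) _.
  have e20 : 0 < e ^+ 2 by rewrite exprn_gt0.
  have Dm : e ^- 2 <= m%:R * (kap * u ^+ 2).
    apply: (@le_trans _ _ (m%:R * (kap * ((N%:R * t) ^+ 2)^-1))); last first.
      rewrite ler_wpM2l// ler_wpM2l ?(ltW k0)// /u expr_div_n.
      by rewrite ler_peMl// invr_ge0 sqr_ge0.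
    apply: (@le_trans _ _ ((K * t ^+ 2) * (kap * ((N%:R * t) ^+ 2)^-1))); last first.
      by rewrite ler_wpM2r// mulr_ge0 ?invr_ge0 ?sqr_ge0 ?(ltW k0).
    rewrite (_ : K * _ * _ = K * kap / N%:R ^+ 2); last by field; rewrite !gt_eqF.
    rewrite ler_pdivlMr ?exprn_gt0// -ler_pdivrMr// lerDr ltW//.
  rewrite -[leRHS]invrK lef_pV2 ?posrE ?invr_gt0//.
    by rewrite (le_trans Dm)// lerDr.
  by rewrite ltr_pwDl// mulr_ge0//; case/andP: ku.
rewrite ler_pdivrMr ?exprn_gt0// (le_trans (lerD Ne (lexx e)))//.
by rewrite /e; lra.
Qed.

End characteristic_functions.

(** * Uniform continuity on boxes *)

Section plane_topology.
Context {R : realType}.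
Implicit Types (A e : R) (z w c : R * R) (f : R * R -> R).

(** The sigma-algebra is the product one, so an open set is exhausted by the countably many rational
    squares that it contains. *)
Lemma open_measurable_plane (U : set (R * R)) : open U -> measurable U.
Proof.
move=> oU.
pose sqr (i : rat * rat * nat) : set (R * R) :=
  sqset i.2.+1%:R^-1 (ratr i.1.1, ratr i.1.2).
pose F i : set (R * R) := if pselect (sqr i `<=` U) then sqr i else set0.
have -> : U = \bigcup_i F i.
  apply/seteqP; split => z; last by move=> [i _]; rewrite /F; case: pselect => // h /h.
  move=> Uz; have := open_nbhs_nbhs (conj oU Uz) => /nbhs_ballP[r /= r0 rU].
  set n := Num.truncn (2 / r).
  have n0 : 0 < n.+1%:R^-1 :> R by rewrite invr_gt0 ltr0n.
  have nr : 2 * n.+1%:R^-1 < r.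
    rewrite -ltr_pdivlMl// -[ltRHS]invrK ltf_pV2 ?posrE ?invr_gt0 ?mulr_gt0 ?invr_gt0//.
    by rewrite invfM invrK; exact: Num.Theory.truncnS_gt.
  have [h hE] : exists h : R, h = n.+1%:R^-1 by exists n.+1%:R^-1.
  rewrite -hE in n0 nr.
  have rat_near (x : R) : exists q : rat, `|x - ratr q| < h.
    have xx : x - h < x + h by lra.
    have [q] := rat_in_itvoo xx; rewrite in_itv/= => /andP[? ?].
    by exists q; rewrite ltr_norml; lra.
  have [q1 h1] := rat_near z.1; have [q2 h2] := rat_near z.2.
  exists (q1, q2, n) => //; rewrite /F.
  have zs : sqr (q1, q2, n) z.
    move: h1 h2; rewrite !ltr_norml => /andP[? ?] /andP[? ?].
    by rewrite /sqr /= -hE; split => /=; rewrite in_itv/=; lra.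
  case: pselect => // sU; exfalso; apply: sU => w; rewrite /sqr /= -hE => -[] /=; rewrite !in_itv/= => w1 w2.
  apply: rU; move: h1 h2; rewrite !ltr_norml => h1 h2.
  split; rewrite /ball/= ltr_norml; lra.
apply: countable_bigcupT_measurable => // i; rewrite /F.
by case: pselect => [h|h]; [exact: measurable_sqset|exact: measurable0].
Qed.

Lemma continuous_measurable_plane f : continuous f -> measurable_fun setT f.
Proof.
move=> /continuousP cf; apply: (measurability _ (RGenOpens.measurableE R)).
move=> _ [_ [a [b ->] <-]]; rewrite setTI.
apply: open_measurable_plane; apply: cf; exact: interval_open.
Qed.

(** Only [c] is confined to the compact box, while [w] may lie outside; hence the covering argument
    in [c], with [e] tending to 0 from the right as parameter. *)
Lemma sq_uniform_continuity f A (delta : R) : continuous f -> 0 < delta ->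
  exists e, [/\ 0 < e, e <= 1 &
    forall c w, box A c -> sq e c w -> `|f w - f c| <= delta].
Proof.
move=> cf d0.
have cK : compact (box A).
  by apply: compact_setX; exact: segment_compact.
pose Q e c := forall w, sq e c w -> `|f w - f c| <= delta.
have H : forall x : R * R, box A x ->
    \forall y \near x & e \near 0^'+, Q e y.
  move=> x _; have /cvgrPdist_lt /(_ (delta / 2)) := cf x.
  rewrite divr_gt0// => /(_ isT) /nbhs_ballP[r /= r0 rf].
  exists (ball x (r / 2), [set e | e < r / 2]).
    split; first by apply/nbhs_ballP; exists (r / 2) => //=; rewrite divr_gt0.
    by near=> e; near: e; apply: nbhs_right_lt; rewrite divr_gt0.
  move=> [c e] /= [[c1 c2] er] w /andP[w1 w2].
  have bc : ball x r c.
    by split; rewrite /ball/=; [move: c1|move: c2]; rewrite /ball/= !ltr_norml; lra.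
  have bw : ball x r w.
    split; rewrite /ball/=.
      by move: c1 w1; rewrite /ball/= !ltr_norml; lra.
    by move: c2 w2; rewrite /ball/= !ltr_norml; lra.
  by move: (rf _ bc) (rf _ bw); rewrite !ltr_norml ler_norml; lra.
have near0 : \forall e \near (0 : R)^'+, box A `<=` Q e.
  exact: ((compact_near_coveringP _).1 cK R (0^'+) Q _ H).
have near1 : \forall e \near (0 : R)^'+, 0 < e /\ e <= 1.
  near=> e; split; near: e; first exact: nbhs_right_gt.
  by apply: nbhs_right_le.
have near2 : \forall e \near (0 : R)^'+, box A `<=` Q e /\ (0 < e /\ e <= 1).
  by apply: filterS2 near0 near1 => e; split.
near (0 : R)^'+ => e.
have [H1 [e0 e1]] : box A `<=` Q e /\ (0 < e /\ e <= 1) by near: e.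
by exists e; split=> // c w cA; exact: H1.
Unshelve. all: by end_near. Qed.

Lemma box_exhaust (mu : probability (R * R)%type R) (eps : R) : 0 < eps ->
  exists2 A, 0 <= A & 1 - eps <= fine (mu (box A)).
Proof.
move=> e0; have mb n : measurable (box (n%:R : R)) by exact: measurable_box.
have U : \bigcup_n box (n%:R : R) = setT.
  apply/seteqP; split => // z _.
  exists (maxn (Num.truncn `|z.1|).+1 (Num.truncn `|z.2|).+1) => //; apply/boxP.
  split; (apply: le_trans; first exact/ltW/Num.Theory.truncnS_gt);
    by rewrite ler_nat (leq_maxl, leq_maxr).
have : (fun n => mu (box n%:R)) @ \oo --> mu (\bigcup_n box (n%:R : R)).
  apply: nondecreasing_cvg_mu => //; first by rewrite U.
  move=> m n mn; apply/subsetPset => z /boxP[z1 z2]; apply/boxP.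
  by split; [apply: le_trans z1 _|apply: le_trans z2 _]; rewrite ler_nat.
rewrite U probability_setT => /fine_cvgP[_ /cvgrPdist_le/(_ _ e0)[N _ H]].
have := H N (leqnn N); rewrite /= ler_norml => /andP[_ h].
by exists N%:R => //; lra.
Qed.

End plane_topology.

(** * The scale n^(1/33) *)

Section root33.
Context {R : realType}.

(** With b = n^(1/33), tau = b^12 and t = b^16, all scales are integer powers of b: tau^3 = n b^3
    exceeds the typical size n of [W32], t^2 = n/b stays below the variance scale, and tau^4/(n t) =
    1/b. *)
Definition root33 (n : nat) : R := n%:R `^ (33%:R^-1).

Lemma root33K n : root33 n ^+ 33 = n%:R.
Proof.
rewrite -powR_mulrn ?powR_ge0// -powRrM mulVf ?powRr1//.
Qed.

Lemma root33_ge (K : R) : exists N, forall n, (N <= n)%N -> K <= root33 n.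
Proof.
exists (Num.truncn (`|K| ^+ 33)).+1 => n Nn; rewrite (le_trans (ler_norm _))//.
rewrite -(@ler_pXn2r _ 33) ?nnegrE ?powR_ge0// root33K.
apply: (@le_trans _ _ (Num.truncn (`|K| ^+ 33)).+1%:R); last by rewrite ler_nat.
exact/ltW/Num.Theory.truncnS_gt.
Qed.

End root33.

(** * The small set of the logarithmic derivative *)

Lemma sqrt_sqrD_le {R : realType} (x y : R) : Num.sqrt (x ^+ 2 + y ^+ 2) <= `|x| + `|y|.
Proof.
rewrite -[leRHS]ger0_norm ?addr_ge0// -sqrtr_sqr ler_wsqrtr//.
have xy : 0 <= `|x| * `|y| by rewrite mulr_ge0.
have := real_normK (num_real x); have := real_normK (num_real y); nra.
Qed.

Lemma invdist_le_kre_kim {R : realType} (z w : R * R) :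
  invdist z w <= `|kre z w| + `|kim z w|.
Proof.
rewrite -normc_inv_toC inv_toC -[`|kim z w|]normrN; exact: sqrt_sqrD_le.
Qed.

Lemma invdist_ge_box {R : realType} (z a : R * R) (B : R) : box B z -> z <> a ->
  (2 * B + `|a.1| + `|a.2| + 1)^-1 <= invdist z a.
Proof.
move=> /boxP[z1 z2] za.
have c0 : 0 < cdist z a.
  rewrite sqrtr_gt0 lt0r addr_ge0 ?sqr_ge0// andbT paddr_eq0 ?sqr_ge0//.
  rewrite !sqrf_eq0 !subr_eq0; apply/negP => /andP[/eqP e1 /eqP e2]; apply: za.
  by rewrite (surjective_pairing z) e1 e2 -surjective_pairing.
have h := sqrt_sqrD_le (z.1 - a.1) (z.2 - a.2).
have h1 := ler_normB z.1 a.1; have h2 := ler_normB z.2 a.2.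
have cD : cdist z a <= 2 * B + `|a.1| + `|a.2| + 1 by rewrite /cdist; lra.
by rewrite lef_pV2// posrE (lt_le_trans c0).
Qed.

Section random_points.
Context {R : realType} (mu : probability (R * R)%type R).
Context (d : measure_display) (T : measurableType d) (P : probability T R).
Context (X : nat -> T -> R * R) (k : nat -> nat) (xi : nat -> nat -> R * R).
Hypothesis mX : forall j, measurable_fun setT (X j).
Hypothesis lawX : forall j (A : set (R * R)), measurable A -> P (X j @^-1` A) = mu A.
Hypothesis indX : mutually_independent P X.
Hypothesis kn : forall n, (k n <= n)%N.
Hypothesis ko : (fun n => (k n)%:R / n%:R : R) @ \oo --> (0 : R).
Implicit Types (z : R * R) (w : T).
Local Notation plane := (measurableTypeR R * measurableTypeR R)%type.

Definition pts n w : seq (R * R) :=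
  [seq X j w | j <- index_iota 0 (n - k n)] ++ [seq xi n l | l <- index_iota 0 (k n)].

Lemma size_pts n w : size (pts n w) = n.
Proof. by rewrite size_cat !size_map !size_iota !subn0 subnK. Qed.

Lemma sum_pts n w (h : R * R -> R) : \sum_(x <- pts n w) h x =
  \sum_(j < n - k n) h (X j w) + \sum_(l < k n) h (xi n l).
Proof. by rewrite big_cat !big_map !big_mkord. Qed.

Lemma prod_pts n w : \prod_(x <- pts n w) ('X - (toC x)%:P) =
  (\prod_(j < n - k n) ('X - (toC (X j w))%:P)) *
  (\prod_(l < k n) ('X - (toC (xi n l))%:P)).
Proof. by rewrite big_cat !big_map !big_mkord. Qed.

Lemma k_le (delta : R) : 0 < delta ->
  exists N, forall n, (N <= n)%N -> (k n)%:R <= delta * n%:R.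
Proof.
move=> d0; have /cvgrPdist_le/(_ _ d0)[N _ H] := ko.
exists N => n Nn; have := H n Nn; rewrite sub0r normrN ger0_norm ?mulr_ge0 ?invr_ge0//.
(* For n = 0 the quotient says nothing, but [kn] gives [k 0 = 0]. *)
have [->|n0] := posnP n; last by rewrite ler_pdivrMr// ltr0n.
by have := kn 0; rewrite leqn0 => /eqP -> _; rewrite mulr0.
Qed.

Lemma half_le : exists N, forall n, (N <= n)%N -> n%:R / 2 <= (n - k n)%:R :> R.
Proof.
have [|N H] := @k_le 2^-1; first by rewrite invr_gt0.
exists N => n /H kn2; rewrite natrB//; lra.
Qed.

Definition small_at n (t : R) z : set T := [set w | small_set (pts n w) t z].

Lemma measurable_sum_pts (kk : R * R -> R * R -> R) n :
    measurable_fun setT (fun p : (R * R) * (R * R) => kk p.1 p.2) ->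
  measurable_fun setT (fun p : (R * R) * T => \sum_(x <- pts n p.2) kk p.1 x).
Proof.
move=> mkk; rewrite (_ : (fun _ => _) = (fun p : (R * R) * T =>
   \sum_(j < n - k n) kk p.1 (X j p.2) + \sum_(l < k n) kk p.1 (xi n l))); last first.
  by apply/funext => p; rewrite sum_pts.
apply: measurable_funD; apply: measurable_sum => j.
  apply: (@measurableT_comp _ _ _ _ _ _ (fun p => kk p.1 p.2) _ (fun p => (p.1, X j p.2))) => //.
  apply: measurable_fun_pair => //; exact: measurableT_comp.
apply: (@measurableT_comp _ _ _ _ _ _ (fun p => kk p.1 p.2) _ (fun p => (p.1, xi n j))) => //.
exact: measurable_fun_pair.
Qed.

Lemma measurable_small_pair n t :
  measurable [set p : (R * R) * T | small_set (pts n p.2) t p.1].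
Proof.
have m1 : measurable_fun setT (fun p : (R * R) * T => `|\sum_(x <- pts n p.2) kre p.1 x|).
  apply: measurableT_comp => //; apply: measurable_sum_pts; exact: measurable_kre2.
have m2 : measurable_fun setT (fun p : (R * R) * T => `|\sum_(x <- pts n p.2) kim p.1 x|).
  apply: measurableT_comp => //; apply: measurable_sum_pts; exact: measurable_kim2.
rewrite (_ : [set p : (R * R) * T | _] =
  [set p : (R * R) * T | `|\sum_(x <- pts n p.2) kre p.1 x| <= t] `&`
  [set p : (R * R) * T | `|\sum_(x <- pts n p.2) kim p.1 x| <= t])//.
by apply: measurableI; exact: measurable_le_fun.
Qed.

Definition small_area n t B w : \bar R := area (box B `&` small_set (pts n w) t).

Let ind n t B (p : (R * R) * T) : \bar R :=
  (\1_(box B) p.1 * \1_[set p : (R * R) * T | small_set (pts n p.2) t p.1] p)%:E.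

Let mind n t B : measurable_fun setT (ind n t B).
Proof.
apply/measurable_EFinP; apply: measurable_funM.
  by apply: measurableT_comp => //; apply: measurable_indic; exact: measurable_box.
by apply: measurable_indic; exact: measurable_small_pair.
Qed.

Let ind0 n t B p : (0 <= ind n t B p)%E.
Proof. by rewrite lee_fin mulr_ge0. Qed.

Let small_areaE n t B w : small_area n t B w = (\int[area]_z ind n t B (z, w))%E.
Proof.
have mS : measurable (box B `&` small_set (pts n w) t :
    set (measurableTypeR R * measurableTypeR R)).
  by apply: measurableI; [exact: measurable_box|exact: measurable_small_set].
transitivity (\int[area]_z (\1_(box B `&` small_set (pts n w) t) z)%:E)%E.
  by rewrite integral_indic// setIT.
apply: eq_integral => z _; rewrite /ind indicI /=; congr (_ * _)%:E.
Qed.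

Lemma measurable_small_area n t B : measurable_fun setT (small_area n t B).
Proof.
rewrite (_ : small_area n t B = fubini_G area (ind n t B)).
  exact: (@measurable_fun_fubini_tonelli_G _ _ plane T R area _ (@mind n t B) (@ind0 n t B)).
by apply/funext => w; rewrite small_areaE.
Qed.

Lemma measurable_small_at n t z : measurable (small_at n t z).
Proof.
have := measurable_xsection z (measurable_small_pair n t).
congr measurable; apply/seteqP; split => w; by rewrite /xsection /= inE.
Qed.

(** By Tonelli, the expected area of the small set is the integral of its pointwise probabilities,
    the only quantities that anticoncentration controls. *)
Lemma integral_small_area n t B :
  (\int[P]_w small_area n t B w = \int[area]_(z in box B) P (small_at n t z))%E.
Proof.
under eq_integral do rewrite small_areaE.
rewrite -(@fubini_tonelli _ _ plane T R area P _ (@mind n t B) (@ind0 n t B)).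
rewrite [RHS]integral_mkcond; apply: eq_integral => z _; rewrite patchE.
case: ifPn => zB; last first.
  by rewrite integral0_eq// => w _; rewrite /ind /= indicE (negbTE zB) mul0r.
have mA := measurable_small_at n t z.
rewrite (_ : P _ = \int[P]_w (\1_(small_at n t z) w)%:E)%E; last first.
  by rewrite integral_indic// setIT.
apply: eq_integral => w _; rewrite /ind /= indicE zB mul1r; congr _%:E.
Qed.

Lemma measurable_P_small n t : measurable_fun setT (fun z : plane => P (small_at n t z)).
Proof.
have mI : measurable_fun setT (fun p : (R * R) * T =>
    (\1_[set p : (R * R) * T | small_set (pts n p.2) t p.1] p)%:E : \bar R).
  apply/measurable_EFinP; apply: measurable_indic; exact: measurable_small_pair.
have I0 (p : (R * R) * T) :
    (0 <= (\1_[set p : (R * R) * T | small_set (pts n p.2) t p.1] p)%:E :> \bar R)%E.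
  by rewrite lee_fin.
have := @measurable_fun_fubini_tonelli_F _ _ plane T R P _ mI I0.
congr measurable_fun; apply/funext => z; rewrite /fubini_F.
have mA := measurable_small_at n t z.
transitivity (\int[P]_w (\1_(small_at n t z) w)%:E)%E; last first.
  by rewrite integral_indic// setIT.
by apply: eq_integral => w _; congr _%:E.
Qed.

Let measurable_pt (a : R * R) : measurable [set a].
Proof.
rewrite (_ : [set a] = [set a.1] `*` [set a.2]); first exact: measurableX.
by apply/seteqP; split => [[x y] -> //|[x y] [/= -> ->]]; rewrite -surjective_pairing.
Qed.

(** If both coordinates of 1/(z - y) were almost surely constant, so would be y, since inversion
    (with 0 sent to 0) is injective. *)
Lemma nondegenerate_kernel z : (forall a, mu [set a] != 1%E) ->
  (forall v, mu [set y | kre z y = v] != 1%E) \/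
  (forall v, mu [set y | kim z y = v] != 1%E).
Proof.
move=> nd; have [|/existsNP[v1 /negP/negPn/eqP E1]] :=
  pselect (forall v, mu [set y | kre z y = v] != 1%E); first by left.
right=> v2; apply/negP => /eqP E2.
have mE (g : R * R -> R) v : measurable_fun setT g -> measurable [set y | g y = v].
  move=> mg; rewrite -[X in measurable X]setTI; exact: (mg measurableT [set v]).
have m1 := mE _ v1 (measurable_kreR z); have m2 := mE _ v2 (measurable_kimR z).
set S := [set y | kre z y = v1] `&` [set y | kim z y = v2].
have mS : measurable S by exact: measurableI.
have muS : mu S = 1%E.
  apply/eqP; rewrite eq_le probability_le1//=.
  have : (mu (~` S) <= 0)%E.
    have h : (mu (~` [set y | kre z y = v1] `|` ~` [set y | kim z y = v2]) <=
        mu (~` [set y | kre z y = v1]) + mu (~` [set y | kim z y = v2]))%E.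
      by apply: measureU2; exact: measurableC.
    by rewrite setCI (le_trans h)// !probability_setC// E1 E2 subee// adde0.
  by rewrite probability_setC// lee_subel_addr// add0e.
have [a Sa] : S !=set0.
  by apply/set0P/eqP => S0; move: muS; rewrite S0 measure0 => /eqP; rewrite eq_sym onee_eq0.
have /negP := nd a; apply; rewrite eq_le probability_le1//= -muS le_measure ?inE//.
move=> y [/= y1 y2]; move: Sa => [/= a1 a2].
have : (toC z - toC y)^-1 = (toC z - toC a)^-1 by rewrite !inv_toC y1 y2 a1 a2.
by move=> /invr_inj /(addrI (toC z)) /oppr_inj /toC_inj.
Qed.

(** Anticoncentration is applied to the random points, in whichever coordinate of the kernel is
    nonconstant; the deterministic points form the shift [c]. *)
Lemma P_small_le z (eta : R) : (forall a, mu [set a] != 1%E) -> 0 < eta ->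
  exists N, forall n, (N <= n)%N -> (P (small_at n (root33 n ^+ 16) z) <= eta%:E)%E.
Proof.
move=> nd eta0.
have key (g : R * R -> R) : measurable_fun setT g -> (forall v, mu [set y | g y = v] != 1%E) ->
    (forall n t w, small_at n t z w -> `|\sum_(x <- pts n w) g x| <= t) ->
    exists N, forall n, (N <= n)%N -> (P (small_at n (root33 n ^+ 16) z) <= eta%:E)%E.
  move=> mg ng sg; have [K K0 HK] := anticoncentration mX lawX indX mg eta0 ng.
  (* From b >= 1 + 2 K follow K <= b <= b^16 and K b^32 <= b^33/2 = n/2 <= n - k n. *)
  have [N1 H1] := half_le; have [N2 H2] := root33_ge (1 + 2 * K).
  exists (maxn N1 N2) => n; rewrite geq_max => /andP[/H1 {}H1 /H2].
  set b := root33 n => bK; have b1 : 1 <= b by lra.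
  have {}HK := HK (n - k n)%N (\sum_(l < k n) g (xi n l)) (b ^+ 16).
  have mS : measurable [set x | `|\sum_(j < n - k n) g (X j x) +
      \sum_(l < k n) g (xi n l)| <= b ^+ 16].
    apply: measurable_le_fun; apply: measurableT_comp => //.
    apply: measurable_funD => //; apply: measurable_sum => j; exact: measurableT_comp.
  rewrite -[leLHS]fineK ?fin_num_measure//; last exact: measurable_small_at.
  rewrite lee_fin; apply: le_trans (HK _ _).
  - rewrite fine_le ?fin_num_measure//; try exact: measurable_small_at.
    rewrite le_measure ?inE//; first exact: measurable_small_at.
    by move=> w /sg; rewrite sum_pts.
  - apply: (@le_trans _ _ b); first lra.
    by rewrite -{1}[b]expr1 ler_weXn2l.
  - apply: le_trans H1; rewrite -(root33K n) -/b -exprM ler_pdivlMr// mulrAC.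
    have -> : b ^+ 33 = b * b ^+ (16 * 2) by rewrite -exprS.
    apply: ler_wpM2r; first by apply: exprn_ge0; lra.
    lra.
case: (nondegenerate_kernel z nd) => ng.
- by apply: (key (kre z) (measurable_kreR z) ng) => n t w [].
- by apply: (key (kim z) (measurable_kimR z) ng) => n t w [].
Qed.

(* If [mu] is a point mass at [a], the sum of [1/(z - X_j)] is deterministic of
   order [n], and only the deterministic points can compensate it. *)
Lemma small_at_dirac a t (B D : R) n z : D = 2 * B + `|a.1| + `|a.2| + 1 -> 0 <= B ->
    n%:R / 2 <= (n - k n)%:R :> R -> t + (k n)%:R <= n%:R / (8 * D) ->
    mu [set a] = 1%E -> box B z -> z <> a ->
    W32 [seq xi n l | l <- index_iota 0 (k n)] z < n%:R / (8 * D) ->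
  P (small_at n t z) = 0%E.
Proof.
move=> eD B0 hn htk mua zB za hW.
have D0 : 0 < D by rewrite eD ltr_wpDl// !addr_ge0 ?mulr_ge0.
pose N := \bigcup_j (~` (X j @^-1` [set a])).
have mXa j : measurable (X j @^-1` [set a]).
  by rewrite -[X in measurable X]setTI; apply: mX => //; exact: measurable_pt.
have nN : P.-negligible N.
  apply: negligible_bigcup => j; apply/negligibleP; first exact: measurableC.
  have : P (~` (X j @^-1` [set a])) = 0%E.
    by rewrite probability_setC// lawX ?mua ?subee//; exact: measurable_pt.
  by [].
apply/measure_negligible; first exact: measurable_small_at.
apply: negligibleS nN => w [s1 s2]; apply: contrapT => Nw.
have Xa j : X j w = a by apply: contrapT => h; apply: Nw; exists j.
have sumE (g : R * R -> R) : (forall y, `|g y| <= invdist z y) ->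
    `|\sum_(x <- pts n w) g x| <= t ->
    (n - k n)%:R * `|g a| <= t + (k n)%:R + W32 [seq xi n l | l <- index_iota 0 (k n)] z.
  move=> gi; rewrite sum_pts.
  under eq_bigr do rewrite Xa.
  rewrite sumr_const card_ord -[g a *+ _]mulr_natl => h.
  have -> : (n - k n)%:R * `|g a| = `|(n - k n)%:R * g a| by rewrite normrM normr_nat.
  rewrite -[X in `|X|](addrK (\sum_(l < k n) g (xi n l))).
  rewrite (le_trans (ler_normB _ _))// -addrA lerD//.
  rewrite (le_trans (ler_norm_sum _ _ _))// /W32 big_map big_mkord.
  rewrite -[X in X%:R + _]card_ord -sumr_const -big_split/= ler_sum// => l _.
  by rewrite (le_trans (gi _))// invdist_le.
have h1 := sumE _ (kre_le z) s1; have h2 := sumE _ (kim_le z) s2.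
have h3 := invdist_ge_box zB za; rewrite -eD in h3.
have h4 := invdist_le_kre_kim z a.
have m0 : 0 <= (n - k n)%:R :> R by [].
have h5 : (n - k n)%:R * D^-1 <= (n - k n)%:R * (`|kre z a| + `|kim z a|).
  by rewrite ler_wpM2l// (le_trans h3).
have h6 : n%:R / 2 * D^-1 <= (n - k n)%:R * D^-1.
  by rewrite ler_wpM2r// invr_ge0 ltW.
(* Adding the two coordinates, (n - k)/D is at most 2 (t + k + W32), which is below 4 n/(8 D) = n/(2
   D); but n - k is at least n/2. *)
have e8 : n%:R / (8 * D) = n%:R / 2 * D^-1 / 4 by field; rewrite gt_eqF.
rewrite e8 in htk hW; rewrite mulrDr in h5; lra.
Qed.

(** By [small_at_dirac] the probability vanishes unless z = a or [W32] of the deterministic points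
    is of order n. The latter set has area of order (k n)/n by Markov, which tends to 0. *)
Lemma integral_P_small_dirac a (B eta : R) : mu [set a] = 1%E -> 0 <= B -> 0 < eta ->
  exists N, forall n, (N <= n)%N ->
    (\int[area]_(z in box B) P (small_at n (root33 n ^+ 16) z) <= eta%:E)%E.
Proof.
move=> mua B0 eta0.
pose D := 2 * B + `|a.1| + `|a.2| + 1.
have D0 : 0 < D by rewrite ltr_wpDl// !addr_ge0 ?mulr_ge0.
have [N1 H1] := half_le; have [N2 H2] := root33_ge (1 + 16 * D).
have [|N3 H3] := @k_le (16 * D)^-1; first by rewrite invr_gt0 mulr_gt0.
have K0 := K32_gt0 B.
have [|N4 H4] := @k_le (eta / (8 * D * K32 B)).
  by rewrite divr_gt0// !mulr_gt0.
exists (maxn (maxn N1 N2) (maxn N3 N4)) => n.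
rewrite !geq_max => /andP[/andP[/H1 {}H1 /H2 {}H2] /andP[/H3 {}H3 /H4 {}H4]].
set b := root33 n in H2 *; have b1 : 1 <= b by lra.
have n0 : 0 < n%:R :> R by rewrite -(root33K n) exprn_gt0// -/b; lra.
set s := [seq xi n l | l <- index_iota 0 (k n)].
have htk : b ^+ 16 + (k n)%:R <= n%:R / (8 * D).
  have bt : b ^+ 16 <= n%:R / (16 * D).
    rewrite ler_pdivlMr ?mulr_gt0// -(root33K n) -/b.
    have -> : b ^+ 33 = b ^+ 16 * (b ^+ 16 * b) by rewrite -exprSr -exprD.
    rewrite ler_wpM2l ?exprn_ge0//; [lra|].
    rewrite (@le_trans _ _ b)//; first lra.
    by rewrite ler_peMl ?exprn_ege1//; lra.
  have -> : n%:R / (8 * D) = n%:R / (16 * D) + (16 * D)^-1 * n%:R.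
    by field; rewrite gt_eqF.
  exact: lerD.
pose S : set plane := [set z | n%:R / (8 * D) <= W32 s z].
have mS : measurable S.
  by apply: measurable_ge_fun; exact: measurable_W32.
have mSB : measurable (box B `&` S : set plane).
  by apply: measurableI => //; exact: measurable_box.
pose V : set plane := (box B `&` S) `|` [set a].
have mV : measurable V by apply: measurableU => //; exact: measurable_pt.
apply: (@le_trans _ _ (\int[area]_(z in box B) (\1_V z)%:E)%E).
  apply: (@ge0_le_integral _ plane R area) => //.
  - exact: measurable_box.
  - apply: measurable_funTS; exact: (measurable_P_small n).
  - by apply/measurable_EFinP/measurable_funTS; exact: measurable_indic.
  move=> z zB; rewrite indicE; case: (boolP (z \in V)) => [_|/negP zV].
    exact: probability_le1 (measurable_small_at _ _ _).
  rewrite (@small_at_dirac a _ B D)//; first by move=> e; apply: zV; rewrite inE; right.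
  rewrite ltNge; apply/negP => h; apply: zV; rewrite inE; left; split => //.
rewrite integral_indic//; last exact: measurable_box.
apply: (@le_trans _ _ (area (box B `&` S) + area [set a])%E).
  apply: (@le_trans _ _ (area V)).
    apply: le_measure; rewrite ?inE//.
    by apply: measurableI => //; exact: measurable_box.
  by apply: measureU2 => //; exact: measurable_pt.
have -> : area [set a] = 0%E.
  apply/measure_negligible; first exact: measurable_pt.
  by apply: negligibleS (area_seq [:: a]) => y ->; rewrite /= mem_head.
rewrite adde0 (le_trans (area_W32_le _ _ _))//; first by rewrite divr_gt0 ?mulr_gt0.
rewrite lee_fin size_map size_iota subn0 ler_pdivrMr ?divr_gt0 ?mulr_gt0//.
have -> : eta * (n%:R / (8 * D)) = eta / (8 * D * K32 B) * n%:R * K32 B.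
  by field; rewrite !gt_eqF.
by rewrite ler_wpM2r// ltW.
Qed.

(** Without a point mass of full measure, the pointwise limits integrate by dominated convergence on
    the box; a point mass has no fluctuations and is treated separately. *)
Lemma integral_P_small (B eta : R) : 0 <= B -> 0 < eta ->
  exists N, forall n, (N <= n)%N ->
    (\int[area]_(z in box B) P (small_at n (root33 n ^+ 16) z) <= eta%:E)%E.
Proof.
move=> B0 eta0.
have [nd|/existsNP[a /negP/negPn/eqP mua]] := pselect (forall a, mu [set a] != 1%E);
  last exact: integral_P_small_dirac mua B0 eta0.
have mB : measurable (box B : set plane) by exact: measurable_box.
have fB : (area (box B) < +oo)%E by exact: area_box_lty.
have pf n z : P (small_at n (root33 n ^+ 16) z) \is a fin_num.
  by apply: fin_num_measure; exact: measurable_small_at.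
have : (\int[area]_(z in box B) P (small_at n (root33 n ^+ 16) z))%E @[n --> \oo] -->
    (\int[area]_(z in box B) (cst 0 z))%E.
  apply: (@dominated_cvg _ plane R area _ mB _ _ (cst 1%E)) => //.
  - move=> n; apply: measurable_funTS; exact: (measurable_P_small n).
  - move=> z _; apply/fine_cvgP; split; first by near=> n; exact: pf.
    apply/cvgrPdist_le => e e0; have [N HN] := P_small_le z nd e0.
    exists N => // n /HN h; rewrite sub0r normrN ger0_norm ?fine_ge0//=.
    by rewrite -lee_fin fineK.
  - apply: (@integrable_box R (cst 1) B 1) => [|c]; [exact: measurable_cst|by rewrite /= normr1].
  - move=> n z _; rewrite gee0_abs//.
    exact: probability_le1 (measurable_small_at _ _ _).
rewrite integral0 => /fine_cvgP[[N1 _ H1] /cvgrPdist_le/(_ _ eta0)[N2 _ H2]].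
exists (maxn N1 N2) => n; rewrite geq_max => /andP[/H1/= {}H1 /H2/= {}H2].
rewrite -(fineK H1) lee_fin (le_trans _ H2)// sub0r normrN ler_norm//.
Unshelve. all: by end_near.
Qed.

End random_points.

(** * Critical points of random polynomials *)

Lemma crit_measure_intE {R : realType} (s : seq (R * R)) f : (0 < size s)%N ->
  crit_measure_int (\prod_(x <- s) ('X - (toC x)%:P)) f = avg (crit_points s) f.
Proof.
move=> s0; have := @size_deriv_prodXsub _ (map toC s).
rewrite big_map size_map => sz.
by rewrite /avg (size_crit_points s0) /crit_measure_int /root_measure_int sz big_map.
Qed.

(** The two terms of [crit_bound] are at most 4/b and 2/b, using n - 1 >= n/2. *)
Lemma crit_bound_le {R : realType} (n : nat) (b : R) : (1 < n)%N -> 1 <= b ->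
  n%:R = b ^+ 33 -> crit_bound n (b ^+ 12) (b ^+ 16) <= 6 / b.
Proof.
move=> n1 b1 nb; have b0 : 0 < b by lra.
have n2 : 2 <= n%:R :> R by rewrite ler_nat.
have bc : n%:R = b * b ^+ 32 by rewrite nb exprS.
have nh : n%:R / 2 <= n%:R - 1 :> R by lra.
have c1 : 1 <= b ^+ 32 by exact: exprn_ege1.
have e6 : 6 / b = 4 / b + 2 / b by field; rewrite gt_eqF.
rewrite /crit_bound e6; apply: lerD.
- rewrite ler_pdivrMr; last by rewrite mulr_gt0; lra.
  apply: (@le_trans _ _ (4 / b * (n%:R * (n%:R / 2)))); last first.
    by rewrite ler_wpM2l ?divr_ge0 ?(ltW b0)// ler_wpM2l//.
  have -> : 4 / b * (n%:R * (n%:R / 2)) = 2 * b ^+ 32 * n%:R :> R.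
    by rewrite {1}bc; field; rewrite gt_eqF.
  have h : b ^+ 12 ^+ 3 <= b ^+ 32 * n%:R.
    by rewrite nb -exprM -exprD ler_weXn2l.
  have : n%:R <= b ^+ 32 * n%:R :> R by rewrite ler_peMl.
  lra.
- rewrite ler_pdivrMr; last by rewrite mulr_gt0 ?exprn_gt0//; lra.
  apply: (@le_trans _ _ (2 / b * (n%:R / 2 * b ^+ 16))); last first.
    by rewrite ler_wpM2l ?divr_ge0 ?(ltW b0)// ler_wpM2r// exprn_ge0// ltW.
  have -> : 2 / b * (n%:R / 2 * b ^+ 16) = b ^+ 32 * b ^+ 16.
    by rewrite bc; field; rewrite gt_eqF.
  by rewrite -exprM -exprD.
Qed.

(** The previous estimates with tau = b^12 and t = b^16: the good set contributes through 2 (6/b),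
    and n K32/tau^3 = K32/b^3 is absorbed into K32/b. *)
Lemma avg_crit_points_le {R : realType} (s : seq (R * R)) (f : R * R -> R)
    (A e M osc b l beta : R) :
    (1 < size s)%N -> 1 <= b -> (size s)%:R = b ^+ 33 ->
    0 <= A -> 0 < e -> 0 <= osc -> 0 < l ->
    measurable_fun setT f -> (forall z, `|f z| <= M) ->
    (forall c w, box A c -> sq e c w -> `|f w - f c| <= osc) ->
    (area (box (A + e)%R `&` small_set s (b ^+ 16)) <= beta%:E)%E ->
  `|avg (crit_points s) f - avg s f| <=
  2 * osc + 2 * M * (1 - avg s (\1_(box (A - e)))) + 2 * M *
  (((12 * (2 * (A + e)) ^+ 2 + 4 * l ^+ 2 * K32 (A + e)) / b +
    4 * l ^+ 2 * beta + 4 * l^-1 * K32 (A + e)) / (pi * e)).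
Proof.
move=> s1 b1 sb A0 e0 osc0 l0 mf fM fosc small.
have b0 : 0 < b by lra.
have B0 : 0 <= A + e by lra.
apply: avg_diff_le => //; first by rewrite size_crit_points ?(ltnW s1)// -subn1 subn_gt0.
  exact: ltnW.
apply: le_trans (integral_transform_norm_le s1 B0 (exprn_gt0 12 b0) _ l0 small) _.
  exact: exprn_gt0.
rewrite lee_fin; have cb := crit_bound_le s1 b1 sb.
set K := K32 (A + e); have K0 : 0 < K by exact: K32_gt0.
have Kb : (size s)%:R * K / (b ^+ 12) ^+ 3 <= K / b.
  rewrite sb -exprM ler_pdivrMr ?exprn_gt0//.
  have -> : K / b * b ^+ (12 * 3) = b ^+ 35 * K.
    by rewrite (exprS b 35); field; rewrite gt_eqF.
  by rewrite ler_wpM2r ?(ltW K0)// ler_weXn2l.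
have h1 : 2 * crit_bound (size s) (b ^+ 12) (b ^+ 16) * (2 * (A + e)) ^+ 2 <=
    12 * (2 * (A + e)) ^+ 2 / b.
  have -> : 12 * (2 * (A + e)) ^+ 2 / b = 2 * (6 / b) * (2 * (A + e)) ^+ 2.
    by field; rewrite gt_eqF.
  by rewrite ler_wpM2r ?sqr_ge0// ler_wpM2l.
have h2 : 4 * l ^+ 2 * ((size s)%:R * K / (b ^+ 12) ^+ 3) <= 4 * l ^+ 2 * (K / b).
  by rewrite ler_wpM2l// mulr_ge0 ?sqr_ge0.
rewrite [(12 * _ + _) / b]mulrDl -[4 * l ^+ 2 * K / b]mulrA.
rewrite [4 * l ^+ 2 * (_ + beta)]mulrDr; lra.
Qed.

Section random_polynomials.
Context {R : realType} (mu : probability (R * R)%type R).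
Context (d : measure_display) (T : measurableType d) (P : probability T R).
Context (X : nat -> T -> R * R) (k : nat -> nat) (xi : nat -> nat -> R * R).
Hypothesis mX : forall j, measurable_fun setT (X j).
Hypothesis lawX : forall j (A : set (R * R)), measurable A -> P (X j @^-1` A) = mu A.
Hypothesis indX : mutually_independent P X.
Hypothesis kn : forall n, (k n <= n)%N.
Hypothesis ko : (fun n => (k n)%:R / n%:R : R) @ \oo --> (0 : R).
Local Notation pts := (pts X k xi).
Local Notation small_area := (small_area X k xi).

(** Both the added points and the change of normalization weigh at most (k n)/n. *)
Lemma avg_pts_le n w (h : R * R -> R) M : (forall y, `|h y| <= M) -> (0 < n - k n)%N ->
  `|avg (pts n w) h - (n - k n)%:R^-1 * \sum_(j < n - k n) h (X j w)| <=
  2 * M * ((k n)%:R / n%:R).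
Proof.
move=> hM m0; rewrite /avg size_pts// sum_pts; set m := (n - k n)%N in m0 *.
have M0 : 0 <= M by exact: le_trans (hM (0, 0)).
have nm : n%:R = m%:R + (k n)%:R :> R by rewrite -natrD subnK.
have mp : 0 < m%:R :> R by rewrite ltr0n.
have k0 : 0 <= (k n)%:R :> R by [].
have n0 : 0 < n%:R :> R by rewrite nm; lra.
have bd (N : nat) (g : 'I_N -> R * R) : `|\sum_(j < N) h (g j)| <= N%:R * M.
  rewrite (le_trans (ler_norm_sum _ _ _))// -[X in X%:R * _]card_ord -sum1_card.
  by rewrite natr_sum mulr_suml ler_sum// => j _; rewrite mul1r.
have b1 := bd m (fun j => X j w); have b2 := bd (k n) (fun l => xi n l).
move: b1 b2; set S1 := \sum_(j < m) _; set S2 := \sum_(l < k n) _ => b1 b2.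
have -> : n%:R^-1 * (S1 + S2) - m%:R^-1 * S1 =
    n%:R^-1 * S2 - (k n)%:R / n%:R * (m%:R^-1 * S1).
  by rewrite nm; field; rewrite -nm !gt_eqF.
have -> : 2 * M * ((k n)%:R / n%:R) =
    n%:R^-1 * ((k n)%:R * M) + (k n)%:R / n%:R * (m%:R^-1 * (m%:R * M)).
  by field; rewrite !gt_eqF.
rewrite (le_trans (ler_normB _ _))// !normrM !normfV !normr_nat.
by rewrite lerD// ler_wpM2l ?mulr_ge0 ?invr_ge0// ler_wpM2l// invr_ge0.
Qed.

Lemma empirical_mean_le (h : R * R -> R) M theta delta :
    measurable_fun setT h -> (forall y, `|h y| <= M) -> 0 < theta -> 0 < delta ->
  exists N, forall n, (N <= n)%N -> fine (P [set w | theta <=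
    `|(n - k n)%:R^-1 * (\sum_(j < n - k n) h (X j w)) - Ex mu h|]) <= delta.
Proof.
move=> mh hM th0 d0; have [N1 H1] := half_le kn ko.
pose C := (2 * M) ^+ 2 / (theta ^+ 2 * delta); have t2 : 0 < theta ^+ 2 by exact: exprn_gt0.
have C0 : 0 <= C by rewrite divr_ge0 ?sqr_ge0// mulr_ge0// ltW.
exists (maxn N1 (Num.truncn (2 * C)).+1) => n; rewrite geq_max => /andP[/H1 {}H1 nC].
have {}nC : 2 * C < n%:R.
  by rewrite (lt_le_trans (Num.Theory.truncnS_gt _))// ler_nat.
have mC : C < (n - k n)%:R by lra.
have m0 : 0 < (n - k n)%:R :> R by lra.
apply: le_trans (@law_large_numbers _ _ _ _ _ _ mX lawX indX _ h M theta _ _ _ hM) _ => //.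
- by rewrite -(ltr0n R).
- by split => //; exists M.
rewrite ler_pdivrMr ?mulr_gt0//; move/ltW: mC.
rewrite /C ler_pdivrMr ?mulr_gt0//; lra.
Qed.

Lemma small_area_fin n t B w : small_area n t B w \is a fin_num.
Proof.
rewrite ge0_fin_numE//; apply: le_lt_trans (area_box_lty B).
apply: le_measure; rewrite ?inE.
- by apply: measurableI; [exact: measurable_box|exact: measurable_small_set].
- exact: measurable_box.
- exact: subIsetl.
Qed.

(** Markov's inequality for the area, whose expectation is eventually at most [beta * delta]. *)
Lemma P_small_area_le (B beta delta : R) : 0 <= B -> 0 < beta -> 0 < delta ->
  exists N, forall n, (N <= n)%N ->
    fine (P [set w | beta <= fine (small_area n (root33 n ^+ 16) B w)]) <= delta.
Proof.
move=> B0 be0 d0.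
have [N HN] := integral_P_small xi mX lawX indX kn ko B0 (mulr_gt0 be0 d0).
exists N => n /HN {HN}; rewrite -integral_small_area// => H.
have mf : measurable_fun setT (fun w => fine (small_area n (root33 n ^+ 16) B w)).
  by apply: measurableT_comp => //; exact: measurable_small_area.
have mS := measurable_ge_fun beta mf.
have := @markov_ge0 _ T R P setT _ beta measurableT mf (fun w => fine_ge0 (measure_ge0 _ _)) be0.
rewrite setTI; under eq_integral do rewrite fineK ?small_area_fin//.
move=> /le_trans /(_ H) {}H.
set S := [set w | _] in mS H *; have F : P S \is a fin_num by exact: fin_num_measure.
have {}H : (beta%:E * P S <= (beta * delta)%:E)%E by exact: H.
by move: H; rewrite -(fineK F) -EFinM lee_fin ler_pM2l.
Qed.

End random_polynomials.

(** Outside three events of small probability (law of large numbers for [f], the same for the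
    indicator of a box, large area of the small set), the estimate of [avg_crit_points_le] is
    deterministic. *)
Lemma crit_measure_cvg {R : realType} (mu : probability (R * R)%type R)
    (d : measure_display) (T : measurableType d) (P : probability T R)
    (X : nat -> T -> R * R) (k : nat -> nat) (xi : nat -> nat -> R * R) (f : R * R -> R) :
    (forall j, measurable_fun setT (X j)) ->
    (forall j (A : set (R * R)), measurable A -> P (X j @^-1` A) = mu A) ->
    mutually_independent P X -> (forall n, (k n <= n)%N) ->
    (fun n => (k n)%:R / n%:R : R) @ \oo --> (0 : R) -> bounded_continuous f ->
  cvg_in_probability P (fun n w => crit_measure_int
    (\prod_(x <- pts X k xi n w) ('X - (toC x)%:P)) f) (Ex mu f).
Proof.
move=> mX lawX indX kn ko [cf [M' fM']] eps eps0.
pose M := `|M'| + 1; have M0 : 0 < M by rewrite ltr_wpDl.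
have fM z : `|f z| <= M.
  by rewrite (le_trans (fM' z))// (le_trans (ler_norm _))// lerDl.
have mf := continuous_measurable_plane cf.
pose e1 := eps / (16 * M); have e10 : 0 < e1 by rewrite divr_gt0 ?mulr_gt0.
have [A A0 muA] := box_exhaust mu e10.
have [e [e0 e_le1 He]] : exists e, [/\ 0 < e, e <= 1 &
    forall c w, box (A + 1) c -> sq e c w -> `|f w - f c| <= eps / 16].
  by apply: sq_uniform_continuity => //; rewrite divr_gt0.
(* The lemmas are applied with outer box [A + e], so that their inner box is [box A]; the transforms
   are then integrated over [box (A + e + e)]. *)
pose B := A + e + e; have B0 : 0 <= B by rewrite /B; lra.
have K0 : 0 < K32 B by exact: K32_gt0.
have pi0 : 0 < pi :> R by exact: pi_gt0.
(* The integral of the transforms has to stay below [iota]. Its terms are made at most iota/4 in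
   this order: [l] fixes the truncation tail, [beta] is then adapted to l^2, and finally n is large
   enough for C/b. *)
pose iota := pi * e * e1; have io0 : 0 < iota.
  by apply: (mulr_gt0 _ e10); exact: mulr_gt0.
pose l := 16 * K32 B / iota; have l0 : 0 < l by apply: (divr_gt0 _ io0); exact: mulr_gt0.
pose beta := iota / (16 * l ^+ 2).
have be0 : 0 < beta by apply: (divr_gt0 io0); rewrite mulr_gt0// exprn_gt0.
pose C := 12 * (2 * B) ^+ 2 + 4 * l ^+ 2 * K32 B.
have C0 : 0 <= C.
  apply: addr_ge0; first by rewrite mulr_ge0 ?sqr_ge0.
  by apply: mulr_ge0 (ltW K0); rewrite mulr_ge0 ?sqr_ge0.
have [N1 H1] := root33_ge (1 + 4 * C / iota).
have [|N2 H2] := @k_le R k kn ko (e1 / 2); first by rewrite divr_gt0.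
have [N3 H3] := half_le kn ko.
pose n0 := maxn (maxn N1 N2) (maxn N3 2).
pose mean (h : R * R -> R) n w := (n - k n)%:R^-1 * \sum_(j < n - k n) h (X j w).
pose E1 n := [set w | eps / 16 <= `|mean f n w - Ex mu f|].
pose E2 n := [set w | e1 <= `|mean (\1_(box A)) n w - Ex mu (\1_(box A))|].
pose E3 n := [set w | beta <= fine (small_area X k xi n (root33 n ^+ 16) B w)].
have m1 : measurable_fun setT (\1_(box A) : R * R -> R).
  by apply: measurable_indic; exact: measurable_box.
have b1 z : `|(\1_(box A) : R * R -> R) z| <= 1.
  by rewrite indicE ger0_norm// lern1 leq_b1.
have mmean h n : measurable_fun setT h -> measurable_fun setT (mean h n).
  move=> mh; apply: measurable_funM => //; apply: measurable_sum => j.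
  exact: measurableT_comp.
have mdev h n a c : measurable_fun setT h -> measurable [set w | a <= `|mean h n w - c|].
  move=> mh; apply: measurable_ge_fun; apply: measurableT_comp => //.
  by apply: measurable_funB => //; exact: mmean.
have mE1 n : measurable (E1 n) by exact: mdev.
have mE2 n : measurable (E2 n) by exact: mdev.
have mE3 n : measurable (E3 n).
  apply: measurable_ge_fun; apply: measurableT_comp => //.
  exact: measurable_small_area.
(* For the finitely many n before [n0] the envelope is the whole space. *)
exists (fun n => if (n < n0)%N then setT else E1 n `|` E2 n `|` E3 n).
split; [|split].
- by move=> n; case: ifP => // _; apply: measurableU => //; exact: measurableU.
- move=> n w; case: ifPn => // /=; rewrite -leqNgt /n0 !geq_max.
  move=> /andP[/andP[/H1 bC /H2 kn1] /andP[/H3 mh n2]] /= dev.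
  apply: contrapT => /not_orP[/not_orP[F1 F2] F3].
  move/negP: F1; move/negP: F2; move/negP: F3.
  rewrite -!ltNge => F3 F2 F1; move: dev; apply/negP; rewrite -ltNge.
  set b := root33 n in bC F3; have Ci0 : 0 <= 4 * C / iota.
    by apply: (divr_ge0 _ (ltW io0)); exact: mulr_ge0.
  have bb1 : 1 <= b by rewrite (le_trans _ bC)// lerDl.
  have nR2 : 2 <= n%:R :> R by rewrite ler_nat.
  have m0 : (0 < n - k n)%N.
    by rewrite -(ltr0n R); move: mh nR2; clear; lra.
  have sz := size_pts X xi kn n w.
  rewrite crit_measure_intE ?sz 1?ltnW//.
  have small : (area (box (A + e + e)%R `&` small_set (pts X k xi n w) (b ^+ 16)) <= beta%:E)%E.
    have F : (small_area X k xi n (b ^+ 16) B w <= beta%:E)%E.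
      by rewrite -(fineK (small_area_fin X k xi n _ _ _)) lee_fin ltW.
    exact: F.
  have := @avg_crit_points_le _ (pts X k xi n w) f (A + e) e M (eps / 16) b l beta.
  rewrite sz => /(_ n2 bb1 (esym (root33K n)) _ e0 _ l0 mf fM _ small) H.
  have {}H := H (addr_ge0 A0 (ltW e0)) (divr_ge0 (ltW eps0) (ler0n _ 16)).
  have {}H : `|avg (crit_points (pts X k xi n w)) f - avg (pts X k xi n w) f| <=
      2 * (eps / 16) + 2 * M * (1 - avg (pts X k xi n w) (\1_(box A))) +
      2 * M * ((C / b + 4 * l ^+ 2 * beta + 4 * l^-1 * K32 B) / (pi * e)).
    have -> : A = A + e - e by rewrite addrK.
    apply: H => c w' /boxP[c1 c2]; apply: He; apply/boxP.
    by split; [apply: le_trans c1 _|apply: le_trans c2 _]; rewrite lerD2l.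
  have kn2 : (k n)%:R / n%:R <= e1 / 2 by rewrite ler_pdivrMr// (lt_le_trans _ nR2).
  have G1 := avg_pts_le X xi kn w fM m0; have G2 := avg_pts_le X xi kn w b1 m0.
  have {}G1 : `|avg (pts X k xi n w) f - mean f n w| <= M * e1.
    apply: le_trans G1 _; have -> : M * e1 = 2 * M * (e1 / 2) by field.
    by rewrite ler_wpM2l// mulr_ge0// ltW.
  have {}G2 : `|avg (pts X k xi n w) (\1_(box A)) - mean (\1_(box A)) n w| <= e1.
    by apply: le_trans G2 _; rewrite mulr1 mulrC -ler_pdivlMr.
  have EA : Ex mu (\1_(box A)) = fine (mu (box A)) by apply: Ex_indic; exact: measurable_box.
  (* One [e1] each for the mass of [mu] outside the box, the deviation of the empirical mean, and
     the deterministic points. *)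
  have a1 : 1 - avg (pts X k xi n w) (\1_(box A)) <= 3 * e1.
    move: G2 F2 muA; rewrite EA ler_norml ltr_norml; clear.
    by move=> /andP[? ?] /andP[? ?] ?; lra.
  have Me1 : M * e1 = eps / 16 by rewrite /e1; field; rewrite gt_eqF.
  have I1 : C / b + 4 * l ^+ 2 * beta + 4 * l^-1 * K32 B <= iota.
    have -> : 4 * l ^+ 2 * beta = iota / 4 by rewrite /beta; field; rewrite gt_eqF.
    have lK (x y : R) : 0 < x -> 0 < y -> 4 * (16 * x / y)^-1 * x = y / 4.
      by move=> x0 y0; field; rewrite !gt_eqF.
    rewrite (lK _ _ K0 io0).
    have CiL : 4 * C <= b * iota.
      by rewrite -ler_pdivrMr// (le_trans _ bC)// lerDr.
    have : C / b <= iota / 4.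
      rewrite ler_pdivrMr; last by rewrite (lt_le_trans ltr01).
      by move: CiL; clear; lra.
    by move: io0; clear; lra.
  have I2 : 2 * M * ((C / b + 4 * l ^+ 2 * beta + 4 * l^-1 * K32 B) / (pi * e)) <=
      2 * (M * e1).
    have pe0 : 0 < pi * e by exact: mulr_gt0.
    rewrite -mulrA ler_pM2l// ler_pM2l// (ler_pdivrMr _ _ pe0) [e1 * _]mulrC.
    exact: I1.
  have I3 : 2 * M * (1 - avg (pts X k xi n w) (\1_(box A))) <= 6 * (M * e1).
    have -> : 6 * (M * e1) = 2 * M * (3 * e1) by ring.
    by rewrite ler_wpM2l// mulr_ge0// ltW.
  rewrite Me1 in G1 I2 I3.
  (* In units of eps/16 the errors are 2 (oscillation), 6 (outside the box), 2 (transforms), 1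
     (deterministic points) and 1 (empirical mean), in total 12 < 16. *)
  move: H G1 F1; rewrite !ler_norml !ltr_norml.
  move: I2 I3 eps0; clear; move=> ? ? ? /andP[? ?] /andP[? ?] /andP[? ?].
  by apply/andP; split; lra.
- apply/fine_cvgP; split.
    near=> n; apply: fin_num_measure; case: ifP => // _.
    by apply: measurableU => //; exact: measurableU.
  apply/cvgrPdist_le => delta d0; have d3 : 0 < delta / 3 by rewrite divr_gt0.
  have th0 : 0 < eps / 16 by rewrite divr_gt0.
  have [P1 HP1] := empirical_mean_le mX lawX indX kn ko mf fM th0 d3.
  have [P2 HP2] := empirical_mean_le mX lawX indX kn ko m1 b1 e10 d3.
  have [P3 HP3] := P_small_area_le xi mX lawX indX kn ko B0 be0 d3.
  exists (maxn n0 (maxn P1 (maxn P2 P3))) => // n /=; rewrite !geq_max -!geq_max.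
  rewrite geq_max => /andP[nn0]; rewrite !geq_max.
  move=> /andP[/HP1 h1 /andP[/HP2 h2 /HP3 h3]].
  rewrite ltnNge nn0/= sub0r normrN ger0_norm ?fine_ge0//.
  have U : (P (E1 n `|` E2 n `|` E3 n) <= P (E1 n) + P (E2 n) + P (E3 n))%E.
    have u1 : (P (E1 n `|` E2 n) <= P (E1 n) + P (E2 n))%E by exact: measureU2.
    have u2 : (P (E1 n `|` E2 n `|` E3 n) <= P (E1 n `|` E2 n) + P (E3 n))%E.
      by apply: measureU2 => //; exact: measurableU.
    by apply: le_trans u2 _; rewrite leeD2r.
  have fP (S : set T) : measurable S -> P S \is a fin_num by exact: fin_num_measure.
  have : fine (P (E1 n `|` E2 n `|` E3 n)) <=
      fine (P (E1 n)) + fine (P (E2 n)) + fine (P (E3 n)).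
    rewrite -!fineD ?fin_numD ?fP//; apply: fine_le => //; rewrite ?fin_numD ?fP//.
    by apply: measurableU => //; exact: measurableU.
  by move: h1 h2 h3; rewrite /E1 /E2 /E3 /mean; clear; lra.
Unshelve. all: by end_near.
Qed.

Unset Implicit Arguments.
Theorem mainTheorem13 (R : realType)
  (mu : probability (R * R)%type R)
  (d : measure_display) (T : measurableType d) (P : probability T R)
  (X : nat -> T -> R * R)
  (k : nat -> nat) (xi : nat -> nat -> R * R) (E : set (R * R)) :
  (* X_1, X_2, ... iid with distribution mu *)
  (forall j, measurable_fun setT (X j)) ->
  (forall j (A : set (R * R)), measurable A -> P (X j @^-1` A) = mu A) ->
  mutually_independent P X ->
  (* 0 <= k_n <= n, k_n = o(n) *)
  (forall n, (k n <= n)%N) ->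
  (fun n => (k n)%:R / n%:R : R) @ \oo --> (0 : R) ->
  (* E is Lebesgue-null in C = R^2 *)
  ((@lebesgue_measure R) \x (@lebesgue_measure R))%E.-negligible E ->
  (forall z, ~ E z ->
     limn_esup (fun n => ((n%:R : R)^-1)%:E *
        \sum_(l < k n) log_minus (cdist z (xi n l)))%E = 0%E) ->
  (* mu'_{p_n} -> mu weakly in probability *)
  forall f : R * R -> R, bounded_continuous f ->
    cvg_in_probability P
      (fun n w => crit_measure_int
         ((\prod_(j < n - k n) ('X - (toC (X j w))%:P)) *
          (\prod_(l < k n) ('X - (toC (xi n l))%:P))) f)
      (fine (\int[mu]_x (f x)%:E)).
Proof.
move=> mX lawX indX kn ko _ _ f /(crit_measure_cvg xi mX lawX indX kn ko) H eps eps0.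
have [B [mB [BY PB]]] := H eps eps0; exists B; split=> //; split=> // n w /=.
by rewrite -prod_pts; exact: BY.
Qed.
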